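(* Let $s\in[0,1]$. On the first-order embedded polynomials, $$(L^{(s)*}+L^{(s)})(\rho^{s/2}a\rho^{(1-s)/2})=-2\gamma\,\rho^{s/2}a\rho^{(1-s)/2}-\mathrm i\kappa\,(1+e^{(2s-1)\beta})\,\rho^{s/2}a^\dagger\rho^{(1-s)/2},$$ $$(L^{(s)*}+L^{(s)})(\rho^{s/2}a^\dagger\rho^{(1-s)/2})=-2\gamma\,\rho^{s/2}a^\dagger\rho^{(1-s)/2}+\mathrm i\overline\kappa\,(1+e^{(1-2s)\beta})\,\rho^{s/2}a\rho^{(1-s)/2}.$$ Consequently, the fundamental eigenvalues of $L^{(s)*}+L^{(s)}$ (its eigenvalues on the span of $\rho^{s/2}a\rho^{(1-s)/2}$ and $\rho^{s/2}a^\dagger\rho^{(1-s)/2}$) are $$-2\gamma\pm2|\kappa|\cosh\Big(\frac{(1-2s)\beta}{2}\Big).$$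
   Context: $\mathsf h=\Gamma(\mathbb C)$ is the one-mode bosonic Fock space with orthonormal basis $(e_n)_{n\ge0}$; $ae_n=\sqrt n\,e_{n-1}$ ($ae_0=0$), $a^\dagger e_n=\sqrt{n+1}\,e_{n+1}$, $N=a^\dagger a$; $W(z)=\exp(za^\dagger-\overline z a)$, $z\in\mathbb C$. $\mathcal B(\mathsf h)$, $\mathcal B_2(\mathsf h)$ are the bounded and Hilbert--Schmidt operators, with $\langle X,Y\rangle_2=\mathrm{Tr}(X^*Y)$. Gaussian QMS: let $\Omega\in\mathbb R$, $\kappa,\zeta,u_1,u_2,v_1,v_2\in\mathbb C$, $\gamma=\frac12\sum_{\ell=1}^2(|v_\ell|^2-|u_\ell|^2)$, and define real-linear operators on $\mathbb C$ by $Zz=(\mathrm i\Omega-\gamma)z+\mathrm i\kappa\overline z$ and $Cz=\sum_{\ell=1}^2\big((|u_\ell|^2+|v_\ell|^2)z+2v_\ell u_\ell\overline z\big)$. The Gaussian quantum Markov semigroup $(\mathcal T_t)_{t\ge0}$ is the weak$^*$-continuous semigroup of normal, completely positive, identity-preserving maps on $\mathcal B(\mathsf h)$ determined by $$\mathcal T_t(W(z))=\exp\Big\{-\tfrac12\int_0^t\Re\big(\overline{e^{rZ}z}\,C(e^{rZ}z)\big)dr+\mathrm i\int_0^t\Re\big(\overline\zeta\,e^{rZ}z\big)dr\Big\}W(e^{tZ}z).$$ Drift matrix: $\mathbf Z=\begin{pmatrix}-\gamma-\Im\kappa&\Re\kappa-\Omega\\ \Re\kappa+\Omega&-\gamma+\Im\kappa\end{pmatrix}$.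 Standing assumptions: $\mathbf Z$ is stable (eigenvalues with strictly negative real parts); the unique normal invariant state $\rho$ is faithful; and (standardization) $\zeta=0$, $\kappa=\mathrm i\tanh(\beta/2)\sum_\ell u_\ell v_\ell$ with $\beta=-\log\big(\sum_\ell|u_\ell|^2/\sum_\ell|v_\ell|^2\big)>0$, so that $\rho=(1-e^{-\beta})e^{-\beta N}$. Induced semigroup: for $s\in[0,1]$, $T_t^{(s)}(\rho^{s/2}X\rho^{(1-s)/2})=\rho^{s/2}\mathcal T_t(X)\rho^{(1-s)/2}$, $X\in\mathcal B(\mathsf h)$, extends uniquely to a strongly continuous contraction semigroup on $\mathcal B_2(\mathsf h)$, with generator $L^{(s)}$. For a polynomial $P$ in $a,a^\dagger$, $\rho^{s/2}P\rho^{(1-s)/2}$ is initially defined on the span of the $e_n$ and denotes its Hilbert--Schmidt extension; all such operators (embedded polynomials) form a space $\mathcal X\subset\operatorname{Dom}L^{(s)}\cap\operatorname{Dom}L^{(s)*}$, on which $L^{(s)*}+L^{(s)}$ is defined as the sum. *)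

(* Defs.v *)
From Stdlib Require Export Reals Factorial.
From Stdlib Require Import Lra Lia FunctionalExtensionality ProofIrrelevance ClassicalEpsilon.
From Coquelicot Require Export Coquelicot.

Open Scope R_scope.

Record is_norm (V : ModuleSpace C_Ring) (N : V -> R) : Prop := {
  norm_sub : forall x y : V, N (plus x y) <= N x + N y;
  norm_hom : forall (l : C) (x : V), N (scal l x) <= Cmod l * N x;
  norm_pos : forall x : V, 0 <= N x;
  norm_def : forall x : V, N x = 0 -> x = zero }.

Lemma is_norm_zero (V : ModuleSpace C_Ring) (N : V -> R) :
  is_norm V N -> N zero = 0.
Proof.
intros H. apply Rle_antisym; [|apply (norm_pos _ _ H)].
pose proof (norm_hom _ _ H (zero : C_Ring) zero) as G.
rewrite (scal_zero_l (zero : V)) in G.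
change (@zero C_Ring) with (RtoC 0) in G. rewrite Cmod_0 in G. lra.
Qed.

Lemma is_norm_opp (V : ModuleSpace C_Ring) (N : V -> R) (x : V) :
  is_norm V N -> N (opp x) = N x.
Proof.
intros H.
assert (G : forall y : V, N (opp y) <= N y).
{ intros y. rewrite <- scal_opp_one.
  eapply Rle_trans; [apply (norm_hom _ _ H)|].
  change (Cmod (Copp 1) * N y <= N y). rewrite Cmod_opp, Cmod_1. lra. }
apply Rle_antisym; [apply G|]. rewrite <- (opp_opp x) at 1. apply G.
Qed.

Lemma norm_ball_center (V : ModuleSpace C_Ring) (N : V -> R) (H : is_norm V N)
  (x : V) (e : posreal) : N (minus x x) < e.
Proof.
replace (N (minus x x)) with 0; [apply cond_pos|].
rewrite minus_eq_zero. symmetry. exact (is_norm_zero V N H).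
Qed.

Lemma norm_ball_sym (V : ModuleSpace C_Ring) (N : V -> R) (H : is_norm V N)
  (x y : V) (e : R) : N (minus y x) < e -> N (minus x y) < e.
Proof. intros h. rewrite <- opp_minus, (is_norm_opp V N _ H). exact h. Qed.

Lemma norm_ball_triangle (V : ModuleSpace C_Ring) (N : V -> R) (H : is_norm V N)
  (x y z : V) (e1 e2 : R) :
  N (minus y x) < e1 -> N (minus z y) < e2 -> N (minus z x) < e1 + e2.
Proof.
intros h1 h2. rewrite (minus_trans y z x).
eapply Rle_lt_trans; [apply (norm_sub _ _ H)|]. lra.
Qed.

Definition norm_uniform_mixin (V : ModuleSpace C_Ring) (N : V -> R)
  (H : is_norm V N) : UniformSpace.mixin_of V :=
  UniformSpace.Mixin V zero (fun x e y => N (minus y x) < e)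
    (norm_ball_center V N H) (norm_ball_sym V N H) (norm_ball_triangle V N H).

Definition norm_aux (V : ModuleSpace C_Ring) (N : V -> R) (H : is_norm V N) :
  NormedModuleAux C_AbsRing :=
  NormedModuleAux.Pack C_AbsRing V
    (NormedModuleAux.Class C_AbsRing V (ModuleSpace.class C_Ring V)
       (norm_uniform_mixin V N H)) V.

Lemma norm_aux_ball (V : ModuleSpace C_Ring) (N : V -> R) (H : is_norm V N)
  (x y : norm_aux V N H) (eps : posreal) :
  ball x eps y -> N (minus y x) < 1 * eps.
Proof. rewrite Rmult_1_l. intros h. exact h. Qed.

Definition norm_mixin (V : ModuleSpace C_Ring) (N : V -> R) (H : is_norm V N) :
  NormedModule.mixin_of C_AbsRing (norm_aux V N H) :=
  NormedModule.Mixin C_AbsRing (norm_aux V N H) N 1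
    (norm_sub V N H) (norm_hom V N H)
    (fun _ _ _ h => h) (norm_aux_ball V N H) (norm_def V N H).

Definition norm_class (V : ModuleSpace C_Ring) (N : V -> R) (H : is_norm V N) :
  NormedModule.class_of C_AbsRing V :=
  NormedModule.Class C_AbsRing V
    (NormedModuleAux.class C_AbsRing (norm_aux V N H)) (norm_mixin V N H).

Definition sqsum {V : NormedModule C_AbsRing} (x : nat -> V) : Prop :=
  ex_series (fun n => norm (x n) ^ 2).

Definition l2norm {V : NormedModule C_AbsRing} (x : nat -> V) : R :=
  sqrt (Series (fun n => norm (x n) ^ 2)).

Lemma ex_series_le_pos (a b : nat -> R) :
  (forall n, 0 <= a n <= b n) -> ex_series b -> ex_series a.
Proof.
intros h hb. apply (ex_series_le (K := R_AbsRing) (V := R_CompleteNormedModule) a b); auto.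
intros n. change (Rabs (a n) <= b n). rewrite Rabs_pos_eq; apply h.
Qed.

Lemma Series_pos (a : nat -> R) : (forall n, 0 <= a n) -> ex_series a -> 0 <= Series a.
Proof.
intros h ha. replace 0 with (Series (fun _ : nat => 0)).
- apply Series_le; auto. intros n. split; [lra|apply h].
- rewrite (Series_ext _ (fun n => 0 * 0)) by (intros; ring).
  rewrite Series_scal_l. ring.
Qed.

Lemma Series_pos_term (a : nat -> R) (n : nat) :
  (forall n, 0 <= a n) -> ex_series a -> a n <= Series a.
Proof.
intros h ha. rewrite (Series_incr_n a (S n)) by (auto; lia). simpl pred.
assert (0 <= Series (fun k => a (S n + k)%nat)).
{ apply Series_pos; [intros; apply h|]. now apply (ex_series_incr_n a). }
assert (a n <= sum_f_R0 a n).
{ destruct n; simpl; [lra|]. pose proof (cond_pos_sum a n h). lra. }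
lra.
Qed.

Lemma sqsum_plus {V : NormedModule C_AbsRing} (x y : nat -> V) :
  sqsum x -> sqsum y -> sqsum (fun n => plus (x n) (y n)).
Proof.
intros hx hy.
apply (ex_series_le_pos _ (fun n => 2 * norm (x n) ^ 2 + 2 * norm (y n) ^ 2)).
- intros n. split; [apply pow2_ge_0|].
  pose proof (norm_triangle (x n) (y n)). pose proof (norm_ge_0 (plus (x n) (y n))).
  assert (norm (plus (x n) (y n)) ^ 2 <= (norm (x n) + norm (y n)) ^ 2)
    by (apply pow_incr; lra).
  pose proof (pow2_ge_0 (norm (x n) - norm (y n))). lra.
- apply (ex_series_plus (V := R_NormedModule));
    apply (ex_series_scal_l (V := R_NormedModule) 2); assumption.
Qed.

Lemma sqsum_scal {V : NormedModule C_AbsRing} (l : C) (x : nat -> V) :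
  sqsum x -> sqsum (fun n => scal l (x n)).
Proof.
intros hx.
apply (ex_series_le_pos _ (fun n => Cmod l ^ 2 * norm (x n) ^ 2)).
- intros n. split; [apply pow2_ge_0|]. rewrite <- Rpow_mult_distr.
  apply pow_incr. split; [apply norm_ge_0|]. apply (norm_scal l (x n)).
- apply (ex_series_scal_l (V := R_NormedModule) (Cmod l ^ 2)); assumption.
Qed.

Lemma sqsum_zero {V : NormedModule C_AbsRing} : sqsum (fun _ : nat => zero : V).
Proof.
exists 0. apply (filterlim_ext (fun _ : nat => 0)); [|apply filterlim_const].
intros n. rewrite (sum_n_ext _ (fun _ => 0)).
- rewrite sum_n_const. symmetry. apply Rmult_0_r.
- intros k. rewrite norm_zero. apply Rmult_0_l.
Qed.

Lemma l2norm_sq {V : NormedModule C_AbsRing} (x : nat -> V) :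
  sqsum x -> l2norm x ^ 2 = Series (fun n => norm (x n) ^ 2).
Proof.
intros hx. unfold l2norm. rewrite pow2_sqrt; [reflexivity|].
apply Series_pos; auto. intros; apply pow2_ge_0.
Qed.

Lemma l2norm_pos {V : NormedModule C_AbsRing} (x : nat -> V) : 0 <= l2norm x.
Proof. apply sqrt_pos. Qed.

Lemma l2norm_eq0 {V : NormedModule C_AbsRing} (x : nat -> V) :
  sqsum x -> l2norm x = 0 -> forall n, x n = zero.
Proof.
intros hx h n. apply norm_eq_zero.
pose proof (l2norm_sq x hx) as H. rewrite h in H.
pose proof (Series_pos_term (fun n => norm (x n) ^ 2) n
  (fun n => pow2_ge_0 _) hx) as G. simpl in G, H.
pose proof (norm_ge_0 (x n)). nra.
Qed.

Lemma l2norm_ext {V : NormedModule C_AbsRing} (x y : nat -> V) :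
  (forall n, x n = y n) -> l2norm x = l2norm y.
Proof. intros h. unfold l2norm. f_equal. apply Series_ext. intros; now rewrite h. Qed.

Lemma l2norm_triangle {V : NormedModule C_AbsRing} (x y : nat -> V) :
  sqsum x -> sqsum y -> l2norm (fun n => plus (x n) (y n)) <= l2norm x + l2norm y.
Proof.
intros hx hy.
destruct (Req_dec (l2norm x) 0) as [ax|ax].
{ rewrite (l2norm_ext _ y); [rewrite ax; lra|].
  intros n. rewrite (l2norm_eq0 x hx ax n). apply plus_zero_l. }
destruct (Req_dec (l2norm y) 0) as [ay|ay].
{ rewrite (l2norm_ext _ x); [rewrite ay; lra|].
  intros n. rewrite (l2norm_eq0 y hy ay n). apply plus_zero_r. }
pose proof (l2norm_pos x). pose proof (l2norm_pos y).
apply Rsqr_incr_0_var; [|lra]. rewrite !Rsqr_pow2.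
rewrite (l2norm_sq _ (sqsum_plus x y hx hy)).
set (a := l2norm x) in *. set (b := l2norm y) in *.
replace ((a + b) ^ 2) with ((1 + b / a) * a ^ 2 + (1 + a / b) * b ^ 2) by (field; auto).
unfold a at 2, b at 3. rewrite (l2norm_sq x hx), (l2norm_sq y hy).
rewrite <- !Series_scal_l.
assert (ex1 : forall c : R, forall z : nat -> V, sqsum z -> ex_series (fun n => c * norm (z n) ^ 2))
  by (intros c z hz; apply (ex_series_scal_l (V := R_NormedModule) c); exact hz).
rewrite <- Series_plus by (apply ex1; assumption).
apply Series_le; [|apply (ex_series_plus (V := R_NormedModule)); apply ex1; assumption].
intros n. split; [apply pow2_ge_0|].
pose proof (norm_triangle (x n) (y n)). pose proof (norm_ge_0 (plus (x n) (y n))).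
assert (norm (plus (x n) (y n)) ^ 2 <= (norm (x n) + norm (y n)) ^ 2)
  by (apply pow_incr; lra).
set (f := norm (x n)) in *. set (g := norm (y n)) in *.
assert (0 < a) by lra. assert (0 < b) by lra.
assert (E : (1 + b / a) * f ^ 2 + (1 + a / b) * g ^ 2 - (f + g) ^ 2
        = (b * f - a * g) ^ 2 * / (a * b)) by (field; split; lra).
assert (0 <= (b * f - a * g) ^ 2 * / (a * b)).
{ apply Rmult_le_pos; [apply pow2_ge_0|]. apply Rlt_le, Rinv_0_lt_compat. nra. }
lra.
Qed.

Lemma l2norm_scal {V : NormedModule C_AbsRing} (l : C) (x : nat -> V) :
  sqsum x -> l2norm (fun n => scal l (x n)) <= Cmod l * l2norm x.
Proof.
intros hx. pose proof (l2norm_pos x). pose proof (Cmod_ge_0 l).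
apply Rsqr_incr_0_var; [|nra]. rewrite !Rsqr_pow2, Rpow_mult_distr.
rewrite (l2norm_sq _ (sqsum_scal l x hx)), (l2norm_sq x hx), <- Series_scal_l.
apply Series_le.
- intros n. split; [apply pow2_ge_0|]. rewrite <- Rpow_mult_distr.
  apply pow_incr. split; [apply norm_ge_0|]. apply (norm_scal l (x n)).
- apply (ex_series_scal_l (V := R_NormedModule)); assumption.
Qed.

(** The one-mode Fock space, realized as l2(nat). *)

Record fock : Type := mk_fock {
  coord :> nat -> C;
  coord_sqsum : sqsum (V := C_NormedModule) coord }.

Lemma fock_eq (x y : fock) : (forall n, x n = y n) -> x = y.
Proof.
destruct x as [x hx], y as [y hy]; simpl; intros h.
assert (E : x = y) by (apply functional_extensionality; exact h).
subst y. f_equal. apply proof_irrelevance.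
Qed.

Definition fock_plus (x y : fock) : fock :=
  mk_fock _ (sqsum_plus _ _ (coord_sqsum x) (coord_sqsum y)).
Definition fock_scal (l : C) (x : fock) : fock :=
  mk_fock _ (sqsum_scal l _ (coord_sqsum x)).
Definition fock_zero : fock := mk_fock _ sqsum_zero.
Definition fock_opp (x : fock) : fock := fock_scal (Copp 1) x.

Lemma fock_plus_comm x y : fock_plus x y = fock_plus y x.
Proof. apply fock_eq; intros n. apply Cplus_comm. Qed.
Lemma fock_plus_assoc x y z :
  fock_plus x (fock_plus y z) = fock_plus (fock_plus x y) z.
Proof. apply fock_eq; intros n. apply Cplus_assoc. Qed.
Lemma fock_plus_zero x : fock_plus x fock_zero = x.
Proof. apply fock_eq; intros n. apply Cplus_0_r. Qed.
Lemma fock_plus_opp x : fock_plus x (fock_opp x) = fock_zero.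
Proof.
apply fock_eq; intros n. change (Cplus (x n) (Cmult (Copp 1) (x n)) = RtoC 0). ring.
Qed.
Lemma fock_scal_assoc (k l : C) x : fock_scal k (fock_scal l x) = fock_scal (Cmult k l) x.
Proof.
apply fock_eq; intros n.
change (Cmult k (Cmult l (x n)) = Cmult (Cmult k l) (x n)). ring.
Qed.
Lemma fock_scal_one x : fock_scal (RtoC 1) x = x.
Proof. apply fock_eq; intros n. apply Cmult_1_l. Qed.
Lemma fock_scal_distr_l (k : C) x y :
  fock_scal k (fock_plus x y) = fock_plus (fock_scal k x) (fock_scal k y).
Proof. apply fock_eq; intros n. apply Cmult_plus_distr_l. Qed.
Lemma fock_scal_distr_r (k l : C) x :
  fock_scal (Cplus k l) x = fock_plus (fock_scal k x) (fock_scal l x).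
Proof. apply fock_eq; intros n. apply Cmult_plus_distr_r. Qed.

Definition fock_AbelianMonoid_mixin : AbelianMonoid.mixin_of fock :=
  AbelianMonoid.Mixin fock fock_plus fock_zero
    fock_plus_comm fock_plus_assoc fock_plus_zero.
Canonical fock_AbelianMonoid := AbelianMonoid.Pack fock fock_AbelianMonoid_mixin fock.
Definition fock_AbelianGroup_mixin : AbelianGroup.mixin_of fock_AbelianMonoid :=
  AbelianGroup.Mixin fock_AbelianMonoid fock_opp fock_plus_opp.
Canonical fock_AbelianGroup :=
  AbelianGroup.Pack fock
    (AbelianGroup.Class fock fock_AbelianMonoid_mixin fock_AbelianGroup_mixin) fock.
Definition fock_ModuleSpace_mixin : ModuleSpace.mixin_of C_Ring fock_AbelianGroup :=
  ModuleSpace.Mixin C_Ring fock_AbelianGroup fock_scal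
    fock_scal_assoc fock_scal_one fock_scal_distr_l fock_scal_distr_r.
Canonical fock_ModuleSpace :=
  ModuleSpace.Pack C_Ring fock
    (ModuleSpace.Class C_Ring fock (AbelianGroup.class fock_AbelianGroup)
       fock_ModuleSpace_mixin) fock.

Lemma fock_is_norm : is_norm fock_ModuleSpace (fun x => l2norm (coord x)).
Proof.
split.
- intros x y. apply (l2norm_triangle (coord x) (coord y)); apply coord_sqsum.
- intros l x. apply (l2norm_scal l (coord x)), coord_sqsum.
- intros x. apply l2norm_pos.
- intros x h. apply fock_eq. intros n.
  apply (l2norm_eq0 (coord x) (coord_sqsum x) h n).
Qed.

Canonical fock_UniformSpace :=
  UniformSpace.Pack fock (norm_uniform_mixin _ _ fock_is_norm) fock.
Canonical fock_NormedModuleAux :=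
  NormedModuleAux.Pack C_AbsRing fock
    (NormedModuleAux.class C_AbsRing (norm_aux _ _ fock_is_norm)) fock.
Canonical fock_NormedModule :=
  NormedModule.Pack C_AbsRing fock (norm_class _ _ fock_is_norm) fock.

Definition delta (n m : nat) : C := if Nat.eqb m n then RtoC 1 else RtoC 0.

Definition finite_particle (x : nat -> C) : Prop :=
  exists N : nat, forall n, (N <= n)%nat -> x n = RtoC 0.

Lemma finite_particle_sqsum (x : nat -> C) :
  finite_particle x -> sqsum (V := C_NormedModule) x.
Proof.
intros [N hN]. unfold sqsum.
apply (ex_series_incr_n (V := R_NormedModule) _ N).
apply (ex_series_ext (V := R_NormedModule) (fun n => norm (zero : C_NormedModule) ^ 2)).
- intros n. change (norm (zero : C_NormedModule) ^ 2 = Cmod (x (N + n)%nat) ^ 2).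
  rewrite norm_zero, hN by lia. rewrite Cmod_0. reflexivity.
- apply (sqsum_zero (V := C_NormedModule)).
Qed.

Lemma delta_finite (n : nat) : finite_particle (delta n).
Proof.
exists (S n). intros m hm. unfold delta.
destruct (Nat.eqb_spec m n); [lia|reflexivity].
Qed.

Definition e_ (n : nat) : fock := mk_fock (delta n) (finite_particle_sqsum _ (delta_finite n)).

Definition Cseries (c : nat -> C) : C :=
  (Series (fun n => Re (c n)), Series (fun n => Im (c n))).

(** Antilinear in the first argument. *)
Definition inner (x y : fock) : C := Cseries (fun n => Cmult (Cconj (x n)) (y n)).

(** Bounded operators: Coquelicot's [is_linear] includes boundedness. *)

Record bop : Type := mk_bop {
  bop_fun :> fock -> fock;
  bop_linear : is_linear (V := fock_NormedModule) bop_fun }.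

Lemma bop_eq (X Y : bop) : (forall x, X x = Y x) -> X = Y.
Proof.
destruct X as [X hX], Y as [Y hY]; simpl; intros h.
assert (E : X = Y) by (apply functional_extensionality; exact h).
subst Y. f_equal. apply proof_irrelevance.
Qed.

Lemma bop_plus_linear (X Y : bop) :
  is_linear (V := fock_NormedModule) (fun x : fock => plus (X x) (Y x)).
Proof.
apply (is_linear_comp (fun x => (X x, Y x)) (fun t => plus (fst t) (snd t))).
- apply is_linear_prod; apply bop_linear.
- apply is_linear_plus.
Qed.
Lemma bop_scal_linear (l : C) (X : bop) :
  is_linear (V := fock_NormedModule) (fun x : fock => scal (l : C_Ring) (X x)).
Proof.
apply (is_linear_comp (V := fock_NormedModule) (W := fock_NormedModule)
  X (fun y => scal (l : C_AbsRing) y)); [apply bop_linear|].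
apply (is_linear_scal_r (V := fock_NormedModule)). exact Cmult_comm.
Qed.
Lemma bop_comp_linear (X Y : bop) :
  is_linear (V := fock_NormedModule) (fun x : fock => X (Y x)).
Proof.
apply (is_linear_comp (V := fock_NormedModule) (W := fock_NormedModule) Y X);
  apply bop_linear.
Qed.

Definition bop_plus (X Y : bop) : bop := mk_bop _ (bop_plus_linear X Y).
Definition bop_scal (l : C) (X : bop) : bop := mk_bop _ (bop_scal_linear l X).
Definition bop_comp (X Y : bop) : bop := mk_bop _ (bop_comp_linear X Y).
Definition bop_zero : bop :=
  mk_bop (fun _ => zero) (is_linear_zero (V := fock_NormedModule)).
Definition bop_id : bop := mk_bop (fun x => x) (is_linear_id (V := fock_NormedModule)).
Definition bop_opp (X : bop) : bop := bop_scal (Copp 1) X.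

Lemma bop_plus_comm X Y : bop_plus X Y = bop_plus Y X.
Proof. apply bop_eq; intros x. apply fock_plus_comm. Qed.
Lemma bop_plus_assoc X Y Z : bop_plus X (bop_plus Y Z) = bop_plus (bop_plus X Y) Z.
Proof. apply bop_eq; intros x. apply fock_plus_assoc. Qed.
Lemma bop_plus_zero X : bop_plus X bop_zero = X.
Proof. apply bop_eq; intros x. apply fock_plus_zero. Qed.
Lemma bop_plus_opp X : bop_plus X (bop_opp X) = bop_zero.
Proof. apply bop_eq; intros x. apply fock_plus_opp. Qed.
Lemma bop_scal_assoc (k l : C) X : bop_scal k (bop_scal l X) = bop_scal (Cmult k l) X.
Proof. apply bop_eq; intros x. apply fock_scal_assoc. Qed.
Lemma bop_scal_one X : bop_scal (RtoC 1) X = X.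
Proof. apply bop_eq; intros x. apply fock_scal_one. Qed.
Lemma bop_scal_distr_l (k : C) X Y :
  bop_scal k (bop_plus X Y) = bop_plus (bop_scal k X) (bop_scal k Y).
Proof. apply bop_eq; intros x. apply fock_scal_distr_l. Qed.
Lemma bop_scal_distr_r (k l : C) X :
  bop_scal (Cplus k l) X = bop_plus (bop_scal k X) (bop_scal l X).
Proof. apply bop_eq; intros x. apply fock_scal_distr_r. Qed.

Definition bop_AbelianMonoid_mixin : AbelianMonoid.mixin_of bop :=
  AbelianMonoid.Mixin bop bop_plus bop_zero bop_plus_comm bop_plus_assoc bop_plus_zero.
Canonical bop_AbelianMonoid := AbelianMonoid.Pack bop bop_AbelianMonoid_mixin bop.
Definition bop_AbelianGroup_mixin : AbelianGroup.mixin_of bop_AbelianMonoid :=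
  AbelianGroup.Mixin bop_AbelianMonoid bop_opp bop_plus_opp.
Canonical bop_AbelianGroup :=
  AbelianGroup.Pack bop
    (AbelianGroup.Class bop bop_AbelianMonoid_mixin bop_AbelianGroup_mixin) bop.
Definition bop_ModuleSpace_mixin : ModuleSpace.mixin_of C_Ring bop_AbelianGroup :=
  ModuleSpace.Mixin C_Ring bop_AbelianGroup bop_scal
    bop_scal_assoc bop_scal_one bop_scal_distr_l bop_scal_distr_r.
Canonical bop_ModuleSpace :=
  ModuleSpace.Pack C_Ring bop
    (ModuleSpace.Class C_Ring bop (AbelianGroup.class bop_AbelianGroup)
       bop_ModuleSpace_mixin) bop.

Definition is_adjoint (X Xs : bop) : Prop :=
  forall x y : fock, inner (Xs x) y = inner x (X y).

Definition Cnonneg (z : C) : Prop := Im z = 0 /\ 0 <= Re z.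

Definition positive_op (X : bop) : Prop := forall x : fock, Cnonneg (inner x (X x)).

Definition trace (X : bop) : C := Cseries (fun n => inner (e_ n) (X (e_ n))).

(** [P] is [|X|], the positive square root of [X^* X]. *)
Definition is_abs (X P : bop) : Prop :=
  positive_op P /\ forall x y : fock, inner (P x) (P y) = inner (X x) (X y).

Definition trace_class (X : bop) : Prop :=
  exists P : bop, is_abs X P /\ ex_series (fun n => Re (inner (e_ n) (P (e_ n)))).

(** Convergence along a filter for the weak* topology of B(h), the dual of the
    trace class under [(sigma, X) |-> Tr (sigma X)]. *)
Definition weakstar_lim (F : (bop -> Prop) -> Prop) (X : bop) : Prop :=
  forall sigma : bop, trace_class sigma ->
  filterlim (fun Y => trace (bop_comp sigma Y)) F
            (locally (trace (bop_comp sigma X))).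

Record hs : Type := mk_hs {
  hs_bop :> bop;
  hs_sqsum : sqsum (V := fock_NormedModule) (fun n => hs_bop (e_ n)) }.

Lemma hs_eq (X Y : hs) : hs_bop X = hs_bop Y -> X = Y.
Proof.
destruct X as [X hX], Y as [Y hY]; simpl; intros h. subst Y.
f_equal. apply proof_irrelevance.
Qed.

Lemma hs_zero_sqsum : sqsum (V := fock_NormedModule) (fun n => bop_zero (e_ n)).
Proof. apply (sqsum_zero (V := fock_NormedModule)). Qed.

Definition hs_plus (X Y : hs) : hs :=
  mk_hs (bop_plus X Y) (sqsum_plus (V := fock_NormedModule) _ _ (hs_sqsum X) (hs_sqsum Y)).
Definition hs_scal (l : C) (X : hs) : hs :=
  mk_hs (bop_scal l X) (sqsum_scal (V := fock_NormedModule) l _ (hs_sqsum X)).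
Definition hs_zero : hs := mk_hs bop_zero hs_zero_sqsum.
Definition hs_opp (X : hs) : hs := hs_scal (Copp 1) X.

Lemma hs_plus_comm X Y : hs_plus X Y = hs_plus Y X.
Proof. apply hs_eq, bop_plus_comm. Qed.
Lemma hs_plus_assoc X Y Z : hs_plus X (hs_plus Y Z) = hs_plus (hs_plus X Y) Z.
Proof. apply hs_eq, bop_plus_assoc. Qed.
Lemma hs_plus_zero X : hs_plus X hs_zero = X.
Proof. apply hs_eq, bop_plus_zero. Qed.
Lemma hs_plus_opp X : hs_plus X (hs_opp X) = hs_zero.
Proof. apply hs_eq, bop_plus_opp. Qed.
Lemma hs_scal_assoc (k l : C) X : hs_scal k (hs_scal l X) = hs_scal (Cmult k l) X.
Proof. apply hs_eq, bop_scal_assoc. Qed.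
Lemma hs_scal_one X : hs_scal (RtoC 1) X = X.
Proof. apply hs_eq, bop_scal_one. Qed.
Lemma hs_scal_distr_l (k : C) X Y :
  hs_scal k (hs_plus X Y) = hs_plus (hs_scal k X) (hs_scal k Y).
Proof. apply hs_eq, bop_scal_distr_l. Qed.
Lemma hs_scal_distr_r (k l : C) X :
  hs_scal (Cplus k l) X = hs_plus (hs_scal k X) (hs_scal l X).
Proof. apply hs_eq, bop_scal_distr_r. Qed.

Definition hs_AbelianMonoid_mixin : AbelianMonoid.mixin_of hs :=
  AbelianMonoid.Mixin hs hs_plus hs_zero hs_plus_comm hs_plus_assoc hs_plus_zero.
Canonical hs_AbelianMonoid := AbelianMonoid.Pack hs hs_AbelianMonoid_mixin hs.
Definition hs_AbelianGroup_mixin : AbelianGroup.mixin_of hs_AbelianMonoid :=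
  AbelianGroup.Mixin hs_AbelianMonoid hs_opp hs_plus_opp.
Canonical hs_AbelianGroup :=
  AbelianGroup.Pack hs
    (AbelianGroup.Class hs hs_AbelianMonoid_mixin hs_AbelianGroup_mixin) hs.
Definition hs_ModuleSpace_mixin : ModuleSpace.mixin_of C_Ring hs_AbelianGroup :=
  ModuleSpace.Mixin C_Ring hs_AbelianGroup hs_scal
    hs_scal_assoc hs_scal_one hs_scal_distr_l hs_scal_distr_r.
Canonical hs_ModuleSpace :=
  ModuleSpace.Pack C_Ring hs
    (ModuleSpace.Class C_Ring hs (AbelianGroup.class hs_AbelianGroup)
       hs_ModuleSpace_mixin) hs.

Definition fock_trunc (x : fock) (N : nat) : fock :=
  sum_n (fun n => scal (x n : C_Ring) (e_ n)) N.

Lemma fock_trunc_coord (x : fock) (N m : nat) :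
  fock_trunc x N m = if Nat.leb m N then x m else RtoC 0.
Proof.
unfold fock_trunc.
assert (step : forall n, coord (scal (x n : C_Ring) (e_ n)) m
               = if Nat.eqb m n then x m else RtoC 0).
{ intros n. change (Cmult (x n) (delta n m) = if Nat.eqb m n then x m else RtoC 0).
  unfold delta. destruct (Nat.eqb_spec m n); [subst; ring|ring]. }
induction N as [|N IH].
- rewrite sum_O, step. destruct m; reflexivity.
- rewrite sum_Sn. change (Cplus (sum_n (fun n => scal (x n : C_Ring) (e_ n)) N m)
    (coord (scal (x (S N) : C_Ring) (e_ (S N))) m) = if Nat.leb m (S N) then x m else RtoC 0).
  rewrite IH, step.
  destruct (Nat.leb_spec m N), (Nat.eqb_spec m (S N)), (Nat.leb_spec m (S N)); try lia; ring.
Qed.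

Lemma fock_trunc_tail (x : fock) (N : nat) :
  norm (minus x (fock_trunc x N)) ^ 2
  = Series (fun k => norm (x k : C_NormedModule) ^ 2)
    - sum_f_R0 (fun k => norm (x k : C_NormedModule) ^ 2) N.
Proof.
set (y := minus x (fock_trunc x N)).
change (l2norm (coord y) ^ 2 = Series (fun k => norm (x k : C_NormedModule) ^ 2)
    - sum_f_R0 (fun k => norm (x k : C_NormedModule) ^ 2) N).
rewrite (l2norm_sq _ (coord_sqsum y)).
assert (Y : forall m, y m = if Nat.leb m N then RtoC 0 else x m).
{ intros m. change (Cplus (x m) (Cmult (Copp 1) (fock_trunc x N m))
    = if Nat.leb m N then RtoC 0 else x m).
  rewrite fock_trunc_coord. destruct (Nat.leb m N); ring. }
rewrite (Series_incr_n _ (S N)) by (try lia; apply (coord_sqsum y)).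
rewrite (Series_incr_n (fun k => norm (x k : C_NormedModule) ^ 2) (S N))
  by (try lia; apply (coord_sqsum x)).
simpl pred.
rewrite (sum_eq _ (fun _ => 0)).
- rewrite sum_cte.
  rewrite (Series_ext (fun k => norm (y (S N + k)%nat : C_NormedModule) ^ 2)
                      (fun k => norm (x (S N + k)%nat : C_NormedModule) ^ 2)); [ring|].
  intros k. rewrite Y. destruct (Nat.leb_spec (S N + k) N); [lia|reflexivity].
- intros k hk. rewrite Y. destruct (Nat.leb_spec k N); [|lia].
  change (Cmod (RtoC 0) ^ 2 = 0). rewrite Cmod_0. ring.
Qed.

Lemma bop_zero_basis (X : bop) : (forall n, X (e_ n) = zero) -> X = bop_zero.
Proof.
intros h. apply bop_eq. intros x.
destruct (bop_linear X) as [hp hsc [M [hM hb]]].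
assert (ht : forall N, X (fock_trunc x N) = zero).
{ intros N. unfold fock_trunc. induction N as [|N IH].
  - rewrite sum_O, hsc, h. apply (scal_zero_r (V := fock_ModuleSpace)).
  - rewrite sum_Sn, hp, IH, hsc, h.
    rewrite (scal_zero_r (V := fock_ModuleSpace)). apply plus_zero_l. }
apply (norm_eq_zero (V := fock_NormedModule)).
set (f := fun k => norm (x k : C_NormedModule) ^ 2).
assert (B : forall N, norm (X x) ^ 2 <= M ^ 2 * (Series f - sum_f_R0 f N)).
{ intros N. unfold f. rewrite <- fock_trunc_tail, <- Rpow_mult_distr.
  apply pow_incr. split; [apply norm_ge_0|].
  replace (X x) with (X (minus x (fock_trunc x N))); [apply hb|].
  rewrite (linear_minus X _ _ (bop_linear X)), ht.
  apply (minus_zero_r (G := fock_AbelianGroup)). }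
assert (L : is_lim_seq (fun N => M ^ 2 * (Series f - sum_f_R0 f N)) (M ^ 2 * (Series f - Series f))).
{ apply (is_lim_seq_scal_l _ (M ^ 2) (Series f - Series f)).
  apply is_lim_seq_minus'; [apply is_lim_seq_const|].
  apply (is_lim_seq_ext (sum_n f)); [intros; apply sum_n_Reals|].
  apply (Series_correct f (coord_sqsum x)). }
pose proof (is_lim_seq_le _ _ _ _ B (is_lim_seq_const (norm (X x) ^ 2)) L) as E.
simpl in E. pose proof (norm_ge_0 (X x)). nra.
Qed.

Definition hs_norm (X : hs) : R := l2norm (V := fock_NormedModule) (fun n => X (e_ n)).

Lemma hs_is_norm : is_norm hs_ModuleSpace hs_norm.
Proof.
split.
- intros X Y. apply (l2norm_triangle (V := fock_NormedModule)); apply hs_sqsum.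
- intros l X. apply (l2norm_scal (V := fock_NormedModule)), hs_sqsum.
- intros X. apply (l2norm_pos (V := fock_NormedModule)).
- intros X h. apply hs_eq, bop_zero_basis. intros n.
  apply (l2norm_eq0 (V := fock_NormedModule) _ (hs_sqsum X) h n).
Qed.

Canonical hs_UniformSpace :=
  UniformSpace.Pack hs (norm_uniform_mixin _ _ hs_is_norm) hs.
Canonical hs_NormedModuleAux :=
  NormedModuleAux.Pack C_AbsRing hs
    (NormedModuleAux.class C_AbsRing (norm_aux _ _ hs_is_norm)) hs.
Canonical hs_NormedModule :=
  NormedModule.Pack C_AbsRing hs (norm_class _ _ hs_is_norm) hs.

(** [Tr (X^* Y)], since [<e_n, X^* Y e_n> = <X e_n, Y e_n>]. *)
Definition hs_inner (X Y : hs) : C := Cseries (fun n => inner (X (e_ n)) (Y (e_ n))).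

(** Unbounded operators are given by their natural action on arbitrary
    sequences of coordinates; they preserve finite-particle vectors. *)
Definition ann (x : nat -> C) (n : nat) : C :=
  Cmult (RtoC (sqrt (INR (S n)))) (x (S n)).

Definition cre (x : nat -> C) (n : nat) : C :=
  match n with
  | O => RtoC 0
  | S m => Cmult (RtoC (sqrt (INR (S m)))) (x m)
  end.

Definition weyl_field (z : C) (x : nat -> C) (n : nat) : C :=
  Cminus (Cmult z (cre x n)) (Cmult (Cconj z) (ann x n)).

(** [W = exp (z a^dagger - conj z a)]: the exponential series converges in
    norm to [W x] on the dense space of finite-particle vectors [x], which
    determines the bounded operator [W]. *)
Definition is_weyl (z : C) (W : bop) : Prop :=
  forall x : fock, finite_particle x ->
  is_lim_seq
    (fun K => l2norm (V := C_NormedModule) (fun m =>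
       Cminus (sum_n (fun k => Cmult (RtoC (/ INR (fact k)))
                                     (Nat.iter k (weyl_field z) x m)) K)
              (W x m)))
    0.

Inductive ladder_poly : Type :=
  | LConst (c : C)
  | LAnn
  | LCre
  | LAdd (P Q : ladder_poly)
  | LMul (P Q : ladder_poly).

Fixpoint poly_act (P : ladder_poly) (x : nat -> C) : nat -> C :=
  match P with
  | LConst c => fun n => Cmult c (x n)
  | LAnn => ann x
  | LCre => cre x
  | LAdd P Q => fun n => Cplus (poly_act P x n) (poly_act Q x n)
  | LMul P Q => poly_act P (poly_act Q x)
  end.

Definition diag_act (d : nat -> R) (x : nat -> C) (n : nat) : C :=
  Cmult (RtoC (d n)) (x n).

Definition bounded_seq (d : nat -> R) : Prop := exists M, forall n, Rabs (d n) <= M.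

Lemma diag_bound (d : nat -> R) (M : R) (x : nat -> C) :
  (forall n, Rabs (d n) <= M) -> sqsum (V := C_NormedModule) x ->
  forall n, 0 <= Cmod (diag_act d x n) ^ 2 <= M ^ 2 * Cmod (x n) ^ 2.
Proof.
intros hM hx n. split; [apply pow2_ge_0|]. rewrite <- Rpow_mult_distr.
apply pow_incr. split; [apply Cmod_ge_0|]. unfold diag_act.
rewrite Cmod_mult, Cmod_R. apply Rmult_le_compat_r; [apply Cmod_ge_0|apply hM].
Qed.

Lemma diag_sqsum (d : nat -> R) (hd : bounded_seq d) (x : fock) :
  sqsum (V := C_NormedModule) (diag_act d x).
Proof.
destruct hd as [M hM].
apply (ex_series_le_pos _ _ (diag_bound d M x hM (coord_sqsum x))).
apply (ex_series_scal_l (V := R_NormedModule) (M ^ 2)), (coord_sqsum x).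
Qed.

Definition diag_fun (d : nat -> R) (hd : bounded_seq d) (x : fock) : fock :=
  mk_fock (diag_act d x) (diag_sqsum d hd x).

Lemma diag_linear (d : nat -> R) (hd : bounded_seq d) :
  is_linear (V := fock_NormedModule) (diag_fun d hd).
Proof.
split.
- intros x y. apply fock_eq; intros n. apply Cmult_plus_distr_l.
- intros k x. apply fock_eq; intros n.
  change (Cmult (RtoC (d n)) (Cmult k (x n)) = Cmult k (Cmult (RtoC (d n)) (x n))). ring.
- destruct hd as [M hM]. exists (Rabs M + 1).
  pose proof (Rabs_pos M). split; [lra|]. intros x.
  assert (hM' : forall n, Rabs (d n) <= Rabs M + 1).
  { intros n. pose proof (hM n). pose proof (Rle_abs M). lra. }
  change (l2norm (V := C_NormedModule) (diag_act d x)
          <= (Rabs M + 1) * l2norm (V := C_NormedModule) x).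
  pose proof (l2norm_pos (V := C_NormedModule) x).
  apply Rsqr_incr_0_var; [|nra]. rewrite !Rsqr_pow2, Rpow_mult_distr.
  rewrite (l2norm_sq (V := C_NormedModule) (diag_act d x) (diag_sqsum d (ex_intro _ M hM) x)).
  rewrite (l2norm_sq (V := C_NormedModule) x (coord_sqsum x)), <- Series_scal_l.
  apply Series_le; [exact (diag_bound d _ x hM' (coord_sqsum x))|].
  apply (ex_series_scal_l (V := R_NormedModule)), (coord_sqsum x).
Qed.

(** The diagonal operator with entries [d] (zero if [d] is unbounded). *)
Definition diag_op (d : nat -> R) : bop :=
  match excluded_middle_informative (bounded_seq d) with
  | left hd => mk_bop (diag_fun d hd) (diag_linear d hd)
  | right _ => bop_zero
  end.

Definition thermal_weight (beta r : R) (n : nat) : R :=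
  Rpower ((1 - exp (- beta)) * exp (- beta * INR n)) r.

(** [rho^r], used for [0 <= r] and [0 < beta]. *)
Definition thermal_pow (beta r : R) : bop := diag_op (thermal_weight beta r).

(** [(1 - e^-beta) e^(-beta N)]. *)
Definition thermal_state (beta : R) : bop := thermal_pow beta 1.

(** [rho^(s/2) X rho^((1-s)/2)] for bounded [X]. *)
Definition embed_bop (beta s : R) (X : bop) : bop :=
  bop_comp (thermal_pow beta (s / 2)) (bop_comp X (thermal_pow beta ((1 - s) / 2))).

(** [Y] is the Hilbert-Schmidt extension of [rho^(s/2) P rho^((1-s)/2)], the
    latter acting on the span of the [e_n]. *)
Definition is_embedded_poly (beta s : R) (P : ladder_poly) (Y : hs) : Prop :=
  forall x : fock, finite_particle x ->
  forall n, Y x n =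
    diag_act (thermal_weight beta (s / 2))
      (poly_act P (diag_act (thermal_weight beta ((1 - s) / 2)) x)) n.

(** [sum_(i,j) <x_i, Phi (X_i^* X_j) x_j> >= 0] for all finite families;
    [Xs i] is the adjoint of [X i]. *)
Definition completely_positive (Phi : bop -> bop) : Prop :=
  forall (m : nat) (X Xs : nat -> bop) (x : nat -> fock),
  (forall i, is_adjoint (X i) (Xs i)) ->
  Cnonneg (sum_n (fun i => sum_n (fun j =>
    inner (x i) (Phi (bop_comp (Xs i) (X j)) (x j))) m) m).

(** Normal: continuous for the weak* topology. *)
Definition normal_map (Phi : bop -> bop) : Prop :=
  forall (F : (bop -> Prop) -> Prop) (X : bop), Filter F ->
  weakstar_lim F X -> weakstar_lim (filtermap Phi F) (Phi X).

Record is_qms (T : R -> bop -> bop) : Prop := {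
  qms_plus : forall t X Y, 0 <= t -> T t (plus X Y) = plus (T t X) (T t Y);
  qms_scal : forall t (c : C) X, 0 <= t -> T t (scal c X) = scal c (T t X);
  qms_cp : forall t, 0 <= t -> completely_positive (T t);
  qms_normal : forall t, 0 <= t -> normal_map (T t);
  qms_id : forall t, 0 <= t -> T t bop_id = bop_id;
  qms_0 : forall X, T 0 X = X;
  qms_add : forall t r X, 0 <= t -> 0 <= r -> T (t + r) X = T t (T r X);
  qms_cont : forall X t, 0 <= t ->
    weakstar_lim (filtermap (fun r => T r X) (within (Rle 0) (locally t))) (T t X) }.

Definition normal_state (sigma : bop) : Prop :=
  positive_op sigma /\ is_series (fun n => Re (inner (e_ n) (sigma (e_ n)))) 1.

Definition invariant_state (T : R -> bop -> bop) (sigma : bop) : Prop :=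
  normal_state sigma /\
  forall t X, 0 <= t -> trace (bop_comp sigma (T t X)) = trace (bop_comp sigma X).

Definition unique_invariant_state (T : R -> bop -> bop) (sigma : bop) : Prop :=
  invariant_state T sigma /\ forall sigma', invariant_state T sigma' -> sigma' = sigma.

Definition faithful_state (sigma : bop) : Prop :=
  forall X : bop, positive_op X -> trace (bop_comp sigma X) = RtoC 0 -> X = bop_zero.

Record gauss_param : Type := {
  Omega : R;
  kappa : C;
  zeta : C;
  u1 : C; u2 : C; v1 : C; v2 : C }.

Definition gamma (p : gauss_param) : R :=
  / 2 * ((Cmod (v1 p) ^ 2 - Cmod (u1 p) ^ 2) + (Cmod (v2 p) ^ 2 - Cmod (u2 p) ^ 2)).

Definition Zop (p : gauss_param) (z : C) : C :=
  ((Ci * Omega p - gamma p) * z + Ci * kappa p * Cconj z)%C.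

Definition Cop (p : gauss_param) (z : C) : C :=
  (((Cmod (u1 p) ^ 2 + Cmod (v1 p) ^ 2)%R * z + 2 * v1 p * u1 p * Cconj z)
   + ((Cmod (u2 p) ^ 2 + Cmod (v2 p) ^ 2)%R * z + 2 * v2 p * u2 p * Cconj z))%C.

(** [exp (t Z) z], by the exponential series of the real-linear operator Z. *)
Definition expZ (p : gauss_param) (t : R) (z : C) : C :=
  Cseries (fun k => Cmult (RtoC (t ^ k / INR (fact k))) (Nat.iter k (Zop p) z)).

Definition Cexp (z : C) : C := (exp (Re z) * cos (Im z), exp (Re z) * sin (Im z)).

Definition gaussian_action (p : gauss_param) (W : C -> bop) (T : R -> bop -> bop) : Prop :=
  forall (t : R) (z : C), 0 <= t ->
  T t (W z) =
  scal (Cexp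
    (RtoC (- / 2 * RInt (fun r => Re (Cmult (Cconj (expZ p r z)) (Cop p (expZ p r z)))) 0 t)
     + Ci * RtoC (RInt (fun r => Re (Cmult (Cconj (zeta p)) (expZ p r z))) 0 t))%C)
    (W (expZ p t z)).

Definition drift_matrix (p : gauss_param) : matrix (T := R) 2 2 :=
  mk_matrix 2 2 (fun i j => match i, j with
    | O, O => - gamma p - Im (kappa p)
    | O, _ => Re (kappa p) - Omega p
    | _, O => Re (kappa p) + Omega p
    | _, _ => - gamma p + Im (kappa p)
    end).

Definition mat_eigenvalue (n : nat) (A : matrix (T := R) n n) (lambda : C) : Prop :=
  exists v : nat -> C, (exists i, (i < n)%nat /\ v i <> RtoC 0) /\
  forall i, (i < n)%nat ->
    sum_n (fun j => Cmult (RtoC (coeff_mat 0 A i j)) (v j)) (pred n)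
    = Cmult lambda (v i).

Definition stable (n : nat) (A : matrix (T := R) n n) : Prop :=
  forall lambda : C, mat_eigenvalue n A lambda -> Re lambda < 0.

Record is_contraction_semigroup (S : R -> hs -> hs) : Prop := {
  sg_plus : forall t X Y, 0 <= t -> S t (plus X Y) = plus (S t X) (S t Y);
  sg_scal : forall t (c : C) X, 0 <= t -> S t (scal c X) = scal c (S t X);
  sg_contr : forall t X, 0 <= t -> hs_norm (S t X) <= hs_norm X;
  sg_0 : forall X, S 0 X = X;
  sg_add : forall t r X, 0 <= t -> 0 <= r -> S (t + r) X = S t (S r X);
  sg_cont : forall X t, 0 <= t ->
    filterlim (fun r => S r X) (within (Rle 0) (locally t)) (locally (S t X)) }.

(** [S_t (rho^(s/2) X rho^((1-s)/2)) = rho^(s/2) T_t(X) rho^((1-s)/2)]. *)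
Definition induces (beta s : R) (T : R -> bop -> bop) (S : R -> hs -> hs) : Prop :=
  forall (t : R) (X : bop) (Y Y' : hs), 0 <= t ->
  hs_bop Y = embed_bop beta s X -> hs_bop Y' = embed_bop beta s (T t X) ->
  S t Y = Y'.

Definition generator (S : R -> hs -> hs) (X Y : hs) : Prop :=
  filterlim (fun t => scal (RtoC (/ t)) (minus (S t X) X)) (at_right 0) (locally Y).

Definition adjoint_graph (L : hs -> hs -> Prop) (X Y : hs) : Prop :=
  forall U V, L U V -> hs_inner X V = hs_inner Y U.

(** [L^* + L] on the space of embedded polynomials. *)
Definition sym_generator (beta s : R) (S : R -> hs -> hs) (X Y : hs) : Prop :=
  (exists P, is_embedded_poly beta s P X) /\
  exists Y1 Y2, adjoint_graph (generator S) X Y1 /\ generator S X Y2 /\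
                Y = plus Y1 Y2.

(** [lambda] is an eigenvalue of (the operator with graph) [L] with an
    eigenvector in the span of [A] and [B]. *)
Definition eigenvalue_on_span (L : hs -> hs -> Prop) (A B : hs) (lambda : C) : Prop :=
  exists c1 c2 : C,
    let X := plus (scal c1 A) (scal c2 B) in
    X <> zero /\ L X (scal lambda X).

(* Main.v *)
(** Write [phi(z) = z a^dagger - conj z a], [z_t = e^(tZ) z], and let [c_t(z)] be the
    scalar with [T_t (W z) = c_t(z) W(z_t)].

    Generator: the embedded Weyl operators expand in Hilbert-Schmidt norm as
    [sum_k r^k / k! phi(z)^k] in [W (r z)], and [c_t(r z) = exp(- r^2 q)], so the
    coefficient of [r] in the identity defining the induced semigroup [S_t] gives
    [S_t phi(z) = phi(z_t)] after embedding.

    Adjoint: the commutators of [W z] with [a] and [a^dagger], together with the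
    fact that [rho] commutes with [a] up to a factor, show that the pairings of the
    embedded [a^dagger] and [a] with the embedded [W z] are constant multiples of
    [z g(z)] and [conj z g(z)], where [g(z) = Tr (rho W z)].  Invariance of [rho]
    means [c_t(z) g(z_t) = g(z)], hence [S_t^*] maps the first-order space to itself
    through the real-linear map [z |-> z_t]; this is proved on embedded Weyl
    operators and extends to all Hilbert-Schmidt operators because those are total.

    Totality: if a bounded functional kills every embedded [W z], Taylor expansion
    shows that it kills every [phi(z)^k], normal ordering that it kills every
    [(a^dagger)^i a^j].  Along each diagonal this says that all factorial moments of
    a geometrically decaying sequence vanish, that is, all derivatives at [1] of a
    power series of radius greater than [1]; so the sequence is zero. *)

From Stdlib Require Import Arith Lra Lia Classical ClassicalEpsilon FunctionalExtensionality.
Require Import Defs.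

(** * Complex series *)

(** The series in [r] has operator coefficients built from the unbounded phi(z), so it needs
    estimates. Entries of phi(z)^k grow like sqrt(k!) up to factors exponential in k and in the
    indices; after division by k! what remains is of order 1/sqrt(k!), summable for every [r]. At s
    = 0 and s = 1 the weight decays in one index only. The matrix of W(z) is full, but phi(z)^k
    lives within distance k of the diagonal, where the decay can be shared between both indices at a
    cost exponential in k. Hence estimates are made degree by degree, on geometrically decaying
    matrices.

    Normal ordering isolates, for each k, only a combination of the (a^dagger)^i a^j with i + j = k;
    rotating the phase of z separates its terms by Fourier frequency.

    The parameter s enters the result at one place: the pairings with a^dagger and a carry the
    constants e^(-beta s) and e^(-beta (1-s)). The antilinear part of e^(tZ) exchanges the two
    pairings, so the antilinear coefficient of the adjoint acquires the ratio of these constants,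
    while the linear one does not. *)

Definition csum (c : nat -> C) (l : C) : Prop :=
  is_series (fun n => Re (c n)) (Re l) /\ is_series (fun n => Im (c n)) (Im l).

Lemma im_le_Cmod (z : C) : Rabs (Im z) <= Cmod z.
Proof.
apply Rsqr_incr_0_var; [|apply Cmod_ge_0].
rewrite !Rsqr_pow2, pow2_abs, Cmod2_alt. pose proof (pow2_ge_0 (Re z)). lra.
Qed.

Lemma Cmod_le_Re_Im (z : C) : Cmod z <= Rabs (Re z) + Rabs (Im z).
Proof.
pose proof (Rabs_pos (Re z)). pose proof (Rabs_pos (Im z)).
apply Rsqr_incr_0_var; [|lra].
rewrite !Rsqr_pow2, Cmod2_alt, <- (pow2_abs (Re z)), <- (pow2_abs (Im z)). nra.
Qed.

Lemma C_ext (z w : C) : Re z = Re w -> Im z = Im w -> z = w.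
Proof. destruct z, w; simpl; intros; subst; reflexivity. Qed.

Lemma Cconj_R (r : R) : Cconj (RtoC r) = RtoC r.
Proof. apply C_ext; simpl; ring. Qed.

Lemma Cconj_Ci : Cconj Ci = Copp Ci.
Proof. apply C_ext; simpl; ring. Qed.

Lemma Ci_sq : (Ci * Ci = - 1)%C.
Proof. apply C_ext; simpl; ring. Qed.

Lemma Cmult_eq_0 (a b : C) : Cmult a b = RtoC 0 -> a = RtoC 0 \/ b = RtoC 0.
Proof.
intros E. destruct (Ceq_dec a 0) as [Z|Z]; [left; exact Z|].
destruct (Ceq_dec b 0) as [Z'|Z']; [right; exact Z'|].
exfalso. apply (Cmult_neq_0 _ _ Z Z' E).
Qed.

Lemma csum_Cseries (c : nat -> C) (l : C) : csum c l -> Cseries c = l.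
Proof.
intros [h1 h2]. apply C_ext; unfold Cseries; simpl; apply is_series_unique; assumption.
Qed.

(** The device by which values of [Cseries] are identified: [Cseries] is total and says nothing
    about convergence, so the two sides of an identity are exhibited as limits of one and the same
    series. *)
Lemma csum_unique (c : nat -> C) (l l' : C) : csum c l -> csum c l' -> l = l'.
Proof. intros h h'. rewrite <- (csum_Cseries _ _ h). apply csum_Cseries, h'. Qed.

Lemma csum_ext (c d : nat -> C) (l : C) :
  (forall n, c n = d n) -> csum c l -> csum d l.
Proof.
intros h [h1 h2]. split; eapply is_series_ext; eauto; intros n; simpl; rewrite h; reflexivity.
Qed.

Lemma csum_plus (c d : nat -> C) (l m : C) :
  csum c l -> csum d m -> csum (fun n => Cplus (c n) (d n)) (Cplus l m).
Proof.
intros [h1 h2] [g1 g2]. split;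
  [apply (is_series_plus _ _ _ _ h1 g1)|apply (is_series_plus _ _ _ _ h2 g2)].
Qed.

Lemma csum_scal (k : C) (c : nat -> C) (l : C) :
  csum c l -> csum (fun n => Cmult k (c n)) (Cmult k l).
Proof.
intros [h1 h2]. split.
- apply (is_series_minus (V := R_NormedModule)
    (fun n => Re k * Re (c n)) (fun n => Im k * Im (c n)) (Re k * Re l) (Im k * Im l));
    apply (is_series_scal_l (V := R_NormedModule)); assumption.
- apply (is_series_plus (V := R_NormedModule)
    (fun n => Re k * Im (c n)) (fun n => Im k * Re (c n)) (Re k * Im l) (Im k * Re l));
    apply (is_series_scal_l (V := R_NormedModule)); assumption.
Qed.

Lemma csum_abs (c : nat -> C) : ex_series (fun n => Cmod (c n)) -> csum c (Cseries c).
Proof.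
intros h. split; apply Series_correct;
  apply (ex_series_le (K := R_AbsRing) (V := R_CompleteNormedModule) _ (fun n => Cmod (c n)));
  try assumption; intros n; [apply re_le_Cmod|apply im_le_Cmod].
Qed.

Lemma csum_dom (c : nat -> C) (b : nat -> R) :
  (forall n, Cmod (c n) <= b n) -> ex_series b -> csum c (Cseries c).
Proof.
intros h hb. apply csum_abs. apply (ex_series_le_pos _ b); [|assumption].
intros n. split; [apply Cmod_ge_0|apply h].
Qed.

Lemma is_series_Rabs_le (a b : nat -> R) (l B : R) :
  (forall n, Rabs (a n) <= b n) -> is_series a l -> is_series b B -> Rabs l <= B.
Proof.
intros h ha hb. rewrite <- (is_series_unique _ _ ha), <- (is_series_unique _ _ hb).
assert (hb' : ex_series b) by (exists B; exact hb).
assert (ex : ex_series (fun n => Rabs (a n))).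
{ apply (ex_series_le_pos _ b); auto. intros n; split; [apply Rabs_pos|apply h]. }
eapply Rle_trans; [apply Series_Rabs; exact ex|].
apply Series_le; auto. intros n; split; [apply Rabs_pos|apply h].
Qed.

(** Real and imaginary parts are dominated separately, whence the factor 2; it reappears in later
    matrix estimates. *)
Lemma csum_bound (c : nat -> C) (b : nat -> R) (l : C) (B : R) :
  (forall n, Cmod (c n) <= b n) -> is_series b B -> csum c l -> Cmod l <= 2 * B.
Proof.
intros h hb [h1 h2]. eapply Rle_trans; [apply Cmod_le_Re_Im|].
assert (Rabs (Re l) <= B).
{ eapply is_series_Rabs_le; [|exact h1|exact hb].
  intros n; eapply Rle_trans; [apply re_le_Cmod|apply h]. }
assert (Rabs (Im l) <= B).
{ eapply is_series_Rabs_le; [|exact h2|exact hb].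
  intros n; eapply Rle_trans; [apply im_le_Cmod|apply h]. }
lra.
Qed.

(** The upper index is excluded, so that inductions can start from the empty sum; in [sum_n] it is
    included. *)
Fixpoint cpartial (c : nat -> C) (N : nat) : C :=
  match N with O => RtoC 0 | S n => Cplus (cpartial c n) (c n) end.

Lemma cpartial_sum_n (c : nat -> C) (N : nat) :
  sum_n c N = cpartial c (S N).
Proof.
induction N as [|N IH].
- rewrite sum_O. simpl. ring.
- rewrite sum_Sn, IH. reflexivity.
Qed.

Lemma is_series_eq (a : nat -> R) (l l' : R) : is_series a l -> l = l' -> is_series a l'.
Proof. intros h <-. exact h. Qed.

Lemma csum_decr_1 (c : nat -> C) (l : C) :
  csum (fun n => c (S n)) l -> csum c (Cplus (c O) l).
Proof.
intros [h1 h2]. split.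
- apply (is_series_decr_1 (V := R_NormedModule) (fun n => Re (c n))).
  apply (is_series_eq _ _ _ h1).
  change (Re l = Re (c O) + Re l + - Re (c O)). ring.
- apply (is_series_decr_1 (V := R_NormedModule) (fun n => Im (c n))).
  apply (is_series_eq _ _ _ h2).
  change (Im l = Im (c O) + Im l + - Im (c O)). ring.
Qed.

Lemma csum_incr_1 (c : nat -> C) (l : C) :
  csum c l -> csum (fun n => c (S n)) (Cminus l (c O)).
Proof.
intros [h1 h2]. split.
- apply (is_series_incr_1 (V := R_NormedModule) (fun n => Re (c n))).
  apply (is_series_eq _ _ _ h1).
  change (Re l = Re l + - Re (c O) + Re (c O)). ring.
- apply (is_series_incr_1 (V := R_NormedModule) (fun n => Im (c n))).
  apply (is_series_eq _ _ _ h2).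
  change (Im l = Im l + - Im (c O) + Im (c O)). ring.
Qed.

Lemma csum_incr_n (c : nat -> C) (l : C) (N : nat) :
  csum c l -> csum (fun n => c (N + n)%nat) (Cminus l (cpartial c N)).
Proof.
intros h. induction N as [|N IH].
- simpl. replace (l - 0)%C with l by ring. exact h.
- apply csum_incr_1 in IH. simpl.
  replace (l - (cpartial c N + c N))%C with (l - cpartial c N - c (N + 0)%nat)%C
    by (rewrite Nat.add_0_r; ring).
  eapply csum_ext; [|exact IH]. intros n. simpl. f_equal. lia.
Qed.

Lemma csum_zero : csum (fun _ => RtoC 0) (RtoC 0).
Proof.
assert (h : csum (fun n => RtoC ((1/2) ^ n)) (RtoC (/ (1 - 1/2)))).
{ split; simpl.
  - apply is_series_geom. rewrite Rabs_pos_eq; lra.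
  - apply (is_series_eq _ (0 * / (1 - 1/2))); [|ring].
    apply (is_series_ext (fun n => scal 0 ((1/2) ^ n))); [intros n; apply Rmult_0_l|].
    apply (is_series_scal_l (V := R_NormedModule)), is_series_geom.
    rewrite Rabs_pos_eq; lra. }
apply (csum_scal (RtoC 0)) in h. rewrite Cmult_0_l in h.
eapply csum_ext; [|exact h]. intros n; apply Cmult_0_l.
Qed.

Lemma csum_finite (c : nat -> C) (N : nat) :
  (forall n, (N <= n)%nat -> c n = RtoC 0) -> csum c (cpartial c N).
Proof.
revert c. induction N as [|N IH]; intros c h.
- eapply csum_ext; [|apply csum_zero]. intros n; rewrite h; [reflexivity|lia].
- assert (E : cpartial c (S N) = Cplus (c O) (cpartial (fun n => c (S n)) N)).
  { clear. induction N as [|N IH]; [simpl; ring|].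
    change (cpartial c (S (S N))) with (Cplus (cpartial c (S N)) (c (S N))).
    rewrite IH. simpl. ring. }
  rewrite E. apply csum_decr_1, IH. intros n hn; apply h; lia.
Qed.

Lemma csum_single (c : nat -> C) (N : nat) :
  (forall n, n <> N -> c n = RtoC 0) -> csum c (c N).
Proof.
intros h. replace (c N) with (cpartial c (S N)).
- apply csum_finite. intros n hn. apply h; lia.
- simpl. assert (E : forall M, (M <= N)%nat -> cpartial c M = RtoC 0).
  { induction M as [|M IH]; intros hM; [reflexivity|].
    simpl. rewrite IH, h by lia. ring. }
  rewrite E by lia. ring.
Qed.

Lemma csum_partial_lim (c : nat -> C) (l : C) :
  is_lim_seq (fun N => Cmod (Cminus (cpartial c (S N)) l)) 0 -> csum c l.
Proof.
intros h.
(* Covers the real and the imaginary part at once: additivity and the bound by the modulus are all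
   that the argument takes from them. *)
assert (P : forall (f : C -> R),
  (forall z w, f (z - w)%C = f z - f w) -> (forall z w, f (z + w)%C = f z + f w) ->
  (forall z, Rabs (f z) <= Cmod z) -> is_series (fun n => f (c n)) (f l)).
{ intros f hm hp hle.
  assert (L : is_lim_seq (sum_n (fun n => f (c n))) (f l)).
  { apply (is_lim_seq_ext (fun N => (f (cpartial c (S N)) - f l) + f l)).
    - intros N. transitivity (f (cpartial c (S N))); [ring|].
      rewrite <- cpartial_sum_n. induction N as [|N IH]; [rewrite !sum_O; reflexivity|].
      rewrite !sum_Sn. rewrite <- IH. apply hp.
    - replace (Finite (f l)) with (Finite (0 + f l)) by (f_equal; ring).
      apply is_lim_seq_plus'; [|apply is_lim_seq_const].
      apply is_lim_seq_abs_0.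
      apply (is_lim_seq_le_le (fun _ => 0) _ (fun N => Cmod (Cminus (cpartial c (S N)) l)));
        [|apply is_lim_seq_const|exact h].
      intros N. split; [apply Rabs_pos|]. rewrite <- hm. apply hle. }
  exact L. }
split; apply P; intros; try reflexivity; [apply re_le_Cmod|apply im_le_Cmod].
Qed.

(** * A moment problem *)

Lemma INR_fact_pos (n : nat) : 0 < INR (fact n).
Proof. apply lt_0_INR, lt_O_fact. Qed.

Lemma fact_S (n : nat) : INR (fact (S n)) = INR (S n) * INR (fact n).
Proof. change (fact (S n)) with (S n * fact n)%nat. apply mult_INR. Qed.

Lemma pow_le_1 (a : R) (n : nat) : 0 <= a <= 1 -> 0 <= a ^ n <= 1.
Proof.
intros ha. split; [apply pow_le; lra|]. rewrite <- (pow1 n). apply pow_incr; lra.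
Qed.

(** A single term of the binomial expansion of (p + (1 - p))^(n + k) is at most 1. The double
    induction is Pascal's rule: (n + 1) + (k + 1) splits the leading factor of the factorial. *)
Lemma fact_add_bound (p : R) (n k : nat) : 0 <= p <= 1 ->
  INR (fact (n + k)) * (p ^ k * (1 - p) ^ n) <= INR (fact n) * INR (fact k).
Proof.
intros hp. revert n. induction k as [|k IHk]; intros n.
{ rewrite Nat.add_0_r. pose proof (INR_fact_pos n).
  pose proof (pow_le_1 (1 - p) n ltac:(lra)).
  rewrite pow_O, Rmult_1_l. change (INR (fact 0)) with 1.
  apply Rmult_le_compat_l; lra. }
induction n as [|n IHn].
{ pose proof (INR_fact_pos (S k)).
  pose proof (pow_le_1 p (S k) hp).
  rewrite Nat.add_0_l. change (INR (fact 0)) with 1. rewrite pow_O, Rmult_1_r, Rmult_1_l.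
  rewrite <- (Rmult_1_r (INR (fact (S k)))) at 2. apply Rmult_le_compat_l; lra. }
replace (S n + S k)%nat with (S (n + S k)) by lia.
rewrite fact_S.
replace (INR (S (n + S k))) with (INR (S n) + INR (S k)) by (rewrite <- plus_INR; f_equal; lia).
pose proof (IHk (S n)) as H1. replace (S n + k)%nat with (n + S k)%nat in H1 by lia.
assert (0 <= INR (S n)) by apply pos_INR. assert (0 <= INR (S k)) by apply pos_INR.
rewrite (fact_S n), (fact_S k) in *.
set (F := INR (fact (n + S k))) in *.
apply Rle_trans with
  (INR (S n) * (1 - p) * (INR (fact n) * (INR (S k) * INR (fact k)))
   + INR (S k) * p * (INR (S n) * INR (fact n) * INR (fact k))); [|lra].
apply Rle_trans with
  (INR (S n) * (1 - p) * (F * (p ^ S k * (1 - p) ^ n))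
   + INR (S k) * p * (F * (p ^ k * (1 - p) ^ S n))).
- simpl. lra.
- apply Rplus_le_compat; apply Rmult_le_compat_l; try assumption;
    apply Rmult_le_pos; lra.
Qed.

Lemma PS_derive_n_add (j k : nat) (w : nat -> R) (n : nat) :
  PS_derive_n j (PS_derive_n k w) n = PS_derive_n (j + k) w n.
Proof.
unfold PS_derive_n. rewrite Nat.add_assoc.
field. split; apply not_eq_sym, Rlt_not_eq, INR_fact_pos.
Qed.

Section Moments.
Variables (w : nat -> R) (A q : R).
Hypothesis hq : 0 < q < 1.
Hypothesis hw : forall n, Rabs (w n) <= A * q ^ n.

Let dw (k : nat) := PSeries (PS_derive_n k w).

Lemma geom_cv_radius (x : R) : Rabs x <= 1 -> Rbar_lt (Rabs x) (CV_radius w).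
Proof.
intros hx. apply (Rbar_lt_le_trans _ (/ q)).
- simpl. apply (Rle_lt_trans _ 1); [assumption|].
  rewrite <- Rinv_1. apply Rinv_lt_contravar; lra.
- apply (CV_radius_bounded w). exists A. intros n.
  rewrite Rabs_mult, <- RPow_abs, Rabs_inv, (Rabs_pos_eq q) by lra.
  replace A with (A * q ^ n * (/ q) ^ n).
  + apply Rmult_le_compat_r; [|apply hw].
    apply pow_le, Rlt_le, Rinv_0_lt_compat; lra.
  + rewrite Rmult_assoc, <- Rpow_mult_distr, Rinv_r, pow1 by lra. ring.
Qed.

(** A Cauchy estimate with constants independent of the point: the Taylor series has radius at least
    1/B around every point of [-1, 1], so the length of a continuation step can be fixed in
    advance. *)
Lemma geom_derive_bound : exists K B, 0 <= K /\ 0 < B /\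
  forall k x, Rabs x <= 1 -> Rabs (dw k x) <= K * (INR (fact k) * B ^ k).
Proof.
(* [a] lies strictly between [q] and 1, and p = 1 - a. The binomial bound at [p] costs 1/a^n and
   1/p^k, which leaves the summable ratio q / a and the rate B = q / p. *)
set (a := (1 + q) / 2). set (p := (1 - q) / 2).
assert (ha : 0 < a < 1) by (unfold a; lra). assert (hp : 0 < p < 1) by (unfold p; lra).
assert (hqa : 0 < q / a < 1).
{ split; [apply Rdiv_lt_0_compat; lra|]. apply (Rmult_lt_reg_r a); [lra|].
  unfold Rdiv. rewrite Rmult_assoc, Rinv_l by lra. unfold a. lra. }
assert (hA : 0 <= A) by (pose proof (hw 0); pose proof (Rabs_pos (w 0)); simpl in *; lra).
exists (A * / (1 - q / a)), (q / p). split; [|split].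
- apply Rmult_le_pos; [assumption|]. apply Rlt_le, Rinv_0_lt_compat; lra.
- apply Rdiv_lt_0_compat; lra.
- intros k x hx. unfold dw.
  apply (is_series_Rabs_le (fun n => PS_derive_n k w n * x ^ n)
    (fun n => (A * (INR (fact k) * (q / p) ^ k)) * (q / a) ^ n)).
  + intros n. rewrite Rabs_mult. unfold PS_derive_n.
    rewrite Rabs_mult, Rabs_pos_eq
      by (apply Rlt_le, Rdiv_lt_0_compat; apply INR_fact_pos).
    apply Rle_trans with (INR (fact (n + k)) / INR (fact n) * (A * q ^ (n + k)) * 1).
    * apply Rmult_le_compat.
      -- apply Rmult_le_pos; [|apply Rabs_pos].
         apply Rlt_le, Rdiv_lt_0_compat; apply INR_fact_pos.
      -- apply Rabs_pos.
      -- apply Rmult_le_compat_l; [|apply hw].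
         apply Rlt_le, Rdiv_lt_0_compat; apply INR_fact_pos.
      -- rewrite <- RPow_abs, <- (pow1 n). apply pow_incr. split; [apply Rabs_pos|assumption].
    * pose proof (fact_add_bound p n k ltac:(lra)) as H.
      replace (1 - p) with a in H by (unfold a, p; field).
      pose proof (INR_fact_pos n). pose proof (INR_fact_pos k).
      assert (0 < a ^ n) by (apply pow_lt; lra). assert (0 < p ^ k) by (apply pow_lt; lra).
      assert (0 < q ^ n) by (apply pow_lt; lra). assert (0 < q ^ k) by (apply pow_lt; lra).
      unfold Rdiv. rewrite !Rpow_mult_distr, !pow_inv, pow_add.
      apply (Rmult_le_reg_r (INR (fact n) * a ^ n * p ^ k)).
      { repeat apply Rmult_lt_0_compat; assumption. }
      replace (INR (fact (n + k)) * / INR (fact n) * (A * (q ^ n * q ^ k)) * 1 *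
        (INR (fact n) * a ^ n * p ^ k)) with
        (A * q ^ n * q ^ k * (INR (fact (n + k)) * (p ^ k * a ^ n))) by (field; lra).
      replace (A * (INR (fact k) * (q ^ k * / p ^ k)) * (q ^ n * / a ^ n) *
        (INR (fact n) * a ^ n * p ^ k)) with
        (A * q ^ n * q ^ k * (INR (fact n) * INR (fact k))) by (field; lra).
      apply Rmult_le_compat_l; [|assumption].
      repeat apply Rmult_le_pos; lra.
  + assert (E : ex_pseries (PS_derive_n k w) x).
    { apply CV_radius_inside. rewrite CV_radius_derive_n. apply geom_cv_radius, hx. }
    destruct E as [l hl]. pose proof (is_pseries_unique _ _ _ hl) as E. rewrite E.
    apply is_pseries_R in hl. exact hl.
  + replace (A * / (1 - q / a) * (INR (fact k) * (q / p) ^ k))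
      with ((A * (INR (fact k) * (q / p) ^ k)) * / (1 - q / a)) by ring.
    apply (is_series_scal_l (V := R_NormedModule)), is_series_geom.
    rewrite Rabs_pos_eq; lra.
Qed.

Lemma pow_lim0 (c K : R) : 0 <= c <= / 2 -> is_lim_seq (fun N => K * c ^ N) 0.
Proof.
intros hc. replace (Finite 0) with (Rbar_mult K 0) by (simpl; f_equal; ring).
apply is_lim_seq_scal_l, is_lim_seq_geom. rewrite Rabs_pos_eq; lra.
Qed.

(* At points where all derivatives vanish the Taylor remainder alone is left; its radius of
   convergence is bounded below on [-1, 0], so finitely many such steps lead from [-1] to [0]. *)
Lemma taylor_step (K B x y : R) : 0 <= K -> 0 < B ->
  (forall k t, Rabs t <= 1 -> Rabs (dw k t) <= K * (INR (fact k) * B ^ k)) ->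
  -1 <= x < y -> y <= 0 -> (y - x) * (4 * B) <= 1 ->
  (forall k, dw k x = 0) -> forall k, dw k y = 0.
Proof.
intros hK hB hb hxy hy hstep hx k.
assert (der : forall j t, -1 <= t <= 0 -> Derive_n (dw k) j t = dw (j + k) t).
{ intros j t ht. unfold dw. rewrite Derive_n_PSeries.
  - apply PSeries_ext. intros n. apply PS_derive_n_add.
  - rewrite CV_radius_derive_n. apply geom_cv_radius. apply Rabs_le; lra. }
assert (bd : forall N, Rabs (dw k y) <= (K * (2 * B) ^ k * INR (fact k)) * (/ 2) ^ (S N)).
{ intros N.
  destruct (Taylor_Lagrange (dw k) N x y ltac:(lra)) as [z [hz E]].
  { intros t ht j _. apply ex_derive_n_PSeries.
    rewrite CV_radius_derive_n. apply geom_cv_radius. apply Rabs_le; lra. }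
  rewrite E. rewrite (sum_eq _ (fun _ => 0)).
  2:{ intros j _. rewrite der by lra. rewrite hx. ring. }
  rewrite sum_cte, Rmult_0_l, Rplus_0_l, der by lra.
  pose proof (hb (S N + k)%nat z ltac:(apply Rabs_le; lra)) as H.
  rewrite Rabs_mult, Rabs_pos_eq.
  2:{ apply Rmult_le_pos; [apply pow_le; lra|].
      apply Rlt_le, Rinv_0_lt_compat, INR_fact_pos. }
  set (M := S N) in *.
  (* The remainder of order [M] for the k-th derivative involves (M + k)!, at most 2^(M+k) M! k!.
     The factor 2^M together with a remainder ratio of 1/2 explains the step length 1/(4B). *)
  pose proof (fact_add_bound (/ 2) M k ltac:(lra)) as G.
  replace (1 - / 2) with (/ 2) in G by field.
  pose proof (INR_fact_pos M). pose proof (INR_fact_pos k).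
  assert (h1 : ((y - x) * (2 * B)) ^ M <= (/ 2) ^ M).
  { apply pow_incr. split; [apply Rmult_le_pos; lra|lra]. }
  assert (0 < (y - x) ^ M) by (apply pow_lt; lra).
  assert (0 < B ^ k) by (apply pow_lt; lra).
  assert (0 < B ^ M) by (apply pow_lt; lra).
  assert (0 < 2 ^ M) by (apply pow_lt; lra).
  assert (0 < 2 ^ k) by (apply pow_lt; lra).
  apply Rle_trans with ((y - x) ^ M / INR (fact M) * (K * (INR (fact (M + k)) * B ^ (M + k)))).
  { apply Rmult_le_compat_l; [|assumption].
    apply Rlt_le, Rdiv_lt_0_compat; assumption. }
  apply Rle_trans with ((K * (2 * B) ^ k * INR (fact k)) * ((y - x) * (2 * B)) ^ M).
  - rewrite !Rpow_mult_distr, pow_add. rewrite !pow_inv in G.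
    assert (G' : INR (fact (M + k)) <= 2 ^ k * 2 ^ M * (INR (fact M) * INR (fact k))).
    { apply (Rmult_le_reg_r (/ 2 ^ k * / 2 ^ M)).
      - apply Rmult_lt_0_compat; apply Rinv_0_lt_compat; assumption.
      - eapply Rle_trans; [exact G|]. right. field. lra. }
    replace (K * (2 ^ k * B ^ k) * INR (fact k) * ((y - x) ^ M * (2 ^ M * B ^ M))) with
      ((y - x) ^ M / INR (fact M) * (K * ((2 ^ k * 2 ^ M * (INR (fact M) * INR (fact k))) * (B ^ M * B ^ k))))
      by (field; lra).
    apply Rmult_le_compat_l; [apply Rlt_le, Rdiv_lt_0_compat; assumption|].
    apply Rmult_le_compat_l; [assumption|].
    apply Rmult_le_compat_r; [|assumption]. apply Rmult_le_pos; lra.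
  - apply Rmult_le_compat_l; [|assumption].
    apply Rmult_le_pos; [|lra]. apply Rmult_le_pos; [assumption|].
    apply pow_le. lra. }
assert (L : is_lim_seq (fun N => (K * (2 * B) ^ k * INR (fact k)) * (/ 2) ^ (S N)) 0).
{ apply (is_lim_seq_incr_1 (fun N => (K * (2 * B) ^ k * INR (fact k)) * (/ 2) ^ N)).
  apply pow_lim0. lra. }
pose proof (is_lim_seq_le _ _ _ _ bd (is_lim_seq_const (Rabs (dw k y))) L) as E.
simpl in E. pose proof (Rabs_pos (dw k y)).
apply Rabs_eq_0. lra.
Qed.

Lemma moments_neg_one_zero :
  (forall k, dw k (-1) = 0) -> forall n, w n = 0.
Proof.
intros h0. destruct geom_derive_bound as [K [B [hK [hB hb]]]].
(* [M] equal steps of length 1/M, below 1/(4B), lead from -1 to 0. *)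
destruct (INR_unbounded (4 * B)) as [M hM].
assert (hM0 : 0 < INR M) by lra.
assert (st : forall i, (i <= M)%nat -> forall k, dw k (-1 + INR i / INR M) = 0).
{ induction i as [|i IH]; intros hi.
  - simpl (INR 0). replace (-1 + 0 / INR M) with (-1) by (field; lra). exact h0.
  - assert (hi' : INR (S i) <= INR M) by (apply le_INR; lia).
    assert (hd : (-1 + INR (S i) / INR M) - (-1 + INR i / INR M) = / INR M)
      by (rewrite S_INR; field; lra).
    pose proof (Rinv_0_lt_compat _ hM0).
    assert (0 <= INR i / INR M).
    { apply Rmult_le_pos; [apply pos_INR|lra]. }
    assert (INR (S i) / INR M <= 1).
    { apply (Rmult_le_reg_r (INR M)); [assumption|].
      unfold Rdiv. rewrite Rmult_assoc, Rinv_l by lra. lra. }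
    apply (taylor_step K B (-1 + INR i / INR M)); auto; try lra.
    + rewrite hd. apply (Rmult_le_reg_l (INR M)); [assumption|].
      rewrite <- Rmult_assoc, Rinv_r by lra. lra.
    + apply IH. lia. }
(* At 0 the derivative of order [n] is n! times [w n]. *)
intros n. specialize (st M (le_n M) n).
replace (-1 + INR M / INR M) with 0 in st by (field; lra).
unfold dw in st. rewrite PSeries_0 in st. unfold PS_derive_n in st.
rewrite Nat.add_0_l in st. change (INR (fact 0)) with 1 in st.
pose proof (INR_fact_pos n). unfold Rdiv in st. rewrite Rinv_1, Rmult_1_r in st.
apply Rmult_integral in st. destruct st; lra.
Qed.

End Moments.

(** Moves the base point from 1 to -1: the Taylor formula in use expands to the right, so 0, where
    the coefficients are read off, has to be reached from the left. *)
Lemma sign_flip_PSeries (w : nat -> R) (k : nat) :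
  PSeries (PS_derive_n k (fun n => (-1) ^ n * w n)) (-1) =
  (-1) ^ k * PSeries (PS_derive_n k w) 1.
Proof.
unfold PSeries. rewrite <- Series_scal_l. apply Series_ext. intros n.
unfold PS_derive_n. rewrite pow1, pow_add.
replace ((-1) ^ n * (-1) ^ k) with ((-1) ^ k * (-1) ^ n) by ring.
transitivity (((-1) ^ n * (-1) ^ n) * ((-1) ^ k * (INR (fact (n + k)) / INR (fact n) * w (n + k)%nat))).
- field. apply not_eq_sym, Rlt_not_eq, INR_fact_pos.
- rewrite <- Rpow_mult_distr. replace (-1 * -1) with 1 by ring. rewrite pow1. ring.
Qed.

Lemma moment_zero (w : nat -> R) (A q : R) : 0 < q < 1 ->
  (forall n, Rabs (w n) <= A * q ^ n) ->
  (forall k, PSeries (PS_derive_n k w) 1 = 0) ->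
  forall n, w n = 0.
Proof.
intros hq hw h n.
assert (E : (-1) ^ n * w n = 0).
{ apply (moments_neg_one_zero (fun n => (-1) ^ n * w n) A q hq).
  - intros m. rewrite Rabs_mult, pow_1_abs, Rmult_1_l. apply hw.
  - intros k. rewrite sign_flip_PSeries, h. ring. }
apply Rmult_integral in E. destruct E as [E|E]; [|exact E].
exfalso. revert E. apply pow_nonzero. lra.
Qed.

(** * Matrices of Hilbert-Schmidt operators *)

(** Deliberately crude: y^(2n) <= y^n and sqrt(1/(1-y)) <= 1/(1-y) keep the bound linear in [G], so
    it can be applied twice, first to the columns of a matrix and then to the sequence of column
    norms. *)
Lemma l2norm_geom {V : NormedModule C_AbsRing} (x : nat -> V) (G y : R) :
  0 < y < 1 -> (forall n, norm (x n) <= G * y ^ n) ->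
  sqsum x /\ l2norm x <= G / (1 - y).
Proof.
intros hy hx.
assert (hG : 0 <= G).
{ pose proof (hx 0%nat). pose proof (norm_ge_0 (x 0%nat)). simpl in *. lra. }
assert (S1 : is_series (fun n => G ^ 2 * y ^ n) (G ^ 2 * / (1 - y))).
{ apply (is_series_scal_l (V := R_NormedModule)), is_series_geom. rewrite Rabs_pos_eq; lra. }
assert (B : forall n, 0 <= norm (x n) ^ 2 <= G ^ 2 * y ^ n).
{ intros n. split; [apply pow2_ge_0|].
  apply Rle_trans with ((G * y ^ n) ^ 2).
  - apply pow_incr. split; [apply norm_ge_0|apply hx].
  - rewrite Rpow_mult_distr. apply Rmult_le_compat_l; [apply pow2_ge_0|].
    pose proof (pow_le_1 y n ltac:(lra)). nra. }
assert (hs : sqsum x) by (apply (ex_series_le_pos _ _ B); eexists; exact S1).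
split; [exact hs|].
assert (h1 : 0 < / (1 - y)) by (apply Rinv_0_lt_compat; lra).
assert (h2 : 1 <= / (1 - y)).
{ rewrite <- Rinv_1 at 1. apply Rinv_le_contravar; lra. }
apply Rsqr_incr_0_var; [|unfold Rdiv; apply Rmult_le_pos; lra].
rewrite !Rsqr_pow2, (l2norm_sq _ hs).
apply Rle_trans with (G ^ 2 * / (1 - y)).
- rewrite <- (is_series_unique _ _ S1). apply Series_le; [exact B|eexists; exact S1].
- unfold Rdiv. rewrite Rpow_mult_distr. apply Rmult_le_compat_l; [apply pow2_ge_0|]. nra.
Qed.

Lemma norm_term_le_l2norm {V : NormedModule C_AbsRing} (x : nat -> V) (n : nat) :
  sqsum x -> norm (x n) <= l2norm x.
Proof.
intros hx. apply Rsqr_incr_0_var; [|apply l2norm_pos].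
rewrite !Rsqr_pow2, (l2norm_sq _ hx).
apply (Series_pos_term (fun n => norm (x n) ^ 2)); [|exact hx].
intros; apply pow2_ge_0.
Qed.

Lemma coord_le (x : fock) (n : nat) :
  Cmod (x n) <= l2norm (V := C_NormedModule) x.
Proof. apply (norm_term_le_l2norm (V := C_NormedModule) (coord x)), coord_sqsum. Qed.

Definition entry (X : bop) (m n : nat) : C := X (e_ n) m.

Lemma col_le (U : hs) (n : nat) : l2norm (V := C_NormedModule) (U (e_ n)) <= hs_norm U.
Proof.
apply (norm_term_le_l2norm (V := fock_NormedModule) (fun n => U (e_ n))), hs_sqsum.
Qed.

Lemma entry_le (U : hs) (m n : nat) : Cmod (entry U m n) <= hs_norm U.
Proof. eapply Rle_trans; [apply coord_le|apply col_le]. Qed.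

Lemma bop_ext_entry (X Y : bop) : (forall m n, entry X m n = entry Y m n) -> X = Y.
Proof.
intros h.
assert (E : bop_plus X (bop_opp Y) = bop_zero).
{ apply bop_zero_basis. intros n. apply fock_eq. intros m.
  change (Cplus (entry X m n) (Cmult (Copp 1) (entry Y m n)) = RtoC 0).
  rewrite h. ring. }
apply bop_eq. intros x. apply fock_eq. intros m.
assert (E' : coord (bop_plus X (bop_opp Y) x) m = RtoC 0) by (rewrite E; reflexivity).
change (Cplus (X x m) (Cmult (Copp 1) (Y x m)) = RtoC 0) in E'.
replace (X x m) with (Cplus (Cplus (X x m) (Cmult (Copp 1) (Y x m))) (Y x m)) by ring.
rewrite E'. ring.
Qed.

Lemma hs_ext (X Y : hs) : (forall m n, entry X m n = entry Y m n) -> X = Y.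
Proof. intros h. apply hs_eq, bop_ext_entry, h. Qed.

(** Geometric decay in both indices yields a Hilbert-Schmidt operator whose norm, for fixed [y], is
    controlled linearly by [G]. Separating [G] from [y] allows series of operators with a common
    rate to be summed. *)
Definition bounded_by (M : nat -> nat -> C) (G y : R) : Prop :=
  0 < y < 1 /\ forall m n, Cmod (M m n) <= G * (y ^ m * y ^ n).

Definition rapid (M : nat -> nat -> C) : Prop := exists G y, bounded_by M G y.

Lemma bounded_by_nonneg (M : nat -> nat -> C) (G y : R) : bounded_by M G y -> 0 <= G.
Proof.
intros [_ h]. specialize (h 0%nat 0%nat). pose proof (Cmod_ge_0 (M 0%nat 0%nat)).
simpl in h. lra.
Qed.

Definition mat_act (M : nat -> nat -> C) (x : nat -> C) (m : nat) : C :=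
  Cseries (fun n => Cmult (M m n) (x n)).

Lemma mat_act_dom (M : nat -> nat -> C) (G y : R) (x : fock) (m n : nat) :
  bounded_by M G y ->
  Cmod (Cmult (M m n) (x n)) <= (G * y ^ m * l2norm (V := C_NormedModule) x) * y ^ n.
Proof.
intros h. pose proof (bounded_by_nonneg _ _ _ h) as hG. destruct h as [hy hM].
rewrite Cmod_mult.
replace ((G * y ^ m * l2norm (V := C_NormedModule) x) * y ^ n)
  with ((G * (y ^ m * y ^ n)) * l2norm (V := C_NormedModule) x) by ring.
apply Rmult_le_compat; try apply Cmod_ge_0; [apply hM|apply coord_le].
Qed.

Lemma geom_series_scal (K y : R) : 0 < y < 1 ->
  is_series (fun n => K * y ^ n) (K * / (1 - y)).
Proof.
intros hy. apply (is_series_scal_l (V := R_NormedModule)), is_series_geom.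
rewrite Rabs_pos_eq; lra.
Qed.

Lemma mat_act_csum (M : nat -> nat -> C) (x : fock) (m : nat) :
  rapid M -> csum (fun n => Cmult (M m n) (x n)) (mat_act M x m).
Proof.
intros [G [y h]].
apply (csum_dom _ (fun n => (G * y ^ m * l2norm (V := C_NormedModule) x) * y ^ n)).
- intros n; apply mat_act_dom, h.
- eexists; apply geom_series_scal, h.
Qed.

Lemma mat_act_le (M : nat -> nat -> C) (G y : R) (x : fock) (m : nat) :
  bounded_by M G y ->
  Cmod (mat_act M x m) <= (2 * (G * l2norm (V := C_NormedModule) x / (1 - y))) * y ^ m.
Proof.
intros h.
replace ((2 * (G * l2norm (V := C_NormedModule) x / (1 - y))) * y ^ m)
  with (2 * ((G * y ^ m * l2norm (V := C_NormedModule) x) * / (1 - y))) by (unfold Rdiv; ring).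
apply (csum_bound (fun n => Cmult (M m n) (x n))
  (fun n => (G * y ^ m * l2norm (V := C_NormedModule) x) * y ^ n)).
- intros n; apply mat_act_dom, h.
- apply geom_series_scal, h.
- apply mat_act_csum. exists G, y; exact h.
Qed.

Lemma mat_act_sqsum (M : nat -> nat -> C) (hM : rapid M) (x : fock) :
  sqsum (V := C_NormedModule) (mat_act M x).
Proof.
destruct hM as [G [y h]].
apply (l2norm_geom (V := C_NormedModule) _ _ y (proj1 h)
  (fun m => mat_act_le M G y x m h)).
Qed.

Definition mat_fun (M : nat -> nat -> C) (hM : rapid M) (x : fock) : fock :=
  mk_fock (mat_act M x) (mat_act_sqsum M hM x).

Lemma mat_linear (M : nat -> nat -> C) (hM : rapid M) :
  is_linear (V := fock_NormedModule) (mat_fun M hM).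
Proof.
split.
- intros x z. apply fock_eq; intros m. apply csum_Cseries.
  eapply csum_ext; [|apply csum_plus; apply mat_act_csum, hM].
  intros n. symmetry. apply Cmult_plus_distr_l.
- intros k x. apply fock_eq; intros m. apply csum_Cseries.
  eapply csum_ext; [|apply csum_scal, mat_act_csum, hM].
  intros n. change (Cmult k (Cmult (M m n) (x n)) = Cmult (M m n) (Cmult k (x n))). ring.
- destruct hM as [G [y h]]. pose proof (bounded_by_nonneg _ _ _ h) as hG.
  pose proof h as [hy _].
  assert (h1 : 0 < / (1 - y)) by (apply Rinv_0_lt_compat; lra).
  exists (2 * (G * / (1 - y) * / (1 - y)) + 1). split.
  { assert (0 <= G * / (1 - y) * / (1 - y)) by (repeat apply Rmult_le_pos; lra). lra. }
  intros x.
  change (l2norm (V := C_NormedModule) (mat_act M x)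
    <= (2 * (G * / (1 - y) * / (1 - y)) + 1) * l2norm (V := C_NormedModule) x).
  destruct (l2norm_geom (V := C_NormedModule) _ _ y hy
    (fun m => mat_act_le M G y x m h)) as [_ B].
  eapply Rle_trans; [exact B|].
  pose proof (l2norm_pos (V := C_NormedModule) x). unfold Rdiv. lra.
Qed.

Definition mat_bop (M : nat -> nat -> C) (hM : rapid M) : bop :=
  mk_bop (mat_fun M hM) (mat_linear M hM).

Lemma mat_bop_entry (M : nat -> nat -> C) (hM : rapid M) (m n : nat) :
  entry (mat_bop M hM) m n = M m n.
Proof.
apply csum_Cseries.
assert (E : csum (fun k => Cmult (M m k) (delta n k)) (Cmult (M m n) (delta n n))).
{ apply (csum_single (fun k => Cmult (M m k) (delta n k)) n).
  intros k hk. unfold delta. destruct (Nat.eqb_spec k n); [contradiction|ring]. }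
replace (M m n) with (Cmult (M m n) (delta n n)); [exact E|].
unfold delta. rewrite Nat.eqb_refl. ring.
Qed.

Lemma bop_rapid_hs (X : bop) (G y : R) : bounded_by (entry X) G y ->
  sqsum (V := fock_NormedModule) (fun n => X (e_ n)) /\
  l2norm (V := fock_NormedModule) (fun n => X (e_ n)) <= G / (1 - y) / (1 - y).
Proof.
intros [hy h].
apply l2norm_geom; [exact hy|]. intros n.
change (l2norm (V := C_NormedModule) (X (e_ n)) <= G / (1 - y) * y ^ n).
replace (G / (1 - y) * y ^ n) with ((G * y ^ n) / (1 - y)) by (unfold Rdiv; ring).
apply (l2norm_geom (V := C_NormedModule) (coord (X (e_ n))) (G * y ^ n) y hy).
intros m. replace (G * y ^ n * y ^ m) with (G * (y ^ m * y ^ n)) by ring. apply h.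
Qed.

Lemma mat_bop_sqsum (M : nat -> nat -> C) (hM : rapid M) :
  sqsum (V := fock_NormedModule) (fun n => mat_bop M hM (e_ n)).
Proof.
pose proof hM as [G [y [hy h]]].
apply (bop_rapid_hs _ G y). split; [exact hy|]. intros m n. rewrite mat_bop_entry. apply h.
Qed.

(** The operator with matrix [M] (zero if [M] does not decay geometrically). *)
Definition mat_op (M : nat -> nat -> C) : hs :=
  match excluded_middle_informative (rapid M) with
  | left hM => mk_hs (mat_bop M hM) (mat_bop_sqsum M hM)
  | right _ => hs_zero
  end.

Lemma mat_op_entry (M : nat -> nat -> C) (m n : nat) :
  rapid M -> entry (mat_op M) m n = M m n.
Proof.
intros h. unfold mat_op. destruct (excluded_middle_informative (rapid M)); [|contradiction].
apply mat_bop_entry.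
Qed.

Lemma mat_op_act (M : nat -> nat -> C) (x : fock) (m : nat) :
  rapid M -> mat_op M x m = mat_act M x m.
Proof.
intros h. unfold mat_op. destruct (excluded_middle_informative (rapid M)); [|contradiction].
reflexivity.
Qed.

Lemma hs_norm_rapid (U : hs) (G y : R) :
  bounded_by (entry U) G y -> hs_norm U <= G / (1 - y) / (1 - y).
Proof. intros h. apply (bop_rapid_hs U G y h). Qed.

Lemma rapid_ext (M N : nat -> nat -> C) :
  (forall m n, M m n = N m n) -> rapid M -> rapid N.
Proof.
intros h [G [y [hy hM]]]. exists G, y. split; [exact hy|]. intros; rewrite <- h; apply hM.
Qed.

Lemma rapid_scal (k : C) (M : nat -> nat -> C) :
  rapid M -> rapid (fun m n => Cmult k (M m n)).
Proof.
intros [G [y [hy hM]]]. exists (Cmod k * G), y. split; [exact hy|]. intros m n.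
rewrite Cmod_mult, Rmult_assoc. apply Rmult_le_compat_l; [apply Cmod_ge_0|apply hM].
Qed.

Lemma bounded_by_mono (M : nat -> nat -> C) (G y z : R) :
  bounded_by M G y -> y <= z < 1 -> bounded_by M G z.
Proof.
intros h hz. pose proof (bounded_by_nonneg _ _ _ h). destruct h as [hy h].
split; [lra|]. intros m n. eapply Rle_trans; [apply h|].
apply Rmult_le_compat_l; [assumption|].
apply Rmult_le_compat; try (apply pow_le; lra); apply pow_incr; lra.
Qed.

Lemma rapid_plus (M N : nat -> nat -> C) :
  rapid M -> rapid N -> rapid (fun m n => Cplus (M m n) (N m n)).
Proof.
intros [G [y h]] [H [z g]].
pose proof (Rmax_l y z). pose proof (Rmax_r y z).
assert (Rmax y z < 1) by (apply Rmax_lub_lt; [apply h|apply g]).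
apply (bounded_by_mono _ _ _ (Rmax y z)) in h; [|lra].
apply (bounded_by_mono _ _ _ (Rmax y z)) in g; [|lra].
exists (G + H), (Rmax y z). split; [apply h|]. intros m n.
eapply Rle_trans; [apply Cmod_triangle|].
rewrite Rmult_plus_distr_r. apply Rplus_le_compat; [apply h|apply g].
Qed.

Lemma mat_op_ext (M N : nat -> nat -> C) :
  (forall m n, M m n = N m n) -> mat_op M = mat_op N.
Proof.
intros h. f_equal. apply functional_extensionality. intros m.
apply functional_extensionality. intros n. apply h.
Qed.

Lemma mat_op_plus (M N : nat -> nat -> C) : rapid M -> rapid N ->
  mat_op (fun m n => Cplus (M m n) (N m n)) = plus (mat_op M) (mat_op N).
Proof.
intros hM hN. apply hs_ext. intros m n.
rewrite mat_op_entry by (apply rapid_plus; assumption).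
change (M m n + N m n = entry (mat_op M) m n + entry (mat_op N) m n)%C.
rewrite !mat_op_entry by assumption. reflexivity.
Qed.

Lemma mat_op_scal (k : C) (M : nat -> nat -> C) : rapid M ->
  mat_op (fun m n => Cmult k (M m n)) = scal k (mat_op M).
Proof.
intros hM. apply hs_ext. intros m n.
rewrite mat_op_entry by (apply rapid_scal; assumption).
change (k * M m n = k * entry (mat_op M) m n)%C.
rewrite !mat_op_entry by assumption. reflexivity.
Qed.

(** * Bounded functionals *)

(** Operator identities are tested on bounded functionals, which turns norm-convergent series of
    operators into series of complex numbers. The instances are matrix entries, pairings, and their
    composites with the semigroup. *)
Record functional (F : hs -> C) : Prop := {
  fun_plus : forall X Y, F (plus X Y) = Cplus (F X) (F Y);
  fun_scal : forall (k : C) X, F (scal k X) = Cmult k (F X);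
  fun_bd : exists K, 0 <= K /\ forall X, Cmod (F X) <= K * hs_norm X }.

Lemma functional_minus (F : hs -> C) (X Y : hs) :
  functional F -> F (minus X Y) = Cminus (F X) (F Y).
Proof.
intros hF. unfold minus. rewrite (fun_plus _ hF).
change (opp Y) with (hs_opp Y). unfold hs_opp.
change (hs_scal (Copp 1) Y) with (scal (Copp 1 : C_Ring) Y).
rewrite (fun_scal _ hF). ring.
Qed.

Lemma functional_zero (F : hs -> C) : functional F -> F zero = RtoC 0.
Proof.
intros hF.
replace (zero : hs) with (scal (RtoC 0 : C_Ring) (zero : hs_ModuleSpace))
  by apply (scal_zero_l (zero : hs_ModuleSpace)).
etransitivity; [apply (fun_scal _ hF)|]. apply Cmult_0_l.
Qed.

(** With a common rate [y] and summable constants, the tails decay at the same rate with constants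
    tending to zero. The series therefore converges in Hilbert-Schmidt norm to its entrywise sum,
    and [F] may be applied term by term. *)
Lemma functional_csum (F : hs -> C) (Mk : nat -> nat -> nat -> C) (M : nat -> nat -> C)
  (G : nat -> R) (y : R) :
  functional F -> (forall k, bounded_by (Mk k) (G k) y) -> ex_series G ->
  (forall m n, csum (fun k => Mk k m n) (M m n)) ->
  rapid M /\ csum (fun k => F (mat_op (Mk k))) (F (mat_op M)).
Proof.
intros hF hk [g hG] hM.
assert (hy : 0 < y < 1) by apply (hk O).
(* The 2 comes from [csum_bound]. The tail at [N = 0] is the whole sum, which gives the decay of [M]
   itself. *)
assert (T : forall N, bounded_by (fun m n => Cminus (M m n) (cpartial (fun k => Mk k m n) N))
    (2 * Series (fun k => G (N + k)%nat)) y).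
{ intros N. split; [exact hy|]. intros m n.
  rewrite Rmult_assoc.
  apply (csum_bound (fun k => Mk (N + k)%nat m n)
    (fun k => G (N + k)%nat * (y ^ m * y ^ n))).
  - intros k. apply hk.
  - apply is_series_scal_r. apply Series_correct.
    apply (ex_series_incr_n G N). exists g; exact hG.
  - apply (csum_incr_n (fun k => Mk k m n)), hM. }
assert (rM : rapid M).
{ destruct (T O) as [_ h]. exists (2 * Series (fun k => G (0 + k)%nat)), y.
  split; [exact hy|]. intros m n. specialize (h m n). simpl in h.
  replace (M m n - 0)%C with (M m n) in h by ring. exact h. }
split; [exact rM|].
assert (P : forall N, rapid (fun m n => cpartial (fun k => Mk k m n) N) /\
  F (mat_op (fun m n => cpartial (fun k => Mk k m n) N)) =
  cpartial (fun k => F (mat_op (Mk k))) N).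
{ induction N as [|N [IH1 IH2]].
  - split.
    + exists 0, y. split; [exact hy|]. intros m n. simpl. rewrite Cmod_0. lra.
    + simpl. etransitivity; [|apply (functional_zero F hF)]. f_equal. apply hs_ext. intros m n.
      rewrite mat_op_entry; [reflexivity|].
      exists 0, y. split; [exact hy|]. intros i j. simpl. rewrite Cmod_0. lra.
  - assert (rN : rapid (Mk N)) by (eexists; eexists; apply hk).
    split; [apply (rapid_plus _ _ IH1 rN)|].
    simpl. rewrite mat_op_plus by assumption. rewrite (fun_plus _ hF), IH2. reflexivity. }
apply csum_partial_lim.
destruct (fun_bd _ hF) as [K [hK hb]].
assert (h1 : 0 < / (1 - y)) by (apply Rinv_0_lt_compat; lra).
apply (is_lim_seq_le_le (fun _ => 0) _
  (fun N => (K * / (1 - y) * / (1 - y) * 2) * Series (fun k => G (S N + k)%nat))).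
- intros N. split; [apply Cmod_ge_0|].
  rewrite <- (proj2 (P (S N))).
  replace (Cmod _) with (Cmod (F (minus (mat_op M) (mat_op (fun m n => cpartial (fun k => Mk k m n) (S N)))))).
  2:{ rewrite (functional_minus _ _ _ hF).
      rewrite <- Cmod_opp. f_equal. ring. }
  eapply Rle_trans; [apply hb|].
  rewrite !Rmult_assoc. apply Rmult_le_compat_l; [assumption|].
  replace (/ (1 - y) * (/ (1 - y) * (2 * Series (fun k => G (S N + k)%nat))))
    with (2 * Series (fun k => G (S N + k)%nat) / (1 - y) / (1 - y)) by (unfold Rdiv; ring).
  apply hs_norm_rapid. split; [exact hy|]. intros m n.
  replace (entry _ m n) with (Cminus (M m n) (cpartial (fun k => Mk k m n) (S N)));
    [apply T|].
  change (M m n - cpartial (fun k => Mk k m n) (S N) =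
    entry (mat_op M) m n + Copp 1 *
    entry (mat_op (fun m n => cpartial (fun k => Mk k m n) (S N))) m n)%C.
  rewrite !mat_op_entry by (apply P || assumption). ring.
- apply is_lim_seq_const.
- set (c := K * / (1 - y) * / (1 - y) * 2).
  replace (Finite 0) with (Rbar_mult c 0) by (simpl; f_equal; ring).
  apply is_lim_seq_scal_l.
  apply (is_lim_seq_ext (fun N => Series G - sum_n G N)).
  + intros N. rewrite (Series_incr_n G (S N)); [|lia|exists g; exact hG].
    simpl pred. rewrite sum_n_Reals. ring.
  + rewrite (is_series_unique _ _ hG).
    replace (Finite 0) with (Finite (g - g)) by (f_equal; ring).
    apply is_lim_seq_minus'; [apply is_lim_seq_const|exact hG].
Qed.

(** * Totality of the matrix units *)

Lemma l2norm_tail_lim {V : NormedModule C_AbsRing} (x : nat -> V) : sqsum x ->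
  is_lim_seq (fun N => l2norm (fun n => if Nat.leb n N then zero else x n)) 0.
Proof.
intros hx.
set (f := fun n => norm (x n) ^ 2).
assert (E : forall N, l2norm (fun n => if Nat.leb n N then zero else x n)
  = sqrt (Series f - sum_n f N)).
{ intros N. unfold l2norm. f_equal.
  set (g := fun n => norm (if Nat.leb n N then zero else x n) ^ 2).
  assert (hg : forall n, g (S N + n)%nat = f (S N + n)%nat).
  { intros n. unfold g, f. destruct (Nat.leb_spec (S N + n) N); [lia|reflexivity]. }
  assert (ex : ex_series g).
  { apply (ex_series_incr_n (V := R_NormedModule) g (S N)).
    apply (ex_series_ext (V := R_NormedModule) (fun n => f (S N + n)%nat)).
    - intros n; symmetry; apply hg.
    - apply (ex_series_incr_n (V := R_NormedModule) f (S N)), hx. }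
  rewrite (Series_incr_n g (S N)) by (lia || exact ex).
  rewrite (Series_incr_n f (S N)) by (lia || exact hx).
  simpl pred. rewrite sum_n_Reals.
  rewrite (sum_eq g (fun _ => 0)).
  - rewrite sum_cte, (Series_ext _ _ hg). ring.
  - intros k hk. unfold g. destruct (Nat.leb_spec k N); [|lia].
    rewrite norm_zero. ring. }
apply (is_lim_seq_ext _ _ _ (fun N => eq_sym (E N))).
replace (Finite 0) with (Finite (sqrt 0)) by (f_equal; apply sqrt_0).
apply (is_lim_seq_continuous sqrt).
- apply continuity_pt_sqrt; lra.
- replace (Finite 0) with (Finite (Series f - Series f)) by (f_equal; ring).
  apply is_lim_seq_minus'; [apply is_lim_seq_const|].
  apply (Series_correct f hx).
Qed.

Lemma le_lim_zero (a K : R) (u : nat -> R) :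
  0 <= a -> (forall N, a <= K * u N) -> is_lim_seq u 0 -> a = 0.
Proof.
intros ha h hu.
assert (L : is_lim_seq (fun N => K * u N) (K * 0)) by (apply (is_lim_seq_scal_l _ K 0 hu)).
pose proof (is_lim_seq_le _ _ _ _ h (is_lim_seq_const a) L) as E. simpl in E. lra.
Qed.

Definition unit_mat (m n i j : nat) : C :=
  if andb (Nat.eqb i m) (Nat.eqb j n) then RtoC 1 else RtoC 0.

Lemma unit_mat_rapid (m n : nat) : rapid (unit_mat m n).
Proof.
(* With rate 1/2, this constant makes the bound equal to 1 exactly at the only nonzero entry. *)
exists (2 ^ m * 2 ^ n), (/ 2). split; [lra|]. intros i j. unfold unit_mat.
assert (E : forall k, 0 < 2 ^ k /\ 0 < (/ 2) ^ k) by (intros; split; apply pow_lt; lra).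
destruct (Nat.eqb_spec i m), (Nat.eqb_spec j n); simpl; subst;
  rewrite ?Cmod_0, ?Cmod_1; try (repeat apply Rmult_le_pos; apply Rlt_le, E).
assert (P : forall k, 2 ^ k * (/ 2) ^ k = 1).
{ intros k. rewrite <- Rpow_mult_distr, Rinv_r, pow1; lra. }
replace (2 ^ m * 2 ^ n * ((/ 2) ^ m * (/ 2) ^ n)) with
  ((2 ^ m * (/ 2) ^ m) * (2 ^ n * (/ 2) ^ n)) by ring.
rewrite !P. lra.
Qed.

Lemma col_linear (x : fock) (n : nat) :
  is_linear (V := fock_NormedModule) (fun u : fock => scal (u n : C_Ring) x : fock).
Proof.
split.
- intros u v. apply (scal_distr_r (V := fock_ModuleSpace) (u n) (v n) x).
- intros k u. symmetry. apply (scal_assoc (V := fock_ModuleSpace) k (u n) x).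
- exists (l2norm (V := C_NormedModule) x + 1).
  pose proof (l2norm_pos (V := C_NormedModule) x). split; [lra|]. intros u.
  change (l2norm (V := C_NormedModule) (fun m => scal (u n : C_Ring) (x m : C_NormedModule))
    <= (l2norm (V := C_NormedModule) x + 1) * l2norm (V := C_NormedModule) u).
  eapply Rle_trans; [apply (l2norm_scal (V := C_NormedModule)), coord_sqsum|].
  pose proof (coord_le u n). pose proof (l2norm_pos (V := C_NormedModule) u).
  pose proof (Cmod_ge_0 (u n)). nra.
Qed.

(** The rank-one operator |x><e_n|, whose Hilbert-Schmidt norm is the norm of [x]. *)
Definition col_bop (x : fock) (n : nat) : bop := mk_bop _ (col_linear x n).

Lemma col_bop_e (x : fock) (n k : nat) :
  col_bop x n (e_ k) = if Nat.eqb k n then x else zero.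
Proof.
apply fock_eq. intros m.
change (Cmult (delta k n) (x m) = coord (if Nat.eqb k n then x else zero) m).
unfold delta. destruct (Nat.eqb_spec k n), (Nat.eqb_spec n k); try congruence; try ring.
apply Cmult_0_l.
Qed.

Lemma col_bop_norm (x : fock) (n : nat) :
  sqsum (V := fock_NormedModule) (fun k => col_bop x n (e_ k)) /\
  l2norm (V := fock_NormedModule) (fun k => col_bop x n (e_ k))
    = l2norm (V := C_NormedModule) x.
Proof.
set (f := fun k => norm (col_bop x n (e_ k) : fock_NormedModule) ^ 2).
assert (S0 : is_series f (f n)).
{ apply (csum_single (fun k => RtoC (f k)) n).
  intros k hk. unfold f. rewrite col_bop_e.
  destruct (Nat.eqb_spec k n); [contradiction|].
  change (RtoC (norm (zero : fock_NormedModule) ^ 2) = RtoC 0).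
  rewrite norm_zero. f_equal. ring. }
split; [exists (f n); exact S0|].
unfold l2norm at 1. fold f. rewrite (is_series_unique _ _ S0).
unfold f. rewrite col_bop_e, Nat.eqb_refl. apply sqrt_pow2, (norm_ge_0 (x : fock_NormedModule)).
Qed.

Definition col_op (x : fock) (n : nat) : hs := mk_hs _ (proj1 (col_bop_norm x n)).

Lemma e_norm (n : nat) : l2norm (V := C_NormedModule) (e_ n) = 1.
Proof.
set (f := fun k => norm (e_ n k : C_NormedModule) ^ 2).
assert (E : f n = 1).
{ unfold f. change (Cmod (delta n n) ^ 2 = 1). unfold delta. rewrite Nat.eqb_refl, Cmod_1. ring. }
assert (S0 : is_series f (f n)).
{ apply (csum_single (fun k => RtoC (f k)) n).
  intros k hk. unfold f. change (RtoC (Cmod (delta n k) ^ 2) = RtoC 0).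
  unfold delta. destruct (Nat.eqb_spec k n); [contradiction|]. rewrite Cmod_0. f_equal. ring. }
unfold l2norm. fold f. rewrite (is_series_unique _ _ S0), E. apply sqrt_1.
Qed.

Lemma unit_mat_op (m n : nat) : mat_op (unit_mat m n) = col_op (e_ m) n.
Proof.
apply hs_ext. intros i j. rewrite (mat_op_entry _ _ _ (unit_mat_rapid m n)).
change (unit_mat m n i j = coord (col_bop (e_ m) n (e_ j)) i).
rewrite col_bop_e. unfold unit_mat.
destruct (Nat.eqb j n); simpl; unfold delta; destruct (Nat.eqb i m); reflexivity.
Qed.

(** The map x -> |x><e_n| is linear and isometric, so truncations of [x] approximate the operator in
    Hilbert-Schmidt norm. *)
Lemma functional_col (F : hs -> C) (n : nat) : functional F ->
  (forall m, F (col_op (e_ m) n) = RtoC 0) -> forall x, F (col_op x n) = RtoC 0.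
Proof.
intros hF h x. destruct (fun_bd _ hF) as [K [hK hb]].
assert (hp : forall u v, col_op (plus u v) n = plus (col_op u n) (col_op v n)).
{ intros u v. apply hs_eq, bop_eq. intros w.
  apply (scal_distr_l (V := fock_ModuleSpace) (w n) u v). }
assert (hsc : forall (k : C) u, col_op (scal k u) n = scal k (col_op u n)).
{ intros k u. apply hs_eq, bop_eq. intros w. apply fock_eq. intros m.
  change (w n * (k * u m) = k * (w n * u m))%C. ring. }
assert (ht : forall N, F (col_op (fock_trunc x N) n) = RtoC 0).
{ intros N. unfold fock_trunc. induction N as [|N IH].
  - rewrite sum_O, hsc, (fun_scal _ hF), h. ring.
  - rewrite sum_Sn, hp, (fun_plus _ hF), IH, hsc, (fun_scal _ hF), h. ring. }
apply Cmod_eq_0.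
apply (le_lim_zero _ K
  (fun N => l2norm (V := C_NormedModule) (fun m => if Nat.leb m N then zero else x m)));
  [apply Cmod_ge_0| |apply (l2norm_tail_lim (V := C_NormedModule)), coord_sqsum].
intros N. replace (F (col_op x n)) with (F (minus (col_op x n) (col_op (fock_trunc x N) n)))
  by (rewrite (functional_minus _ _ _ hF), ht; ring).
eapply Rle_trans; [apply hb|]. apply Rmult_le_compat_l; [assumption|]. right.
replace (minus (col_op x n) (col_op (fock_trunc x N) n))
  with (col_op (minus x (fock_trunc x N)) n).
2:{ unfold minus. rewrite hp. f_equal.
    change (opp (fock_trunc x N)) with (scal (Copp 1 : C_Ring) (fock_trunc x N)).
    apply hsc. }
change (l2norm (V := fock_NormedModule) (fun k => col_bop (minus x (fock_trunc x N)) n (e_ k))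
  = l2norm (V := C_NormedModule) (fun m => if Nat.leb m N then zero else x m)).
rewrite (proj2 (col_bop_norm _ n)). apply l2norm_ext. intros m.
change (x m + Copp 1 * fock_trunc x N m = if Nat.leb m N then RtoC 0 else x m)%C.
rewrite fock_trunc_coord. destruct (Nat.leb m N); ring.
Qed.

(** The second of two approximations: columns are reached from finite vectors by [functional_col],
    and [U] is the limit of its first columns, the error being the square-summable tail of the
    column norms. *)
Lemma functional_units (F : hs -> C) : functional F ->
  (forall m n, F (mat_op (unit_mat m n)) = RtoC 0) -> forall U, F U = RtoC 0.
Proof.
intros hF h U. destruct (fun_bd _ hF) as [K [hK hb]].
assert (hc : forall x n, F (col_op x n) = RtoC 0).
{ intros x n. apply functional_col; [exact hF|]. intros m. rewrite <- unit_mat_op. apply h. }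
set (UN := fix UN N := match N with
  | O => col_op (U (e_ 0)) 0
  | S M => plus (UN M) (col_op (U (e_ (S M))) (S M)) end).
assert (hUN : forall N, F (UN N) = RtoC 0).
{ induction N as [|N IH]; [apply hc|]. simpl.
  rewrite (fun_plus _ hF), IH, hc. ring. }
assert (eUN : forall N n, UN N (e_ n) = if Nat.leb n N then U (e_ n) else zero).
{ induction N as [|N IH]; intros n.
  - simpl. change (col_bop (U (e_ 0)) 0 (e_ n) = if Nat.leb n 0 then U (e_ n) else zero).
    rewrite col_bop_e. destruct n; reflexivity.
  - change (plus (UN N (e_ n)) (col_bop (U (e_ (S N))) (S N) (e_ n))
      = if Nat.leb n (S N) then U (e_ n) else zero).
    rewrite IH, col_bop_e.
    destruct (Nat.leb_spec n N), (Nat.eqb_spec n (S N)), (Nat.leb_spec n (S N)); try lia.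
    + apply plus_zero_r.
    + subst n. apply plus_zero_l.
    + apply plus_zero_l. }
apply Cmod_eq_0.
apply (le_lim_zero _ K
  (fun N => l2norm (V := fock_NormedModule) (fun n => if Nat.leb n N then zero else U (e_ n))));
  [apply Cmod_ge_0| |apply (l2norm_tail_lim (V := fock_NormedModule)), hs_sqsum].
intros N. replace (F U) with (F (minus U (UN N)))
  by (rewrite (functional_minus _ _ _ hF), hUN; ring).
eapply Rle_trans; [apply hb|]. apply Rmult_le_compat_l; [assumption|]. right.
apply (l2norm_ext (V := fock_NormedModule)). intros n.
change (minus (U (e_ n)) (UN N (e_ n)) = if Nat.leb n N then zero else U (e_ n)).
rewrite eUN. destruct (Nat.leb n N).
- apply minus_eq_zero.
- apply (minus_zero_r (G := fock_AbelianGroup)).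
Qed.

(** * Powers of the field operator *)

Definition field_pow (k : nat) (z : C) (m n : nat) : C := Nat.iter k (weyl_field z) (delta n) m.

Lemma field_pow_S (k : nat) (z : C) (m n : nat) :
  field_pow (S k) z m n = weyl_field z (fun i => field_pow k z i n) m.
Proof. reflexivity. Qed.

(** Removes the case distinction in [cre]: at m = 0 the factor sqrt 0 annihilates the spurious value
    at [pred 0]. *)
Lemma weyl_field_eq (z : C) (x : nat -> C) (m : nat) :
  weyl_field z x m =
  Cminus (Cmult z (RtoC (sqrt (INR m)) * x (pred m))%C)
         (Cmult (Cconj z) (RtoC (sqrt (INR (S m))) * x (S m))%C).
Proof.
unfold weyl_field, ann. f_equal. destruct m as [|m]; [|reflexivity].
simpl. rewrite sqrt_0. ring.
Qed.

Lemma field_pow_support (k : nat) (z : C) (m n : nat) :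
  (n + k < m \/ m + k < n)%nat -> field_pow k z m n = RtoC 0.
Proof.
revert m. induction k as [|k IH]; intros m h.
- unfold field_pow. simpl. unfold delta. destruct (Nat.eqb_spec m n); [lia|reflexivity].
- rewrite field_pow_S, weyl_field_eq, (IH (S m)) by lia.
  destruct m as [|m].
  + simpl. rewrite sqrt_0. ring.
  + simpl pred. rewrite IH by lia. ring.
Qed.

(** Starting from e_n, after k applications the level is at most n + k, so the next ladder
    coefficients are at most sqrt(n + k + 1). Their product is the square root of the factorial
    ratio; the 2 counts the raising and the lowering term. *)
Lemma field_pow_bound (k : nat) (z : C) (m n : nat) :
  Cmod (field_pow k z m n) <= (2 * Cmod z) ^ k * sqrt (INR (fact (n + k)) / INR (fact n)).
Proof.
revert m. induction k as [|k IH]; intros m.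
- rewrite Nat.add_0_r. unfold Rdiv. rewrite Rinv_r by (apply not_eq_sym, Rlt_not_eq, INR_fact_pos).
  rewrite sqrt_1. unfold field_pow. simpl. unfold delta. destruct (Nat.eqb m n);
  rewrite ?Cmod_0, ?Cmod_1; lra.
- set (B := (2 * Cmod z) ^ k * sqrt (INR (fact (n + k)) / INR (fact n))) in *.
  pose proof (Cmod_ge_0 z).
  assert (hB : 0 <= B).
  { apply Rmult_le_pos; [apply pow_le; lra|apply sqrt_pos]. }
  (* Either the ladder coefficient is within the bound, or the entry that it multiplies lies outside
     the band and vanishes. *)
  assert (T : forall j i, (n + k < i \/ j <= S (n + k))%nat ->
    Cmod (RtoC (sqrt (INR j)) * field_pow k z i n) <= sqrt (INR (S (n + k))) * B).
  { intros j i h. rewrite Cmod_mult, Cmod_R, (Rabs_pos_eq _ (sqrt_pos _)).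
    destruct (le_lt_dec j (S (n + k))) as [h'|h'].
    - apply Rmult_le_compat; [apply sqrt_pos|apply Cmod_ge_0| |apply IH].
      apply sqrt_le_1_alt, le_INR, h'.
    - rewrite field_pow_support by lia. rewrite Cmod_0, Rmult_0_r.
      apply Rmult_le_pos; [apply sqrt_pos|assumption]. }
  rewrite field_pow_S, weyl_field_eq.
  eapply Rle_trans; [apply Cmod_triangle|].
  rewrite Cmod_opp, (Cmod_mult z), (Cmod_mult (Cconj z)), Cmod_conj.
  replace ((2 * Cmod z) ^ S k * sqrt (INR (fact (n + S k)) / INR (fact n)))
    with (Cmod z * (sqrt (INR (S (n + k))) * B) + Cmod z * (sqrt (INR (S (n + k))) * B)).
  + apply Rplus_le_compat; apply Rmult_le_compat_l; try assumption; apply T; [|lia].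
    destruct m; simpl; lia.
  + unfold B. replace (n + S k)%nat with (S (n + k)) by lia. rewrite fact_S.
    replace (INR (S (n + k)) * INR (fact (n + k)) / INR (fact n)) with
      (INR (S (n + k)) * (INR (fact (n + k)) / INR (fact n))) by (unfold Rdiv; ring).
    rewrite sqrt_mult; [simpl; ring|apply pos_INR|].
    apply Rlt_le, Rdiv_lt_0_compat; apply INR_fact_pos.
Qed.

Lemma weyl_field_plus (z : C) (x y : nat -> C) (m : nat) :
  weyl_field z (fun i => Cplus (x i) (y i)) m = Cplus (weyl_field z x m) (weyl_field z y m).
Proof. rewrite !weyl_field_eq. ring. Qed.

Lemma weyl_field_scal (z k : C) (x : nat -> C) (m : nat) :
  weyl_field z (fun i => Cmult k (x i)) m = Cmult k (weyl_field z x m).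
Proof. rewrite !weyl_field_eq. ring. Qed.

Lemma weyl_field_ext (z : C) (x y : nat -> C) (m : nat) :
  (forall i, x i = y i) -> weyl_field z x m = weyl_field z y m.
Proof. intros h. rewrite !weyl_field_eq, !h. reflexivity. Qed.

Lemma field_pow_real_scal (k : nat) (r : R) (z : C) (m n : nat) :
  field_pow k (RtoC r * z) m n = Cmult (RtoC (r ^ k)) (field_pow k z m n).
Proof.
revert m. induction k as [|k IH]; intros m.
- unfold field_pow. simpl. ring.
- rewrite !field_pow_S, !weyl_field_eq, !IH, Cmult_conj. simpl (r ^ S k).
  replace (Cconj r) with (RtoC r) by (apply C_ext; simpl; ring).
  rewrite RtoC_mult. ring.
Qed.

(** * Thermal weights *)

(** The weights provide a decay e^(-beta/4) per index, which is the square of this base. One factor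
    of the base pays for the factorial growth of the entries, the other remains as the rate in
    [bounded_by]. *)
Definition thermal_base (beta : R) : R := exp (- (beta / 8)).

Lemma exp_pow (a : R) (n : nat) : exp a ^ n = exp (INR n * a).
Proof.
induction n as [|n IH]; [simpl; rewrite Rmult_0_l, exp_0; reflexivity|].
rewrite S_INR. simpl. rewrite IH, <- exp_plus. f_equal. ring.
Qed.

Lemma exp_mono (a b : R) : a <= b -> exp a <= exp b.
Proof. intros [h| ->]; [apply Rlt_le, exp_increasing, h|lra]. Qed.

Lemma thermal_base_bounds (beta : R) : 0 < beta -> 0 < thermal_base beta < 1.
Proof.
intros h. split; [apply exp_pos|]. rewrite <- exp_0. apply exp_increasing. lra.
Qed.

Lemma thermal_weight_eq (beta r : R) (n : nat) : 0 < beta ->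
  thermal_weight beta r n = Rpower (1 - exp (- beta)) r * exp (- (beta * r * INR n)).
Proof.
intros h. unfold thermal_weight, Rpower.
assert (exp (- beta) < 1) by (rewrite <- exp_0; apply exp_increasing; lra).
rewrite ln_mult by (try apply exp_pos; lra). rewrite ln_exp, <- exp_plus. f_equal. ring.
Qed.

Lemma Rpower_le_1 (a r : R) : 0 < a <= 1 -> 0 <= r -> 0 < Rpower a r <= 1.
Proof.
intros ha hr. unfold Rpower. split; [apply exp_pos|]. rewrite <- exp_0. apply exp_mono.
assert (ln a <= 0).
{ rewrite <- ln_1. destruct (Rle_lt_or_eq_dec a 1 (proj2 ha)) as [h|h].
  - apply Rlt_le, ln_increasing; lra.
  - rewrite h; lra. }
nra.
Qed.

Lemma thermal_const (beta r : R) : 0 < beta -> 0 <= r ->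
  0 < Rpower (1 - exp (- beta)) r <= 1.
Proof.
intros h hr. apply Rpower_le_1; [|assumption].
assert (exp (- beta) < 1) by (rewrite <- exp_0; apply exp_increasing; lra).
pose proof (exp_pos (- beta)). lra.
Qed.

Lemma thermal_weight_le (beta r : R) (n : nat) : 0 < beta -> 0 <= r ->
  0 < thermal_weight beta r n <= exp (- (beta * r * INR n)).
Proof.
intros h hr. rewrite thermal_weight_eq by assumption.
pose proof (thermal_const beta r h hr). pose proof (exp_pos (- (beta * r * INR n))).
split; [apply Rmult_lt_0_compat; lra|]. nra.
Qed.

Lemma thermal_bounded (beta r : R) : 0 < beta -> 0 <= r -> bounded_seq (thermal_weight beta r).
Proof.
intros h hr. exists 1. intros n.
pose proof (thermal_weight_le beta r n h hr) as [h1 h2].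
rewrite Rabs_pos_eq by lra. eapply Rle_trans; [exact h2|].
rewrite <- exp_0. apply exp_mono. pose proof (pos_INR n).
assert (0 <= beta * r * INR n) by (repeat apply Rmult_le_pos; lra). lra.
Qed.

Lemma thermal_pow_act (beta r : R) (x : fock) (n : nat) : 0 < beta -> 0 <= r ->
  thermal_pow beta r x n = Cmult (RtoC (thermal_weight beta r n)) (x n).
Proof.
intros h hr. unfold thermal_pow, diag_op.
destruct (excluded_middle_informative _) as [H|H]; [reflexivity|].
exfalso; apply H, thermal_bounded; assumption.
Qed.

(** Since rho is diagonal in the number basis, embedding an operator multiplies its matrix entrywise
    by this weight. *)
Definition wt (beta s : R) (m n : nat) : R :=
  thermal_weight beta (s / 2) m * thermal_weight beta ((1 - s) / 2) n.

Lemma wt_pos (beta s : R) (m n : nat) : 0 < beta -> 0 <= s <= 1 -> 0 < wt beta s m n.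
Proof.
intros h hs. apply Rmult_lt_0_compat; apply thermal_weight_le; lra.
Qed.

(* The weight of an entry at distance [k] from the diagonal is spread evenly over both
   indices, uniformly in [s]; the loss [e^(beta k / 4)] is later absorbed by [k!]. *)
Lemma wt_bound (beta s : R) (m n k : nat) : 0 < beta -> 0 <= s <= 1 ->
  (m <= n + k)%nat -> (n <= m + k)%nat ->
  wt beta s m n <= (/ thermal_base beta) ^ (2 * k) * (thermal_base beta ^ (2 * m) * thermal_base beta ^ (2 * n)).
Proof.
intros h hs h1 h2. unfold wt.
pose proof (thermal_weight_le beta (s / 2) m h ltac:(lra)) as [a1 a2].
pose proof (thermal_weight_le beta ((1 - s) / 2) n h ltac:(lra)) as [b1 b2].
eapply Rle_trans; [apply Rmult_le_compat; [lra|lra|exact a2|exact b2]|].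
unfold thermal_base. rewrite <- exp_Ropp, !exp_pow, <- !exp_plus. apply exp_mono.
rewrite !mult_INR. simpl (INR 2).
apply le_INR in h1. apply le_INR in h2. rewrite plus_INR in h1, h2.
set (M := INR m) in *. set (N := INR n) in *. set (K := INR k) in *.
(* The difference of the two exponents multiplied by 4. Here |2s - 1| <= 1 and |M - N| <= K. *)
enough (0 <= beta * (K + (2 * s - 1) * (M - N))) by lra.
apply Rmult_le_pos; [lra|].
assert (Rabs ((2 * s - 1) * (M - N)) <= 1 * K).
{ rewrite Rabs_mult. apply Rmult_le_compat; try apply Rabs_pos; apply Rabs_le; lra. }
pose proof (Rabs_def2 ((2 * s - 1) * (M - N)) (K + 1)).
assert (- Rabs ((2 * s - 1) * (M - N)) <= (2 * s - 1) * (M - N)).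
{ pose proof (Rle_abs (- ((2 * s - 1) * (M - N)))). rewrite Rabs_Ropp in *. lra. }
lra.
Qed.

(** Square root of the binomial bound at p = 1 - y^2. For any y < 1 the growth in n costs only
    y^(-n), and the growth in k is sqrt(k!) up to an exponential. *)
Lemma sqrt_fact_ratio (y : R) (n k : nat) : 0 < y < 1 ->
  sqrt (INR (fact (n + k)) / INR (fact n))
    <= sqrt (INR (fact k)) * (/ sqrt (1 - y ^ 2)) ^ k * (/ y) ^ n.
Proof.
intros hy.
assert (hp : 0 < 1 - y ^ 2 < 1) by nra.
pose proof (fact_add_bound (1 - y ^ 2) n k ltac:(lra)) as H.
replace (1 - (1 - y ^ 2)) with (y ^ 2) in H by ring.
pose proof (INR_fact_pos n). pose proof (INR_fact_pos k).
pose proof (sqrt_lt_R0 _ (proj1 hp)) as hr.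
assert (0 < / y) by (apply Rinv_0_lt_compat; lra).
assert (0 < / sqrt (1 - y ^ 2)) by (apply Rinv_0_lt_compat; lra).
assert (0 < (/ y) ^ n) by (apply pow_lt; lra).
assert (0 < (/ sqrt (1 - y ^ 2)) ^ k) by (apply pow_lt; lra).
rewrite <- (sqrt_pow2 (sqrt (INR (fact k)) * (/ sqrt (1 - y ^ 2)) ^ k * (/ y) ^ n)).
2:{ repeat apply Rmult_le_pos; try lra. apply sqrt_pos. }
apply sqrt_le_1_alt.
rewrite !Rpow_mult_distr, pow2_sqrt by lra.
rewrite <- !pow_mult, !(Nat.mul_comm _ 2), !pow_mult.
rewrite pow_inv, pow2_sqrt by lra.
assert (0 < (1 - y ^ 2) ^ k) by (apply pow_lt; lra).
assert (0 < (y ^ 2) ^ n) by (apply pow_lt; nra).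
apply (Rmult_le_reg_r (INR (fact n) * ((1 - y ^ 2) ^ k * (y ^ 2) ^ n))).
{ repeat apply Rmult_lt_0_compat; assumption. }
replace (INR (fact (n + k)) / INR (fact n) * (INR (fact n) * ((1 - y ^ 2) ^ k * (y ^ 2) ^ n)))
  with (INR (fact (n + k)) * ((1 - y ^ 2) ^ k * (y ^ 2) ^ n)) by (field; lra).
eapply Rle_trans; [exact H|]. right.
rewrite !pow_inv. field. repeat split; lra.
Qed.

(** A majorant of D^k / sqrt(k!) free of square roots: writing that term as 2^(-k) a with a = (2D)^k
    / sqrt(k!), the inequality a <= 1 + a^2 splits it into a geometric and an exponential series. *)
Definition growth (D : R) (k : nat) : R := (/ 2) ^ k + (2 * D ^ 2) ^ k / INR (fact k).

Lemma growth_ex_series (D : R) : ex_series (growth D).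
Proof.
apply (ex_series_plus (V := R_NormedModule)).
- exists (/ (1 - / 2)). apply is_series_geom. rewrite Rabs_pos_eq; lra.
- exists (exp (2 * D ^ 2)). pose proof (is_exp_Reals (2 * D ^ 2)) as H.
  apply is_pseries_R in H. revert H. apply is_series_ext. intros n. apply Rmult_comm.
Qed.

Lemma growth_bound (D : R) (k : nat) : 0 <= D -> D ^ k / sqrt (INR (fact k)) <= growth D k.
Proof.
intros hD. unfold growth. pose proof (INR_fact_pos k). pose proof (sqrt_lt_R0 _ H).
set (f := sqrt (INR (fact k))) in *.
replace (INR (fact k)) with (f ^ 2) by (unfold f; apply pow2_sqrt; lra).
set (a := 2 ^ k * D ^ k / f).
assert (0 < (/ 2) ^ k) by (apply pow_lt; lra).
assert (E2 : (/ 2) ^ k * 2 ^ k = 1) by (rewrite <- Rpow_mult_distr, Rinv_l, pow1; lra).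
replace (D ^ k / f) with ((/ 2) ^ k * a).
2:{ unfold a. replace (D ^ k / f) with (1 * D ^ k / f) by (field; lra). rewrite <- E2. field; lra. }
replace ((2 * D ^ 2) ^ k / f ^ 2) with ((/ 2) ^ k * a ^ 2).
2:{ unfold a. rewrite Rpow_mult_distr, <- pow_mult, Nat.mul_comm, pow_mult.
    replace (2 ^ k * (D ^ k) ^ 2 / f ^ 2) with ((1 * 2 ^ k) * (D ^ k) ^ 2 / f ^ 2) by (field; lra).
    rewrite <- E2. field; lra. }
pose proof (pow2_ge_0 (a - 1)). nra.
Qed.

Definition wpw (beta s : R) (k : nat) (z : C) (m n : nat) : C :=
  Cmult (RtoC (wt beta s m n)) (Cmult (RtoC (/ INR (fact k))) (field_pow k z m n)).

(** Collects what is exponential in k: 2|z| from [field_pow_bound], the inverse square of the base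
    from [wt_bound], and the last factor from [sqrt_fact_ratio] at the thermal base. *)
Definition growth_rate (beta : R) (z : C) : R :=
  2 * Cmod z * (/ thermal_base beta) ^ 2 * / sqrt (1 - thermal_base beta ^ 2).

(** The factor 1/k! of the exponential series against the growth sqrt(k!) of the entries leaves D^k
    / sqrt(k!). The rate does not depend on k, z or s, as [functional_csum] demands for the series
    over k. *)
Lemma wpw_bound (beta s : R) (k : nat) (z : C) : 0 < beta -> 0 <= s <= 1 ->
  bounded_by (wpw beta s k z) (growth (growth_rate beta z) k) (thermal_base beta).
Proof.
intros h hs. pose proof (thermal_base_bounds beta h) as hy. split; [exact hy|]. intros m n.
set (y := thermal_base beta) in *.
assert (hr : 0 < sqrt (1 - y ^ 2)) by (apply sqrt_lt_R0; nra).
assert (hi : 0 < / y) by (apply Rinv_0_lt_compat; lra).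
assert (hri : 0 < / sqrt (1 - y ^ 2)) by (apply Rinv_0_lt_compat; lra).
pose proof (Cmod_ge_0 z).
assert (hD : 0 <= growth_rate beta z).
{ unfold growth_rate. fold y. repeat apply Rmult_le_pos; try lra. }
pose proof (INR_fact_pos k) as hk. pose proof (sqrt_lt_R0 _ hk) as hsk.
assert (ym : 0 < y ^ m) by (apply pow_lt; lra).
assert (yn : 0 < y ^ n) by (apply pow_lt; lra).
assert (hg : 0 <= growth (growth_rate beta z) k).
{ eapply Rle_trans; [|apply growth_bound, hD].
  apply Rmult_le_pos; [apply pow_le, hD|apply Rlt_le, Rinv_0_lt_compat; lra]. }
destruct (le_lt_dec m (n + k)) as [h1|h1]; [destruct (le_lt_dec n (m + k)) as [h2|h2]|].
2,3: unfold wpw; rewrite field_pow_support, !Cmult_0_r, Cmod_0 by lia;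
     repeat apply Rmult_le_pos; lra.
unfold wpw. rewrite !Cmod_mult, !Cmod_R.
rewrite (Rabs_pos_eq (wt _ _ _ _)) by (apply Rlt_le, wt_pos; assumption).
rewrite Rabs_pos_eq by (apply Rlt_le, Rinv_0_lt_compat; assumption).
pose proof (wt_bound beta s m n k h hs h1 h2) as hw. fold y in hw.
pose proof (field_pow_bound k z m n) as hp.
pose proof (sqrt_fact_ratio y n k hy) as hf.
apply Rle_trans with (((/ y) ^ (2 * k) * (y ^ (2 * m) * y ^ (2 * n))) *
  (/ INR (fact k) * ((2 * Cmod z) ^ k * (sqrt (INR (fact k)) * (/ sqrt (1 - y ^ 2)) ^ k * (/ y) ^ n)))).
- apply Rmult_le_compat; [apply Rlt_le, wt_pos; assumption| |exact hw|].
  + apply Rmult_le_pos; [apply Rlt_le, Rinv_0_lt_compat; assumption|apply Cmod_ge_0].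
  + apply Rmult_le_compat_l; [apply Rlt_le, Rinv_0_lt_compat; assumption|].
    eapply Rle_trans; [exact hp|]. apply Rmult_le_compat_l; [apply pow_le; lra|exact hf].
- apply Rle_trans with ((growth_rate beta z) ^ k / sqrt (INR (fact k)) * (y ^ (2 * m) * y ^ n)).
  + right. unfold growth_rate. fold y. rewrite !Rpow_mult_distr.
    rewrite <- (sqrt_sqrt (INR (fact k))) at 1 by lra.
    replace (((/ y) ^ 2) ^ k) with ((/ y) ^ (2 * k)) by (rewrite pow_mult; reflexivity).
    replace (y ^ (2 * n)) with (y ^ n * y ^ n) by (rewrite <- pow_add; f_equal; lia).
    assert (E : y ^ n * (/ y) ^ n = 1) by (rewrite <- Rpow_mult_distr, Rinv_r, pow1; lra).
    set (A := (/ y) ^ (2 * k)). set (B := (/ sqrt (1 - y ^ 2)) ^ k).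
    set (f := sqrt (INR (fact k))) in *.
    transitivity (A * y ^ (2 * m) * y ^ n * (y ^ n * (/ y) ^ n) * (/ f * (2 ^ k * Cmod z ^ k * B))).
    * field. lra.
    * rewrite E. field. lra.
  + apply Rmult_le_compat; [| |apply growth_bound, hD|].
    * apply Rmult_le_pos; [apply pow_le, hD|apply Rlt_le, Rinv_0_lt_compat; lra].
    * apply Rmult_le_pos; [apply pow_le; lra|lra].
    * apply Rmult_le_compat_r; [lra|].
      replace (2 * m)%nat with (m + m)%nat by lia. rewrite pow_add.
      pose proof (pow_le_1 y m ltac:(lra)). nra.
Qed.

(** * Expansion of embedded Weyl operators *)

Lemma weyl_entry (z : C) (W : bop) (m n : nat) : is_weyl z W ->
  csum (fun k => Cmult (RtoC (/ INR (fact k))) (field_pow k z m n)) (entry W m n).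
Proof.
intros h. specialize (h (e_ n) (delta_finite n)).
set (a := fun i k => Cmult (RtoC (/ INR (fact k))) (field_pow k z i n)).
apply csum_partial_lim.
apply (is_lim_seq_le_le (fun _ => 0) _
  (fun K => l2norm (V := C_NormedModule) (fun i => Cminus (sum_n (a i) K) (W (e_ n) i))));
  [|apply is_lim_seq_const|exact h].
intros N. split; [apply Cmod_ge_0|].
rewrite <- cpartial_sum_n.
apply (norm_term_le_l2norm (V := C_NormedModule)
  (fun i => Cminus (sum_n (a i) N) (W (e_ n) i)) m).
(* [l2norm] dominates the coordinates only of square-summable sequences; partial sums applied to e_n
   are finite-particle vectors. *)
assert (E : sqsum (V := C_NormedModule) (fun i => sum_n (a i) N)).
{ apply finite_particle_sqsum. exists (S (n + N)). intros i hi.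
  rewrite cpartial_sum_n.
  assert (Z : forall M, (M <= S N)%nat -> cpartial (a i) M = RtoC 0).
  { induction M as [|M IH]; intros hM; [reflexivity|].
    simpl. rewrite IH by lia. unfold a. rewrite field_pow_support by lia. ring. }
  apply Z; lia. }
pose proof (sqsum_plus (V := C_NormedModule) _ _ E
  (sqsum_scal (V := C_NormedModule) (Copp 1) _ (coord_sqsum (W (e_ n))))) as H.
unfold sqsum in *. revert H.
apply (ex_series_ext (V := R_NormedModule)). intros i.
replace (Cminus (sum_n (a i) N) (W (e_ n) i))
  with (plus (sum_n (a i) N) (scal (Copp 1 : C_Ring) (W (e_ n) i : C_NormedModule)) : C);
  [reflexivity|].
change (sum_n (a i) N + Copp 1 * W (e_ n) i = sum_n (a i) N - W (e_ n) i)%C. ring.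
Qed.

Lemma bop_scal_arg (X : bop) (k : C) (x : fock) : X (fock_scal k x) = fock_scal k (X x).
Proof. apply (linear_scal X (bop_linear X) k x). Qed.

Lemma thermal_pow_e (beta r : R) (n : nat) : 0 < beta -> 0 <= r ->
  thermal_pow beta r (e_ n) = fock_scal (RtoC (thermal_weight beta r n)) (e_ n).
Proof.
intros h hr. apply fock_eq. intros m. rewrite thermal_pow_act by assumption.
change (thermal_weight beta r m * delta n m = thermal_weight beta r n * delta n m)%C.
unfold delta. destruct (Nat.eqb_spec m n); [subst; reflexivity|ring].
Qed.

Lemma embed_entry (beta s : R) (X : bop) (m n : nat) : 0 < beta -> 0 <= s <= 1 ->
  entry (embed_bop beta s X) m n = Cmult (RtoC (wt beta s m n)) (entry X m n).
Proof.
intros h hs. unfold entry, embed_bop.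
change (thermal_pow beta (s / 2) (X (thermal_pow beta ((1 - s) / 2) (e_ n))) m =
  wt beta s m n * X (e_ n) m)%C.
rewrite thermal_pow_act by lra. rewrite thermal_pow_e by lra. rewrite bop_scal_arg.
change (thermal_weight beta (s / 2) m * (thermal_weight beta ((1 - s) / 2) n * X (e_ n) m) =
  wt beta s m n * X (e_ n) m)%C.
unfold wt. rewrite RtoC_mult. ring.
Qed.

Lemma entry_functional (m n : nat) : functional (fun U => entry U m n).
Proof.
split; [reflexivity|reflexivity|].
exists 1. split; [lra|]. intros U. rewrite Rmult_1_l. apply entry_le.
Qed.

(** [rho^(s/2) X rho^((1-s)/2)], provided that its matrix decays geometrically. *)
Definition embed_hs (beta s : R) (X : bop) : hs :=
  mat_op (fun m n => Cmult (RtoC (wt beta s m n)) (entry X m n)).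

Lemma weyl_expansion (beta s : R) (z : C) (W : bop) (F : hs -> C) :
  0 < beta -> 0 <= s <= 1 -> is_weyl z W -> functional F ->
  rapid (fun m n => Cmult (RtoC (wt beta s m n)) (entry W m n)) /\
  csum (fun k => F (mat_op (wpw beta s k z))) (F (embed_hs beta s W)).
Proof.
intros h hs hW hF.
apply (functional_csum F _ _ (growth (growth_rate beta z)) (thermal_base beta) hF).
- intros k. apply wpw_bound; assumption.
- apply growth_ex_series.
- intros m n. unfold wpw. apply csum_scal, weyl_entry, hW.
Qed.

Lemma embed_hs_bop (beta s : R) (z : C) (W : bop) :
  0 < beta -> 0 <= s <= 1 -> is_weyl z W ->
  hs_bop (embed_hs beta s W) = embed_bop beta s W.
Proof.
intros h hs hW. apply bop_ext_entry. intros m n.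
rewrite embed_entry by assumption. unfold embed_hs. rewrite mat_op_entry; [reflexivity|].
apply (weyl_expansion beta s z W _ h hs hW (entry_functional 0 0)).
Qed.

Lemma wpw_rapid (beta s : R) (k : nat) (z : C) : 0 < beta -> 0 <= s <= 1 ->
  rapid (wpw beta s k z).
Proof. intros h hs. eexists; eexists; apply wpw_bound; assumption. Qed.

(** Homogeneity of phi(z)^k under real scaling turns the operator expansion into a scalar power
    series in [r], valid for all real [r], so that coefficients can be compared. *)
Lemma weyl_ray (beta s r : R) (z : C) (W : bop) (F : hs -> C) :
  0 < beta -> 0 <= s <= 1 -> is_weyl (RtoC r * z) W -> functional F ->
  csum (fun k => Cmult (RtoC (r ^ k)) (F (mat_op (wpw beta s k z)))) (F (embed_hs beta s W)).
Proof.
intros h hs hW hF.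
eapply csum_ext; [|apply (weyl_expansion beta s _ W F h hs hW hF)].
intros k. simpl. rewrite <- (fun_scal _ hF), <- mat_op_scal by (apply wpw_rapid; assumption).
f_equal. apply mat_op_ext. intros m n. unfold wpw. rewrite field_pow_real_scal. ring.
Qed.

(** * Coefficients of real power series *)

Lemma cv_radius_pos (a : nat -> R) (l : R) :
  is_series (fun k => 1 ^ k * a k) l -> Rbar_lt 0 (CV_radius a).
Proof.
intros h. apply (Rbar_lt_le_trans _ 1); [simpl; lra|].
apply Rbar_not_lt_le. intros H.
apply (CV_disk_outside a 1); [rewrite Rabs_R1; exact H|].
apply (is_lim_seq_ext (fun k => 1 ^ k * a k)); [intros; ring|].
apply ex_series_lim_0. exists l; exact h.
Qed.

Lemma PSeries_is_series (a : nat -> R) (r l : R) :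
  is_series (fun k => r ^ k * a k) l -> PSeries a r = l.
Proof.
intros h. unfold PSeries. rewrite <- (is_series_unique _ _ h). apply Series_ext; intros; ring.
Qed.

Lemma csum_real_powers (a : nat -> C) (r : R) (l : C) :
  csum (fun k => Cmult (RtoC (r ^ k)) (a k)) l ->
  is_series (fun k => r ^ k * Re (a k)) (Re l) /\
  is_series (fun k => r ^ k * Im (a k)) (Im l).
Proof.
intros [h1 h2]. split.
- revert h1. apply is_series_ext. intros k.
  change (r ^ k * Re (a k) - 0 * Im (a k) = r ^ k * Re (a k)). ring.
- revert h2. apply is_series_ext. intros k.
  change (r ^ k * Im (a k) + 0 * Re (a k) = r ^ k * Im (a k)). ring.
Qed.

Lemma power_coef_zero (a : nat -> R) :
  (forall r, is_series (fun k => r ^ k * a k) 0) -> forall k, a k = 0.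
Proof.
intros h k.
apply (PSeries_ext_recip a (fun _ => 0)).
- apply (cv_radius_pos a 0), h.
- rewrite CV_radius_const_0. exact I.
- exists (mkposreal 1 Rlt_0_1). intros x _. rewrite PSeries_const_0. apply PSeries_is_series, h.
Qed.

Lemma csum_power_zero (a : nat -> C) :
  (forall r : R, csum (fun k => Cmult (RtoC (r ^ k)) (a k)) (RtoC 0)) ->
  forall k, a k = RtoC 0.
Proof.
intros h k. apply C_ext.
- apply (power_coef_zero (fun k => Re (a k))). intros r. apply (csum_real_powers _ _ _ (h r)).
- apply (power_coef_zero (fun k => Im (a k))). intros r. apply (csum_real_powers _ _ _ (h r)).
Qed.

(** * Normal ordering *)

Lemma cpartial_ext (c d : nat -> C) (N : nat) :
  (forall i, (i < N)%nat -> c i = d i) -> cpartial c N = cpartial d N.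
Proof.
induction N as [|N IH]; intros h; [reflexivity|].
simpl. rewrite IH, h by (intros; try apply h; lia). reflexivity.
Qed.

Lemma cpartial_plus (c d : nat -> C) (N : nat) :
  cpartial (fun i => Cplus (c i) (d i)) N = Cplus (cpartial c N) (cpartial d N).
Proof. induction N as [|N IH]; simpl; [ring|]. rewrite IH. ring. Qed.

Lemma cpartial_scal (k : C) (c : nat -> C) (N : nat) :
  cpartial (fun i => Cmult k (c i)) N = Cmult k (cpartial c N).
Proof. induction N as [|N IH]; simpl; [ring|]. rewrite IH. ring. Qed.

Lemma cpartial_S_l (c : nat -> C) (N : nat) :
  cpartial c (S N) = Cplus (c O) (cpartial (fun i => c (S i)) N).
Proof.
induction N as [|N IH]; [simpl; ring|].
change (cpartial c (S (S N))) with (Cplus (cpartial c (S N)) (c (S N))).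
rewrite IH. simpl. ring.
Qed.

(** The matrix of [(a^dagger)^i a^j]. *)
Definition mono (i j m n : nat) : R :=
  if andb (Nat.leb i m) (Nat.eqb n (j + (m - i)))
  then sqrt (INR (fact m) * INR (fact n)) / INR (fact (m - i)) else 0.

Lemma mono_cre (i j m n : nat) :
  sqrt (INR m) * mono i j (pred m) n = mono (S i) j m n.
Proof.
destruct m as [|m].
- change (INR 0) with 0. rewrite sqrt_0, Rmult_0_l. reflexivity.
- unfold mono. simpl (pred (S m)). change (S i <=? S m)%nat with (i <=? m)%nat.
  change (S m - S i)%nat with (m - i)%nat.
  destruct (andb _ _); [|ring].
  rewrite (fact_S m), (Rmult_assoc (INR (S m))), (sqrt_mult (INR (S m))); [unfold Rdiv; ring|apply pos_INR|].
  apply Rmult_le_pos; apply pos_INR.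
Qed.

(** The relation a (a^dagger)^i = (a^dagger)^i a + i (a^dagger)^(i-1) on matrix entries. On the
    support it is the splitting m + 1 = (m + 1 - i) + i; at i = 0 the value at [pred 0] is
    multiplied by zero. *)
Lemma mono_ann (i j m n : nat) :
  sqrt (INR (S m)) * mono i j (S m) n
  = mono i (S j) m n + INR i * mono (pred i) j m n.
Proof.
assert (Q : sqrt (INR (S m)) * sqrt (INR (fact (S m)) * INR (fact n))
  = INR (S m) * sqrt (INR (fact m) * INR (fact n))).
{ rewrite <- sqrt_mult; [|apply pos_INR|apply Rmult_le_pos; apply pos_INR].
  rewrite fact_S.
  replace (INR (S m) * (INR (S m) * INR (fact m) * INR (fact n)))
    with ((INR (S m) * INR (S m)) * (INR (fact m) * INR (fact n))) by ring.
  rewrite sqrt_mult; [|apply Rmult_le_pos; apply pos_INR|apply Rmult_le_pos; apply pos_INR].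
  rewrite sqrt_square by apply pos_INR. reflexivity. }
unfold mono.
destruct (Nat.leb_spec i (S m)) as [h1|h1].
2:{ destruct (Nat.leb_spec i m); [lia|]. destruct (Nat.leb_spec (pred i) m); [lia|].
    simpl. ring. }
destruct (Nat.eqb_spec n (j + (S m - i))) as [h2|h2]; simpl andb.
- transitivity (INR (S m) * sqrt (INR (fact m) * INR (fact n)) / INR (fact (S m - i))).
  { rewrite <- Q. unfold Rdiv. ring. }
  set (q := sqrt (INR (fact m) * INR (fact n))).
  destruct (Nat.eq_dec i (S m)) as [hi|hi].
  + subst i. destruct (Nat.leb_spec (S m) m); [lia|].
    simpl (pred (S m)). rewrite Nat.leb_refl, !Nat.sub_diag, Nat.add_0_r in *.
    subst n. rewrite Nat.eqb_refl. simpl andb. cbv iota.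
    change (INR (fact 0)) with 1. clearbody q. unfold Rdiv. rewrite Rinv_1. ring.
  + destruct (Nat.leb_spec i m); [|lia].
    change (S j + (m - i))%nat with (S (j + (m - i))).
    destruct (Nat.eqb_spec n (S (j + (m - i)))); [|lia].
    set (l := (m - i)%nat) in *.
    replace (S m - i)%nat with (S l) by lia. rewrite fact_S.
    pose proof (INR_fact_pos l). assert (0 < INR (S l)) by (apply lt_0_INR; lia).
    assert (E : INR (S m) = INR (S l) + INR i) by (rewrite <- plus_INR; f_equal; lia).
    destruct i as [|i].
    * simpl andb. cbv iota. simpl (INR 0) in *. rewrite Rmult_0_l. rewrite E. field. lra.
    * simpl (pred (S i)).
      destruct (Nat.leb_spec i m); [|lia].
      replace (m - i)%nat with (S l) by lia.
      destruct (Nat.eqb_spec n (j + S l)); [|lia].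
      simpl andb. cbv iota. rewrite fact_S, E. field. lra.
- assert (Z1 : andb (i <=? m)%nat (n =? S (j + (m - i)))%nat = false).
  { destruct (Nat.leb_spec i m), (Nat.eqb_spec n (S (j + (m - i)))); try reflexivity. lia. }
  change (S j + (m - i))%nat with (S (j + (m - i))).
  rewrite Z1. destruct i as [|i]; [simpl; ring|].
  simpl (pred (S i)).
  assert (Z2 : andb (i <=? m)%nat (n =? j + (m - i))%nat = false).
  { destruct (Nat.leb_spec i m), (Nat.eqb_spec n (j + (m - i))); try reflexivity. lia. }
  rewrite Z2. ring.
Qed.

Definition divpow (z : C) (i : nat) : C := Cmult (RtoC (/ INR (fact i))) (Cpow z i).

Lemma divpow_S (z : C) (i : nat) :
  Cmult (RtoC (INR (S i))) (divpow z (S i)) = Cmult z (divpow z i).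
Proof.
unfold divpow. rewrite fact_S.
replace (/ (INR (S i) * INR (fact i))) with (/ INR (S i) * / INR (fact i)).
2:{ rewrite Rinv_mult. reflexivity. }
assert (E : Cmult (RtoC (INR (S i))) (RtoC (/ INR (S i))) = RtoC 1).
{ rewrite <- RtoC_mult, Rinv_r; [reflexivity|]. apply not_0_INR; lia. }
rewrite RtoC_mult. simpl (Cpow z (S i)).
transitivity ((RtoC (INR (S i)) * RtoC (/ INR (S i))) * (z * (/ INR (fact i))%R * Cpow z i))%C;
  [ring|]. rewrite E. ring.
Qed.

(** The normally ordered part of degree [k] of [exp (z a^dagger - conj z a)]. *)
Definition normal_pow (k : nat) (z : C) (m n : nat) : C :=
  cpartial (fun i => Cmult (Cmult (divpow z i) (divpow (Copp (Cconj z)) (k - i)))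
    (RtoC (mono i (k - i) m n))) (S k).

Lemma weyl_field_cpartial (z : C) (c : nat -> nat -> C) (N m : nat) :
  weyl_field z (fun i => cpartial (fun k => c k i) N) m
  = cpartial (fun k => weyl_field z (c k) m) N.
Proof.
induction N as [|N IH]; simpl.
- rewrite weyl_field_eq. ring.
- rewrite weyl_field_plus, IH. reflexivity.
Qed.

(* Hermite recursion, from [[a, a^dagger] = 1]. *)
Lemma normal_pow_rec (k : nat) (z : C) (m n : nat) :
  weyl_field z (fun i => normal_pow k z i n) m
  = Cplus (Cmult (RtoC (INR (S k))) (normal_pow (S k) z m n))
          (match k with O => RtoC 0
           | S k' => Copp (Cmult (Cmult z (Cconj z)) (normal_pow k' z m n)) end).
Proof.
unfold normal_pow at 1. rewrite weyl_field_cpartial.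
set (w := Copp (Cconj z)).
set (A := divpow z). set (B := divpow w).
(* [f1], after a shift of index, is the creation part; [f2] is the annihilation part moved to the
   right, and [g] is the commutator left by that move. The weights i and k + 1 - i of [f1] and [f2]
   add up to k + 1. *)
set (f1 := fun i => (INR i * A i * B (S k - i)%nat * mono i (S k - i) m n)%C).
set (f2 := fun i => (INR (S k - i) * A i * B (S k - i)%nat * mono i (S k - i) m n)%C).
set (g := fun i => (INR i * A i * B (k - i)%nat * w * mono (pred i) (k - i) m n)%C).
rewrite (cpartial_ext _ (fun i => f1 (S i) + f2 i + g i)%C).
2:{ intros i hi. rewrite weyl_field_eq. unfold f1, f2, g.
    change (S k - S i)%nat with (k - i)%nat.
    replace (S k - i)%nat with (S (k - i)) by lia.
    pose proof (divpow_S z i) as E1. pose proof (divpow_S w (k - i)) as E2.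
    fold A in E1. fold B in E2.
    rewrite <- (mono_cre i (k - i) m n), E1, RtoC_mult.
    replace (RtoC (INR (S (k - i))) * A i * B (S (k - i)) * RtoC (mono i (S (k - i)) m n))%C
      with (A i * (INR (S (k - i)) * B (S (k - i))) * mono i (S (k - i)) m n)%C by ring.
    rewrite E2.
    pose proof (f_equal RtoC (mono_ann i (k - i) m n)) as E3.
    rewrite RtoC_mult, RtoC_plus, RtoC_mult in E3.
    replace (Cconj z) with (Copp w) by (unfold w; ring).
    transitivity (z * A i * B (k - i)%nat * (sqrt (INR m) * mono i (k - i) (pred m) n)
      + w * A i * B (k - i)%nat * (sqrt (INR (S m)) * mono i (k - i) (S m) n))%C; [ring|].
    rewrite E3. ring. }
rewrite !cpartial_plus.
assert (H1 : cpartial (fun i => f1 (S i)) (S k) = cpartial f1 (S (S k))).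
{ rewrite (cpartial_S_l f1 (S k)). unfold f1 at 2. simpl (INR 0). ring. }
assert (H2 : cpartial f2 (S k) = cpartial f2 (S (S k))).
{ change (cpartial f2 (S (S k))) with (cpartial f2 (S k) + f2 (S k))%C.
  unfold f2 at 3. rewrite Nat.sub_diag. simpl (INR 0). ring. }
rewrite H1, H2, <- cpartial_plus.
f_equal.
- unfold normal_pow. fold w A B. rewrite <- cpartial_scal. apply cpartial_ext. intros i hi.
  unfold f1, f2. replace (RtoC (INR (S k))) with (Cplus (RtoC (INR i)) (RtoC (INR (S k - i)))).
  + ring.
  + rewrite <- RtoC_plus, <- plus_INR. do 2 f_equal. lia.
- rewrite cpartial_S_l. unfold g at 1. simpl (INR 0).
  destruct k as [|k].
  + simpl. ring.
  + unfold normal_pow. fold w A B. rewrite (cpartial_ext _ (fun i => (z * w) *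
      (A i * B (k - i)%nat * mono i (k - i) m n)))%C.
    * rewrite cpartial_scal. replace (Cconj z) with (Copp w) by (unfold w; ring). ring.
    * intros i hi. unfold g. change (S k - S i)%nat with (k - i)%nat.
      pose proof (divpow_S z i) as E1. fold A in E1. rewrite E1. simpl (pred (S i)). ring.
Qed.

(** * Totality of the embedded Weyl operators *)

Definition expi (t : R) : C := (cos t, sin t).

Lemma expi_plus (a b : R) : expi (a + b) = Cmult (expi a) (expi b).
Proof.
apply C_ext; simpl; [apply cos_plus|]. rewrite sin_plus. ring.
Qed.

Lemma expi_nonzero (a : R) : expi a <> RtoC 0.
Proof.
intros h. pose proof (sin2_cos2 a) as E. unfold Rsqr in E.
injection h as h1 h2. rewrite h1, h2 in E. lra.
Qed.

Lemma expi_conj (a : R) : Cmult (expi a) (Cconj (expi a)) = RtoC 1.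
Proof.
pose proof (sin2_cos2 a) as E. unfold Rsqr in E.
apply C_ext; simpl; nra.
Qed.

Lemma expi_pow (a : R) (n : nat) : Cpow (expi a) n = expi (INR n * a).
Proof.
induction n as [|n IH].
- simpl. rewrite Rmult_0_l. unfold expi. rewrite cos_0, sin_0. reflexivity.
- rewrite S_INR. simpl Cpow. rewrite IH, <- expi_plus. f_equal. ring.
Qed.

(* Subtracting the values at [t] and at a rotated point kills the constant term. *)
Lemma circle_poly (N : nat) (c : nat -> C) :
  (forall t, cpartial (fun i => Cmult (c i) (Cpow (expi t) i)) N = RtoC 0) ->
  forall i, (i < N)%nat -> c i = RtoC 0.
Proof.
revert c. induction N as [|N IH]; intros c h i hi; [lia|].
(* The angle is small enough that its multiples by 1, ..., N stay in (0, 1], inside (0, pi), where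
   the sine is positive; so none of these powers of [w] equals 1. *)
set (w := expi (/ INR (S N))).
assert (hN : 0 < INR (S N)) by (apply lt_0_INR; lia).
assert (hw : forall j, (j < N)%nat -> Cminus (Cpow w (S j)) 1 <> RtoC 0).
{ intros j hj E. unfold w in E. rewrite expi_pow in E.
  assert (E2 : Im (expi (INR (S j) * / INR (S N)) - 1)%C = 0) by (rewrite E; reflexivity).
  change (sin (INR (S j) * / INR (S N)) + - 0 = 0) in E2.
  assert (0 < sin (INR (S j) * / INR (S N))); [|lra].
  apply sin_gt_0.
  - apply Rmult_lt_0_compat; [apply lt_0_INR; lia|apply Rinv_0_lt_compat, hN].
  - pose proof PI2_1. apply Rle_lt_trans with 1; [|lra].
    apply (Rmult_le_reg_r (INR (S N))); [exact hN|].
    rewrite Rmult_assoc, Rinv_l, Rmult_1_r, Rmult_1_l by lra. apply le_INR. lia. }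
assert (hS : forall j, (j < N)%nat -> c (S j) = RtoC 0).
{ intros j hj.
  assert (E : Cmult (c (S j)) (Cminus (Cpow w (S j)) 1) = RtoC 0).
  { apply (IH (fun i => Cmult (c (S i)) (Cminus (Cpow w (S i)) 1))); [|exact hj].
    intros t.
    assert (E : Cmult (expi t) (cpartial (fun i =>
      (c (S i) * (Cpow w (S i) - 1) * Cpow (expi t) i)%C) N) = RtoC 0).
    { rewrite <- cpartial_scal.
      replace (RtoC 0) with (Cminus (RtoC 0) (RtoC 0)) by ring.
      rewrite <- (h t) at 2. rewrite <- (h (/ INR (S N) + t)).
      rewrite !cpartial_S_l.
      replace (_ - _)%C with
        (cpartial (fun i => c (S i) * Cpow (expi (/ INR (S N) + t)) (S i)) N +
         Copp 1 * cpartial (fun i => c (S i) * Cpow (expi t) (S i)) N)%C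
        by (simpl; ring).
      rewrite <- cpartial_scal, <- cpartial_plus. apply cpartial_ext. intros k hk.
      rewrite expi_plus. fold w.
      rewrite Cpow_mult_l. simpl. ring. }
    destruct (Cmult_eq_0 _ _ E) as [Z|Z]; [|exact Z]. destruct (expi_nonzero _ Z). }
  destruct (Cmult_eq_0 _ _ E) as [Z|Z]; [exact Z|]. destruct (hw j hj Z). }
destruct i as [|i]; [|apply hS; lia].
specialize (h 0). rewrite cpartial_S_l in h.
rewrite (cpartial_ext _ (fun _ => RtoC 0)) in h.
2:{ intros j hj. rewrite hS by exact hj. ring. }
assert (Z : forall M, cpartial (fun _ => RtoC 0) M = RtoC 0).
{ induction M as [|M IHM]; [reflexivity|]. simpl. rewrite IHM. ring. }
rewrite Z in h. rewrite <- h. simpl. ring.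
Qed.

Lemma mono_support (i j m n : nat) :
  (forall l, ~ (m = (i + l)%nat /\ n = (j + l)%nat)) -> mono i j m n = 0.
Proof.
intros h. unfold mono.
destruct (Nat.leb_spec i m); [|reflexivity].
destruct (Nat.eqb_spec n (j + (m - i))); [|reflexivity].
exfalso. apply (h (m - i)%nat). lia.
Qed.

Lemma mono_diag (i j l : nat) :
  mono i j (i + l) (j + l) = sqrt (INR (fact (i + l)) * INR (fact (j + l))) / INR (fact l).
Proof.
unfold mono. destruct (Nat.leb_spec i (i + l)); [|lia].
replace (i + l - i)%nat with l by lia. rewrite Nat.eqb_refl. reflexivity.
Qed.

Definition wmono (beta s : R) (i j m n : nat) : C := RtoC (wt beta s m n * mono i j m n).

(** At m = i + l, n = j + l the entry is the product of sqrt((l+i)!/l!) and sqrt((l+j)!/l!). Each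
    costs y^(-l), which half of the decay of the weight absorbs, and the distance from the diagonal
    is at most i + j. *)
Lemma wmono_bound (beta s : R) (i j : nat) : 0 < beta -> 0 <= s <= 1 ->
  exists G, bounded_by (wmono beta s i j) G (thermal_base beta).
Proof.
intros h hs. pose proof (thermal_base_bounds beta h) as hy. set (y := thermal_base beta) in *.
set (c := fun k => sqrt (INR (fact k)) * (/ sqrt (1 - y ^ 2)) ^ k).
assert (hr : 0 < / sqrt (1 - y ^ 2)) by (apply Rinv_0_lt_compat, sqrt_lt_R0; nra).
assert (hi : 0 < / y) by (apply Rinv_0_lt_compat; lra).
assert (hc : forall k, 0 <= c k).
{ intros k. apply Rmult_le_pos; [apply sqrt_pos|apply pow_le; lra]. }
assert (hG : 0 <= (/ y) ^ (2 * (i + j)) * (c i * c j)).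
{ apply Rmult_le_pos; [apply pow_le; lra|apply Rmult_le_pos; apply hc]. }
exists ((/ y) ^ (2 * (i + j)) * (c i * c j)). split; [exact hy|]. intros m n.
assert (yp : forall k, 0 < y ^ k) by (intros; apply pow_lt; lra).
unfold wmono. rewrite Cmod_R.
destruct (classic (exists l, m = (i + l)%nat /\ n = (j + l)%nat)) as [[l [-> ->]]|hl].
2:{ rewrite mono_support, Rmult_0_r, Rabs_R0.
    - apply Rmult_le_pos; [exact hG|apply Rmult_le_pos; apply Rlt_le, yp].
    - intros l hl'. apply hl. exists l; exact hl'. }
rewrite mono_diag.
pose proof (INR_fact_pos l) as hfl.
assert (E : sqrt (INR (fact (i + l)) * INR (fact (j + l))) / INR (fact l)
  = sqrt (INR (fact (l + i)) / INR (fact l)) * sqrt (INR (fact (l + j)) / INR (fact l))).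
{ rewrite !sqrt_div_alt by assumption.
  rewrite sqrt_mult by apply pos_INR.
  rewrite (Nat.add_comm i), (Nat.add_comm j).
  rewrite <- (sqrt_sqrt (INR (fact l))) at 1 by lra.
  field. apply not_eq_sym, Rlt_not_eq, sqrt_lt_R0, hfl. }
rewrite E.
pose proof (sqrt_fact_ratio y l i hy) as b1. pose proof (sqrt_fact_ratio y l j hy) as b2.
fold (c i) in b1. fold (c j) in b2.
rewrite Rabs_pos_eq.
2:{ apply Rmult_le_pos; [apply Rlt_le, wt_pos; assumption|].
    apply Rmult_le_pos; apply sqrt_pos. }
pose proof (wt_bound beta s (i + l) (j + l) (i + j) h hs ltac:(lia) ltac:(lia)) as hw.
fold y in hw.
apply Rle_trans with (((/ y) ^ (2 * (i + j)) * (y ^ (2 * (i + l)) * y ^ (2 * (j + l)))) *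
  ((c i * (/ y) ^ l) * (c j * (/ y) ^ l))).
- apply Rmult_le_compat; [apply Rlt_le, wt_pos; assumption| |exact hw|].
  + apply Rmult_le_pos; apply sqrt_pos.
  + apply Rmult_le_compat; try apply sqrt_pos; assumption.
- assert (El : y ^ l * (/ y) ^ l = 1) by (rewrite <- Rpow_mult_distr, Rinv_r, pow1; lra).
  replace (2 * (i + l))%nat with ((i + l) + (i + l))%nat by lia.
  replace (2 * (j + l))%nat with ((j + l) + (j + l))%nat by lia.
  rewrite !(pow_add _ (i + l)), !(pow_add _ (j + l)).
  replace (_ * _) with (((/ y) ^ (2 * (i + j)) * (c i * c j)) * (y ^ (i + l) * y ^ (j + l)) *
    ((y ^ (i + l) * (/ y) ^ l) * (y ^ (j + l) * (/ y) ^ l))) by ring.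
  rewrite !pow_add, !(Rmult_assoc _ (y ^ l) ((/ y) ^ l)), El, !Rmult_1_r.
  pose proof (pow_le_1 y i ltac:(lra)). pose proof (pow_le_1 y j ltac:(lra)).
  rewrite <- (Rmult_1_r (_ * (y ^ i * y ^ l * (y ^ j * y ^ l)))) at 2.
  apply Rmult_le_compat_l.
  + apply Rmult_le_pos; [exact hG|]. repeat apply Rmult_le_pos; apply Rlt_le, yp.
  + nra.
Qed.

Lemma functional_diag (F : hs -> C) (M : nat -> nat -> C) (i j : nat) :
  functional F -> rapid M ->
  (forall m n, (forall l, ~ (m = (i + l)%nat /\ n = (j + l)%nat)) -> M m n = RtoC 0) ->
  csum (fun l => Cmult (M (i + l)%nat (j + l)%nat) (F (mat_op (unit_mat (i + l) (j + l)))))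
       (F (mat_op M)).
Proof.
intros hF [G [y hM]] hs. pose proof (bounded_by_nonneg _ _ _ hM) as hG.
destruct hM as [hy hM].
(* Each factor y is split as z * z: one copy stays as the rate of the single-entry matrices, the
   other makes the series over [l] converge. *)
set (z := sqrt y).
assert (hz : 0 < z < 1).
{ split; [apply sqrt_lt_R0; lra|]. rewrite <- sqrt_1. apply sqrt_lt_1_alt. lra. }
assert (zp : forall k, 0 < z ^ k) by (intros; apply pow_lt; lra).
set (Mk := fun l m n => Cmult (M (i + l)%nat (j + l)%nat) (unit_mat (i + l) (j + l) m n)).
assert (H : rapid M /\ csum (fun l => F (mat_op (Mk l))) (F (mat_op M))).
{ apply (functional_csum F Mk M (fun l => G * z ^ l) z hF).
  - intros l. split; [exact hz|]. intros m n. unfold Mk, unit_mat.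
    destruct (Nat.eqb_spec m (i + l)), (Nat.eqb_spec n (j + l)); simpl;
      rewrite ?Cmult_0_r, ?Cmod_0;
      try (repeat apply Rmult_le_pos; try (apply Rlt_le, zp); assumption).
    subst m n. rewrite Cmult_1_r. eapply Rle_trans; [apply hM|].
    rewrite Rmult_assoc. apply Rmult_le_compat_l; [assumption|].
    replace y with (z * z) by (apply sqrt_sqrt; lra).
    rewrite !Rpow_mult_distr.
    replace (_ * _) with ((z ^ (i + l) * z ^ (j + l)) * (z ^ (i + l) * z ^ (j + l))) by ring.
    apply Rmult_le_compat_r; [apply Rmult_le_pos; apply Rlt_le, zp|].
    rewrite !pow_add. pose proof (pow_le_1 z i ltac:(lra)).
    pose proof (pow_le_1 z j ltac:(lra)). pose proof (pow_le_1 z l ltac:(lra)).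
    assert (z ^ i * z ^ l <= z ^ l) by nra.
    assert (0 <= z ^ i * z ^ l) by (apply Rmult_le_pos; lra).
    assert (0 <= z ^ j * z ^ l <= 1) by nra. nra.
  - eexists. apply geom_series_scal, hz.
  - intros m n. destruct (classic (exists l, m = (i + l)%nat /\ n = (j + l)%nat))
      as [[l [-> ->]]|hl].
    + assert (E : Mk l (i + l)%nat (j + l)%nat = M (i + l)%nat (j + l)%nat).
      { unfold Mk, unit_mat. rewrite !Nat.eqb_refl. simpl. ring. }
      rewrite <- E. apply (csum_single (fun k => Mk k (i + l)%nat (j + l)%nat) l).
      intros k hk. unfold Mk, unit_mat.
      destruct (Nat.eqb_spec (i + l) (i + k)); [lia|]. simpl. ring.
    + rewrite hs by (intros l hl'; apply hl; exists l; exact hl').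
      eapply csum_ext; [|apply csum_zero]. intros l. unfold Mk, unit_mat.
      destruct (Nat.eqb_spec m (i + l)), (Nat.eqb_spec n (j + l)); simpl; try ring.
      exfalso. apply hl. exists l. split; assumption. }
eapply csum_ext; [|apply H]. intros l. unfold Mk.
rewrite mat_op_scal by apply unit_mat_rapid. apply (fun_scal _ hF).
Qed.

Lemma unit_functional_le (F : hs -> C) (K : R) (m n : nat) :
  (forall X, Cmod (F X) <= K * hs_norm X) -> Cmod (F (mat_op (unit_mat m n))) <= K.
Proof.
intros hb. eapply Rle_trans; [apply hb|]. right. rewrite unit_mat_op.
change (K * l2norm (V := fock_NormedModule) (fun k => col_bop (e_ m) n (e_ k)) = K).
rewrite (proj2 (col_bop_norm (e_ m) n)), e_norm. ring.
Qed.

Lemma csum_moment_zero (w : nat -> C) (A q : R) : 0 < q < 1 ->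
  (forall n, Cmod (w n) <= A * q ^ n) ->
  (forall k, csum (fun l => Cmult (RtoC (INR (fact (l + k)) / INR (fact l))) (w (l + k)%nat))
                  (RtoC 0)) ->
  forall n, w n = RtoC 0.
Proof.
intros hq hw h n. apply C_ext.
- apply (moment_zero (fun n => Re (w n)) A q hq).
  + intros k. eapply Rle_trans; [apply re_le_Cmod|apply hw].
  + intros k. destruct (h k) as [h1 _].
    unfold PSeries. change 0 with (Re (RtoC 0)) at 1. rewrite <- (is_series_unique _ _ h1). apply Series_ext. intros l.
    unfold PS_derive_n. rewrite pow1. set (x := _ / _).
    change (x * Re (w (l + k)%nat) * 1 = x * Re (w (l + k)%nat) - 0 * Im (w (l + k)%nat)). ring.
- apply (moment_zero (fun n => Im (w n)) A q hq).
  + intros k. eapply Rle_trans; [apply im_le_Cmod|apply hw].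
  + intros k. destruct (h k) as [_ h1].
    unfold PSeries. change 0 with (Im (RtoC 0)) at 1. rewrite <- (is_series_unique _ _ h1). apply Series_ext. intros l.
    unfold PS_derive_n. rewrite pow1. set (x := _ / _).
    change (x * Im (w (l + k)%nat) * 1 = x * Im (w (l + k)%nat) + 0 * Re (w (l + k)%nat)). ring.
Qed.

(** Raising both exponents by k stays on the diagonal through (i, j) and multiplies the entry at
    position l + k by (l+k)!/l!. So the hypotheses along this diagonal say that all factorial
    moments of one sequence vanish, and geometric decay of the entries makes [moment_zero]
    applicable. *)
Lemma functional_monos (beta s : R) (F : hs -> C) : 0 < beta -> 0 <= s <= 1 ->
  functional F -> (forall i j, F (mat_op (wmono beta s i j)) = RtoC 0) ->
  forall U, F U = RtoC 0.
Proof.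
intros h hs hF hm. apply functional_units; [exact hF|]. intros i j.
destruct (fun_bd _ hF) as [K [hK hb]].
destruct (wmono_bound beta s i j h hs) as [G hG].
pose proof (bounded_by_nonneg _ _ _ hG) as hG0. destruct hG as [hy hG].
set (y := thermal_base beta) in *.
set (w := fun l => Cmult (wmono beta s i j (i + l) (j + l)) (F (mat_op (unit_mat (i + l) (j + l))))).
assert (hw : forall l, w l = RtoC 0).
{ apply (csum_moment_zero w (G * K) y hy).
  - intros l. unfold w. rewrite Cmod_mult.
    replace (G * K * y ^ l) with ((G * y ^ l) * K) by ring.
    apply Rmult_le_compat; try apply Cmod_ge_0; [|apply unit_functional_le, hb].
    eapply Rle_trans; [apply hG|]. apply Rmult_le_compat_l; [assumption|].
    rewrite !pow_add.
    pose proof (pow_le_1 y i ltac:(lra)). pose proof (pow_le_1 y j ltac:(lra)).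
    pose proof (pow_le_1 y l ltac:(lra)).
    assert (0 <= y ^ i * y ^ l <= y ^ l) by nra.
    assert (0 <= y ^ j * y ^ l <= 1) by nra. nra.
  - intros k. rewrite <- (hm (i + k)%nat (j + k)%nat).
    eapply csum_ext; [|apply (functional_diag F (wmono beta s (i + k) (j + k)) (i + k) (j + k) hF)].
    + intros l. unfold w. replace (i + (l + k))%nat with (i + k + l)%nat by lia.
      replace (j + (l + k))%nat with (j + k + l)%nat by lia.
      rewrite Cmult_assoc. f_equal. unfold wmono. rewrite <- RtoC_mult. f_equal.
      replace (mono i j (i + k + l) (j + k + l)) with (mono i j (i + (l + k)) (j + (l + k)))
        by (f_equal; lia).
      rewrite !mono_diag.
      replace (i + (l + k))%nat with (i + k + l)%nat by lia.
      replace (j + (l + k))%nat with (j + k + l)%nat by lia.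
      pose proof (INR_fact_pos l). pose proof (INR_fact_pos (l + k)). field. lra.
    + destruct (wmono_bound beta s (i + k) (j + k) h hs) as [G' hG']. exists G', y; exact hG'.
    + intros m n hl. unfold wmono. rewrite mono_support by exact hl. f_equal. ring. }
(* The term of index 0 is a nonzero entry times the value of [F] at the wanted matrix unit. *)
specialize (hw O). unfold w in hw. rewrite !Nat.add_0_r in hw.
destruct (Cmult_eq_0 _ _ hw) as [E|Z]; [exfalso|exact Z].
unfold wmono in E. apply RtoC_inj in E. revert E. apply Rgt_not_eq.
apply Rmult_lt_0_compat; [apply wt_pos; assumption|].
pose proof (mono_diag i j 0) as E. rewrite !Nat.add_0_r in E. rewrite E.
apply Rdiv_lt_0_compat; [|apply INR_fact_pos].
apply sqrt_lt_R0, Rmult_lt_0_compat; apply INR_fact_pos.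
Qed.

(** The decay is part of the predicate because [mat_op] is zero on matrices without it, which would
    make the vanishing of [F] void. [O] is the matrix before weighting. *)
Definition killed (beta s : R) (F : hs -> C) (O : nat -> nat -> C) : Prop :=
  rapid (fun m n => Cmult (RtoC (wt beta s m n)) (O m n)) /\
  F (mat_op (fun m n => Cmult (RtoC (wt beta s m n)) (O m n))) = RtoC 0.

Lemma killed_ext (beta s : R) (F : hs -> C) (O P : nat -> nat -> C) :
  (forall m n, O m n = P m n) -> killed beta s F O -> killed beta s F P.
Proof.
intros h [h1 h2]. split.
- eapply rapid_ext; [|exact h1]. intros; simpl; rewrite h; reflexivity.
- rewrite <- h2. f_equal. apply mat_op_ext. intros; rewrite h; reflexivity.
Qed.

Lemma killed_comb (beta s : R) (F : hs -> C) (O P : nat -> nat -> C) (k l : C) :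
  functional F -> killed beta s F O -> killed beta s F P ->
  killed beta s F (fun m n => Cplus (Cmult k (O m n)) (Cmult l (P m n))).
Proof.
intros hF [a1 a2] [b1 b2].
pose proof (rapid_scal k _ a1) as ka. pose proof (rapid_scal l _ b1) as lb.
assert (E : forall m n,
  Cplus (Cmult k (Cmult (RtoC (wt beta s m n)) (O m n)))
        (Cmult l (Cmult (RtoC (wt beta s m n)) (P m n)))
  = Cmult (RtoC (wt beta s m n)) (Cplus (Cmult k (O m n)) (Cmult l (P m n))))
  by (intros; ring).
split.
- eapply rapid_ext; [exact E|]. apply (rapid_plus _ _ ka lb).
- rewrite <- (mat_op_ext _ _ E), (mat_op_plus _ _ ka lb), (fun_plus _ hF).
  rewrite !mat_op_scal, !(fun_scal _ hF), a2, b2 by assumption. ring.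
Qed.

Lemma iter_weyl_comb (j : nat) (z k l : C) (x y : nat -> C) (m : nat) :
  Nat.iter j (weyl_field z) (fun i => Cplus (Cmult k (x i)) (Cmult l (y i))) m
  = Cplus (Cmult k (Nat.iter j (weyl_field z) x m)) (Cmult l (Nat.iter j (weyl_field z) y m)).
Proof.
revert m. induction j as [|j IH]; intros m; [reflexivity|]. simpl.
rewrite (weyl_field_ext _ _ _ _ IH), weyl_field_plus, !weyl_field_scal. reflexivity.
Qed.

Lemma iter_weyl_ext (j : nat) (z : C) (x y : nat -> C) (m : nat) :
  (forall i, x i = y i) -> Nat.iter j (weyl_field z) x m = Nat.iter j (weyl_field z) y m.
Proof.
intros h. replace y with x; [reflexivity|]. apply functional_extensionality, h.
Qed.

Lemma normal_pow_0 (z : C) (m n : nat) : normal_pow 0 z m n = delta n m.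
Proof.
unfold normal_pow, delta, divpow. simpl cpartial. unfold mono. rewrite Nat.sub_0_r. simpl (0 + m)%nat.
simpl (0 <=? m)%nat. rewrite (Nat.eqb_sym n m).
destruct (Nat.eqb_spec m n) as [->|]; simpl andb; cbv iota.
- rewrite sqrt_square by apply pos_INR. unfold Rdiv.
  rewrite Rinv_r by (apply Rgt_not_eq, INR_fact_pos).
  simpl. rewrite Rinv_1. ring.
- ring.
Qed.

(** Solves the Hermite recursion for its highest term. That term involves phi(z) applied to the
    preceding one, so the induction carries phi(z)^j applied to [normal_pow] for all j, and for two
    consecutive degrees, since the recursion reaches back by two. *)
Lemma normal_pow_killed (beta s : R) (F : hs -> C) (z : C) : functional F ->
  (forall j, killed beta s F (fun m n => field_pow j z m n)) ->
  forall k, killed beta s F (normal_pow k z).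
Proof.
intros hF h.
assert (H : forall k j, killed beta s F
    (fun m n => Nat.iter j (weyl_field z) (fun i => normal_pow k z i n) m) /\
  killed beta s F (fun m n => Nat.iter j (weyl_field z) (fun i => normal_pow (S k) z i n) m)).
(* At k = 0 the lower term is absent: the coefficient [c] is zero and [P] arbitrary, which gives
   both cases one shape. *)
{ assert (R : forall k j P,
    killed beta s F (fun m n => Nat.iter (S j) (weyl_field z) (fun i => normal_pow k z i n) m) ->
    killed beta s F (fun m n => Nat.iter j (weyl_field z) (fun i => P i n) m) ->
    (forall c m n, match k with O => c = RtoC 0
       | S k' => c = Cmult z (Cconj z) /\ P m n = normal_pow k' z m n end ->
      normal_pow (S k) z m n = Cplus (Cmult (RtoC (/ INR (S k))) (weyl_field z (fun i => normal_pow k z i n) m))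
        (Cmult (Cmult (RtoC (/ INR (S k))) c) (P m n)))).
  { intros k j P h1 h2 c m n hc. rewrite normal_pow_rec.
    assert (E : Cmult (RtoC (/ INR (S k))) (RtoC (INR (S k))) = RtoC 1).
    { rewrite <- RtoC_mult, Rinv_l; [reflexivity|]. apply not_0_INR; lia. }
    rewrite Cmult_plus_distr_l, Cmult_assoc, E.
    destruct k as [|k]; [subst c; ring|]. destruct hc as [-> ->]. ring. }
  induction k as [|k IH].
  - assert (K0 : forall j, killed beta s F
      (fun m n => Nat.iter j (weyl_field z) (fun i => normal_pow 0 z i n) m)).
    { intros j. eapply killed_ext; [|apply (h j)]. intros m n. unfold field_pow.
      apply iter_weyl_ext. intros i. symmetry. apply normal_pow_0. }
    intros j. split; [apply K0|].
    pose proof (killed_comb beta s F _ _ (RtoC (/ INR 1)) (Cmult (RtoC (/ INR 1)) 0) hF (K0 (S j)) (K0 j)) as Q.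
    eapply killed_ext; [|exact Q]. intros m n. cbv beta.
    rewrite Nat.iter_succ_r, <- iter_weyl_comb. apply iter_weyl_ext. intros i. symmetry.
    apply (R 0%nat j (fun m n => normal_pow 0 z m n) (K0 (S j)) (K0 j)). reflexivity.
  - intros j. split; [apply (IH j)|].
    pose proof (killed_comb beta s F _ _ (RtoC (/ INR (S (S k))))
      (Cmult (RtoC (/ INR (S (S k)))) (Cmult z (Cconj z))) hF (proj2 (IH (S j))) (proj1 (IH j))) as Q.
    eapply killed_ext; [|exact Q]. intros m n. cbv beta.
    rewrite Nat.iter_succ_r, <- iter_weyl_comb. apply iter_weyl_ext. intros i. symmetry.
    apply (R (S k) j (fun m n => normal_pow k z m n) (proj2 (IH (S j))) (proj1 (IH j))).
    split; reflexivity. }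
intros k. apply (H k O).
Qed.

Lemma functional_cpartial_mono (beta s : R) (F : hs -> C) (k : nat) (c : nat -> C) (N : nat) :
  0 < beta -> 0 <= s <= 1 -> functional F ->
  rapid (fun m n => cpartial (fun i => Cmult (c i) (wmono beta s i (k - i) m n)) N) /\
  F (mat_op (fun m n => cpartial (fun i => Cmult (c i) (wmono beta s i (k - i) m n)) N))
  = cpartial (fun i => Cmult (c i) (F (mat_op (wmono beta s i (k - i))))) N.
Proof.
intros h hs hF.
assert (hr : forall i j, rapid (wmono beta s i j)).
{ intros i j. destruct (wmono_bound beta s i j h hs) as [G hG]. exists G, (thermal_base beta); exact hG. }
induction N as [|N [IH1 IH2]].
- assert (r0 : rapid (fun m n : nat => RtoC 0)).
  { exists 0, (/ 2). split; [lra|]. intros m n. rewrite Cmod_0. lra. }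
  split; [exact r0|]. simpl. etransitivity; [|apply (functional_zero F hF)]. f_equal.
  apply hs_ext. intros m n. rewrite mat_op_entry by exact r0. reflexivity.
- simpl. pose proof (rapid_scal (c N) _ (hr N (k - N)%nat)) as rN.
  split; [apply (rapid_plus _ _ IH1 rN)|].
  rewrite (mat_op_plus _ _ IH1 rN), (fun_plus _ hF), IH2, mat_op_scal by apply hr.
  rewrite (fun_scal _ hF). reflexivity.
Qed.

Theorem weyl_total (beta s : R) (W : C -> bop) (F : hs -> C) :
  0 < beta -> 0 <= s <= 1 -> (forall z, is_weyl z (W z)) -> functional F ->
  (forall z, F (embed_hs beta s (W z)) = RtoC 0) -> forall U, F U = RtoC 0.
Proof.
intros h hs hW hF hz.
apply (functional_monos beta s F h hs hF).
assert (K1 : forall z k, F (mat_op (wpw beta s k z)) = RtoC 0).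
{ intros z. apply csum_power_zero. intros r.
  rewrite <- (hz (Cmult (RtoC r) z)). apply weyl_ray; auto. }
assert (K2 : forall z k, killed beta s F (fun m n => field_pow k z m n)).
{ intros z k. pose proof (wpw_rapid beta s k z h hs) as r.
  assert (E : forall m n, Cmult (RtoC (INR (fact k))) (wpw beta s k z m n)
    = Cmult (RtoC (wt beta s m n)) (field_pow k z m n)).
  { intros m n. unfold wpw.
    assert (E : Cmult (RtoC (INR (fact k))) (RtoC (/ INR (fact k))) = RtoC 1).
    { rewrite <- RtoC_mult, Rinv_r; [reflexivity|]. apply Rgt_not_eq, INR_fact_pos. }
    transitivity ((RtoC (INR (fact k)) * RtoC (/ INR (fact k))) * (wt beta s m n * field_pow k z m n))%C;
      [ring|]. rewrite E. ring. }
  split.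
  - eapply rapid_ext; [exact E|]. apply rapid_scal, r.
  - rewrite <- (mat_op_ext _ _ E), mat_op_scal, (fun_scal _ hF), K1 by exact r. ring. }
assert (K3 : forall z k, cpartial (fun i =>
  Cmult (Cmult (divpow z i) (divpow (Copp (Cconj z)) (k - i)))
    (F (mat_op (wmono beta s i (k - i))))) (S k) = RtoC 0).
{ intros z k. destruct (normal_pow_killed beta s F z hF (K2 z) k) as [_ E].
  rewrite <- E. rewrite <- (proj2 (functional_cpartial_mono beta s F k _ (S k) h hs hF)).
  f_equal. apply mat_op_ext. intros m n. unfold normal_pow. rewrite <- cpartial_scal.
  apply cpartial_ext. intros i hi. unfold wmono. rewrite RtoC_mult. ring. }
assert (K4 : forall k i, (i < S k)%nat -> F (mat_op (wmono beta s i (k - i))) = RtoC 0).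
{ intros k i hi.
  set (c := fun i => (RtoC (/ INR (fact i)) * RtoC (/ INR (fact (k - i))) * Cpow (Copp 1) (k - i) *
    F (mat_op (wmono beta s i (k - i))))%C).
  assert (E : c i = RtoC 0).
  { apply (circle_poly (S k) c); [|exact hi]. intros t.
    (* On the unit circle, multiplication by z^k turns z^i (conj z)^(k-i) into z^(2i); the half
       angle makes this e^(i t) to the power i, the form needed by [circle_poly]. *)
    set (z := expi (t / 2)).
    replace (RtoC 0) with (Cmult (Cpow z k) 0) by ring. rewrite <- (K3 z k), <- cpartial_scal.
    apply cpartial_ext. intros l hl. unfold c, divpow.
    replace (expi t) with (Cmult z z).
    2:{ unfold z. rewrite <- expi_plus. f_equal. field. }
    replace (Copp (Cconj z)) with (Cmult (Copp 1) (Cconj z)) by ring.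
    replace (Cpow z k) with (Cmult (Cpow z l) (Cpow z (k - l))).
    2:{ rewrite <- Cpow_add_r. f_equal. lia. }
    rewrite !Cpow_mult_l.
    assert (Ez : Cmult (Cpow z (k - l)) (Cpow (Cconj z) (k - l)) = RtoC 1).
    { rewrite <- Cpow_mult_l. unfold z. rewrite expi_conj. apply Cpow_1_l. }
    set (f := F _). set (a := RtoC (/ INR (fact l))). set (b := RtoC (/ INR (fact (k - l)))).
    set (o := Cpow (Copp 1) (k - l)) in *. set (zl := Cpow z l).
    transitivity ((Cpow z (k - l) * Cpow (Cconj z) (k - l)) * (a * b * o * f * (zl * zl)))%C;
      [rewrite Ez|]; ring. }
  assert (fz : forall n, RtoC (/ INR (fact n)) <> RtoC 0).
  { intros n Z. apply RtoC_inj in Z. revert Z.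
    apply Rgt_not_eq, Rinv_0_lt_compat, INR_fact_pos. }
  destruct (Cmult_eq_0 _ _ E) as [Z|Z]; [exfalso; revert Z|exact Z].
  apply Cmult_neq_0; [apply Cmult_neq_0; apply fz|]. apply Cpow_nz.
  intros Z. apply (f_equal Re) in Z. simpl in Z. lra. }
intros i j. specialize (K4 (i + j)%nat i ltac:(lia)).
replace (i + j - i)%nat with j in K4 by lia. exact K4.
Qed.

(** * The flow of the drift operator *)

Lemma Zop_plus (p : gauss_param) (z w : C) : Zop p (z + w) = Cplus (Zop p z) (Zop p w).
Proof. unfold Zop. rewrite Cplus_conj. ring. Qed.

Lemma Zop_real (p : gauss_param) (r : R) (z : C) : Zop p (RtoC r * z) = Cmult (RtoC r) (Zop p z).
Proof. unfold Zop. rewrite Cmult_conj, Cconj_R. ring. Qed.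

Definition Zbound (p : gauss_param) : R :=
  Cmod (Ci * Omega p - gamma p) + Cmod (Ci * kappa p).

Lemma Zop_iter_bound (p : gauss_param) (k : nat) (z : C) :
  Cmod (Nat.iter k (Zop p) z) <= Zbound p ^ k * Cmod z.
Proof.
induction k as [|k IH]; [simpl; lra|].
simpl. unfold Zop at 1. eapply Rle_trans; [apply Cmod_triangle|].
rewrite !(Cmod_mult _ (Nat.iter k (Zop p) z)), (Cmod_mult _ (Cconj _)), Cmod_conj.
rewrite <- Rmult_plus_distr_r, Rmult_assoc. fold (Zbound p).
apply Rmult_le_compat_l; [|exact IH]. unfold Zbound.
apply Rplus_le_le_0_compat; apply Cmod_ge_0.
Qed.

Definition Zterm (p : gauss_param) (t : R) (z : C) (k : nat) : C :=
  Cmult (RtoC (t ^ k / INR (fact k))) (Nat.iter k (Zop p) z).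

Lemma Zterm_bound (p : gauss_param) (t : R) (z : C) (k : nat) :
  Cmod (Zterm p t z k) <= Rabs t ^ k * (Zbound p ^ k / INR (fact k) * Cmod z).
Proof.
unfold Zterm. rewrite Cmod_mult, Cmod_R. unfold Rdiv. rewrite Rabs_mult, <- RPow_abs.
pose proof (INR_fact_pos k). rewrite (Rabs_pos_eq (/ _)) by (apply Rlt_le, Rinv_0_lt_compat; lra).
replace (Rabs t ^ k * (Zbound p ^ k * / INR (fact k) * Cmod z))
  with (Rabs t ^ k * / INR (fact k) * (Zbound p ^ k * Cmod z)) by ring.
apply Rmult_le_compat_l; [|apply Zop_iter_bound].
apply Rmult_le_pos; [apply pow_le, Rabs_pos|apply Rlt_le, Rinv_0_lt_compat; lra].
Qed.

Lemma exp_series (x c : R) : is_series (fun k => x ^ k / INR (fact k) * c) (exp x * c).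
Proof.
apply is_series_scal_r.
pose proof (is_exp_Reals x) as H. apply is_pseries_R in H.
revert H. apply is_series_ext. intros n. apply Rmult_comm.
Qed.

Lemma expZ_csum (p : gauss_param) (t : R) (z : C) : csum (Zterm p t z) (expZ p t z).
Proof.
apply (csum_dom _ (fun k => (Rabs t * Zbound p) ^ k / INR (fact k) * Cmod z)).
- intros k. eapply Rle_trans; [apply Zterm_bound|]. rewrite Rpow_mult_distr.
  right. unfold Rdiv. ring.
- eexists. apply exp_series.
Qed.

Lemma Zop_iter_plus (p : gauss_param) (k : nat) (z w : C) :
  Nat.iter k (Zop p) (Cplus z w) = Cplus (Nat.iter k (Zop p) z) (Nat.iter k (Zop p) w).
Proof. induction k as [|k IH]; [reflexivity|]. simpl. rewrite IH. apply Zop_plus. Qed.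

Lemma Zop_iter_real (p : gauss_param) (k : nat) (r : R) (z : C) :
  Nat.iter k (Zop p) (Cmult (RtoC r) z) = Cmult (RtoC r) (Nat.iter k (Zop p) z).
Proof. induction k as [|k IH]; [reflexivity|]. simpl. rewrite IH. apply Zop_real. Qed.

Lemma expZ_plus (p : gauss_param) (t : R) (z w : C) :
  expZ p t (Cplus z w) = Cplus (expZ p t z) (expZ p t w).
Proof.
apply (csum_unique (Zterm p t (Cplus z w))); [apply expZ_csum|].
eapply csum_ext; [|apply csum_plus; apply expZ_csum].
intros k. unfold Zterm. rewrite Zop_iter_plus. ring.
Qed.

Lemma expZ_real (p : gauss_param) (t r : R) (z : C) :
  expZ p t (Cmult (RtoC r) z) = Cmult (RtoC r) (expZ p t z).
Proof.
apply (csum_unique (Zterm p t (Cmult (RtoC r) z))); [apply expZ_csum|].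
eapply csum_ext; [|apply csum_scal; apply expZ_csum].
intros k. unfold Zterm. rewrite Zop_iter_real. ring.
Qed.

(** With [yZ], the complex-linear and the antilinear coefficient of the real-linear map e^(tZ),
    recovered from its values at 1 and at the imaginary unit. *)
Definition xZ (p : gauss_param) (t : R) : C := ((expZ p t 1 - Ci * expZ p t Ci) / 2)%C.
Definition yZ (p : gauss_param) (t : R) : C := ((expZ p t 1 + Ci * expZ p t Ci) / 2)%C.

Lemma expZ_xy (p : gauss_param) (t : R) (z : C) :
  expZ p t z = Cplus (xZ p t * z) (yZ p t * Cconj z).
Proof.
assert (E : z = (RtoC (Re z) * 1 + RtoC (Im z) * Ci)%C).
{ destruct z as [a b]. apply C_ext; unfold Ci, RtoC, Re, Im; simpl; ring. }
rewrite E at 1. rewrite expZ_plus, !expZ_real. unfold xZ, yZ.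
assert (hz : z = (RtoC (Re z) + RtoC (Im z) * Ci)%C) by (rewrite E at 1; ring).
assert (hc : Cconj z = (RtoC (Re z) - RtoC (Im z) * Ci)%C)
  by (destruct z as [a b]; apply C_ext; unfold Ci, RtoC, Cconj, Re, Im; simpl; ring).
rewrite hc. remember (Re z) as a eqn:ea. remember (Im z) as b eqn:eb.
rewrite hz. clear.
set (P := expZ p t 1). set (Q := expZ p t Ci).
transitivity (RtoC a * P + RtoC b * (- (Ci * Ci)) * Q)%C; [rewrite Ci_sq; ring|].
field.
Qed.

(** Used twice: for the generator, and through [xZ] and [yZ] for the adjoint. A quadratic remainder
    still tends to zero after division by t. *)
Lemma expZ_taylor (p : gauss_param) (z : C) :
  exists K, 0 <= K /\ forall t, 0 < t <= 1 ->
  Cmod (expZ p t z - z - RtoC t * Zop p z) <= K * t ^ 2.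
Proof.
exists (2 * (exp (Zbound p) * Cmod z)).
pose proof (Cmod_ge_0 z). split.
{ pose proof (exp_pos (Zbound p)). apply Rmult_le_pos; [lra|]. apply Rmult_le_pos; lra. }
intros t ht.
assert (hZ : 0 <= Zbound p) by (apply Rplus_le_le_0_compat; apply Cmod_ge_0).
pose proof (csum_incr_n _ _ 2 (expZ_csum p t z)) as T.
replace (expZ p t z - cpartial (Zterm p t z) 2)%C
  with (expZ p t z - z - RtoC t * Zop p z)%C in T.
2:{ simpl. unfold Zterm. simpl. replace (1 / 1) with 1 by field.
    replace (t * 1 / 1) with t by field. ring. }
replace (2 * (exp (Zbound p) * Cmod z) * t ^ 2) with (2 * (exp (Zbound p) * (Cmod z * t ^ 2))) by ring.
(* For t <= 1 the terms of degree at least 2 are bounded by t^2 times the corresponding terms at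
   time 1, whose full series sums to the exponential of [Zbound p]. *)
set (b := fun k => Zbound p ^ k / INR (fact k) * (Cmod z * t ^ 2)).
assert (hb : is_series b (exp (Zbound p) * (Cmod z * t ^ 2))) by apply exp_series.
assert (hb0 : forall k, 0 <= b k).
{ intros k. apply Rmult_le_pos.
  - apply Rmult_le_pos; [apply pow_le, hZ|apply Rlt_le, Rinv_0_lt_compat, INR_fact_pos].
  - apply Rmult_le_pos; [assumption|apply pow2_ge_0]. }
assert (eb : ex_series (fun k => b (2 + k)%nat)).
{ apply (ex_series_incr_n b 2). eexists; exact hb. }
apply Rle_trans with (2 * Series (fun k => b (2 + k)%nat)).
- apply (csum_bound (fun n => Zterm p t z (2 + n)) (fun k => b (2 + k)%nat));
    [|apply Series_correct, eb|exact T].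
  intros k. eapply Rle_trans; [apply Zterm_bound|].
  unfold b. rewrite Rabs_pos_eq by lra.
  replace (t ^ (2 + k) * (Zbound p ^ (2 + k) / INR (fact (2 + k)) * Cmod z)) with
    (Zbound p ^ (2 + k) / INR (fact (2 + k)) * (Cmod z * (t ^ 2 * t ^ k))) by (rewrite (pow_add t); ring).
  apply Rmult_le_compat_l.
  { apply Rmult_le_pos; [apply pow_le, hZ|apply Rlt_le, Rinv_0_lt_compat, INR_fact_pos]. }
  apply Rmult_le_compat_l; [assumption|].
  rewrite <- (Rmult_1_r (t ^ 2)) at 2. apply Rmult_le_compat_l; [apply pow2_ge_0|].
  apply pow_le_1. lra.
- apply Rmult_le_compat_l; [lra|]. rewrite <- (is_series_unique _ _ hb).
  rewrite (Series_incr_n b 2) by (lia || (eexists; exact hb)).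
  simpl pred. simpl sum_f_R0. pose proof (hb0 0%nat). pose proof (hb0 1%nat). simpl Nat.add. lra.
Qed.

Lemma cv_radius_all (a : nat -> R) :
  (forall x : R, ex_series (fun k => x ^ k * a k)) ->
  forall x : R, Rbar_lt (Rabs x) (CV_radius a).
Proof.
intros h x. apply (Rbar_lt_le_trans _ (Rabs x + 1)); [simpl; lra|].
apply Rbar_not_lt_le. intros H.
apply (CV_disk_outside a (Rabs x + 1)).
- pose proof (Rabs_pos x). rewrite Rabs_pos_eq by lra. exact H.
- apply (is_lim_seq_ext (fun k => (Rabs x + 1) ^ k * a k)); [intros; ring|].
  apply ex_series_lim_0, h.
Qed.

(** The components are everywhere convergent power series in time; continuity makes the integrand of
    [decay] integrable. *)
Lemma expZ_continuous (p : gauss_param) (z : C) (t : R) :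
  continuous (fun r => Re (expZ p r z)) t /\ continuous (fun r => Im (expZ p r z)) t.
Proof.
assert (P : forall f : C -> R,
  (forall r : R, is_series (fun k => r ^ k * (f (Nat.iter k (Zop p) z) / INR (fact k))) (f (expZ p r z))) ->
  continuous (fun r => f (expZ p r z)) t).
{ intros f h. set (a := fun k => f (Nat.iter k (Zop p) z) / INR (fact k)).
  apply (continuous_ext (PSeries a)).
  - intros r. apply PSeries_is_series, h.
  - apply continuity_pt_filterlim, PSeries_continuity, cv_radius_all.
    intros x. eexists. apply h. }
split; apply P; intros r; destruct (expZ_csum p r z) as [h1 h2].
- revert h1. apply is_series_ext. intros k. unfold Zterm.
  change (r ^ k / INR (fact k) * Re (Nat.iter k (Zop p) z) - 0 * Im (Nat.iter k (Zop p) z) =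
    r ^ k * (Re (Nat.iter k (Zop p) z) / INR (fact k))). unfold Rdiv. ring.
- revert h2. apply is_series_ext. intros k. unfold Zterm.
  change (r ^ k / INR (fact k) * Im (Nat.iter k (Zop p) z) + 0 * Re (Nat.iter k (Zop p) z) =
    r ^ k * (Im (Nat.iter k (Zop p) z) / INR (fact k))). unfold Rdiv. ring.
Qed.

(** As a real quadratic form in the coordinates, the integrand scales by r^2 along a real ray and is
    continuous in time. *)
Lemma Cop_quadratic (p : gauss_param) : exists a b c : R, forall w : C,
  Re (Cmult (Cconj w) (Cop p w)) = a * (Re w * Re w) + b * (Re w * Im w) + c * (Im w * Im w).
Proof.
set (K := Cmod (u1 p) ^ 2 + Cmod (v1 p) ^ 2 + (Cmod (u2 p) ^ 2 + Cmod (v2 p) ^ 2)).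
set (L := (2 * v1 p * u1 p + 2 * v2 p * u2 p)%C).
exists (K + Re L), (2 * Im L), (K - Re L). intros w.
replace (Cop p w) with (RtoC K * w + L * Cconj w)%C.
2:{ unfold Cop, K, L. rewrite (RtoC_plus (Cmod (u1 p) ^ 2 + Cmod (v1 p) ^ 2)). ring. }
destruct w as [x y]. destruct L as [l m]. simpl. ring.
Qed.

Definition decay (p : gauss_param) (t : R) (z : C) : R :=
  RInt (fun r => Re (Cmult (Cconj (expZ p r z)) (Cop p (expZ p r z)))) 0 t.

Lemma decay_real (p : gauss_param) (t r : R) (z : C) :
  decay p t (Cmult (RtoC r) z) = r ^ 2 * decay p t z.
Proof.
unfold decay. destruct (Cop_quadratic p) as [a [b [c h]]].
etransitivity; [|apply (RInt_scal (V := R_CompleteNormedModule) _ 0 t (r ^ 2))].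
- apply RInt_ext. intros x _. rewrite expZ_real, !h.
  change (a * (Re (r * expZ p x z)%C * Re (r * expZ p x z)%C) +
    b * (Re (r * expZ p x z)%C * Im (r * expZ p x z)%C) +
    c * (Im (r * expZ p x z)%C * Im (r * expZ p x z)%C) =
    r ^ 2 * (a * (Re (expZ p x z) * Re (expZ p x z)) + b * (Re (expZ p x z) * Im (expZ p x z))
     + c * (Im (expZ p x z) * Im (expZ p x z)))).
  replace (Re (r * expZ p x z)%C) with (r * Re (expZ p x z)) by (simpl; ring).
  replace (Im (r * expZ p x z)%C) with (r * Im (expZ p x z)) by (simpl; ring). ring.
- apply (ex_RInt_continuous (V := R_CompleteNormedModule)). intros x _.
  destruct (expZ_continuous p z x) as [c1 c2].
  apply (continuous_ext (fun x => a * (Re (expZ p x z) * Re (expZ p x z)) +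
    b * (Re (expZ p x z) * Im (expZ p x z)) + c * (Im (expZ p x z) * Im (expZ p x z)))).
  { intros y. symmetry. apply h. }
  assert (Q : forall (f g : R -> R) (k : R), continuous f x -> continuous g x ->
    continuous (fun y => k * (f y * g y)) x).
  { intros f g k cf cg. apply (continuous_mult (K := R_AbsRing) (fun _ => k) (fun y => f y * g y)).
    - apply continuous_const.
    - apply (continuous_mult (K := R_AbsRing) f g x cf cg). }
  exact (continuous_plus (V := R_NormedModule) _ _ x
    (continuous_plus (V := R_NormedModule) _ _ x (Q _ _ a c1 c1) (Q _ _ b c1 c2)) (Q _ _ c c2 c2)).
Qed.

Definition cfact (p : gauss_param) (t : R) (z : C) : R := exp (- / 2 * decay p t z).

Lemma gaussian_action_weyl (p : gauss_param) (W : C -> bop) (T : R -> bop -> bop) (t : R) (z : C) :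
  gaussian_action p W T -> zeta p = RtoC 0 -> 0 <= t ->
  T t (W z) = bop_scal (RtoC (cfact p t z)) (W (expZ p t z)).
Proof.
intros hg hz ht. rewrite (hg t z ht). change (@scal C_Ring bop_ModuleSpace) with bop_scal.
f_equal. rewrite hz.
replace (RInt (fun r => Re (Cmult (Cconj 0) (expZ p r z))) 0 t) with 0.
2:{ transitivity (RInt (V := R_CompleteNormedModule) (fun _ => 0) 0 t).
    - rewrite RInt_const. change (0 = (t - 0) * 0). ring.
    - apply RInt_ext. intros x _. simpl. ring. }
fold (decay p t z). unfold Cexp, cfact.
apply C_ext; simpl.
- replace (- / 2 * decay p t z + (0 * 0 - 1 * 0)) with (- / 2 * decay p t z) by ring.
  replace (0 + (0 * 0 + 1 * 0)) with 0 by ring. rewrite cos_0. ring.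
- replace (0 + (0 * 0 + 1 * 0)) with 0 by ring. rewrite sin_0. ring.
Qed.

(** * The induced semigroup on first-order polynomials *)

Definition ann_hs (beta s : R) : hs := mat_op (wmono beta s 0 1).
Definition cre_hs (beta s : R) : hs := mat_op (wmono beta s 1 0).

Definition field_hs (beta s : R) (z : C) : hs :=
  plus (scal z (cre_hs beta s)) (scal (Copp (Cconj z)) (ann_hs beta s)).

Lemma mono_00 (m n : nat) : mono 0 0 m n = if Nat.eqb m n then 1 else 0.
Proof.
unfold mono. rewrite Nat.sub_0_r. simpl (0 + m)%nat. simpl (0 <=? m)%nat.
rewrite (Nat.eqb_sym n m). destruct (Nat.eqb_spec m n) as [->|]; simpl andb; cbv iota; [|reflexivity].
rewrite sqrt_square by apply pos_INR. unfold Rdiv.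
apply Rinv_r, Rgt_not_eq, INR_fact_pos.
Qed.

Lemma delta_mono (m n : nat) : delta n m = RtoC (mono 0 0 m n).
Proof. rewrite mono_00. unfold delta. destruct (Nat.eqb m n); reflexivity. Qed.

Lemma wmono_rapid (beta s : R) (i j : nat) : 0 < beta -> 0 <= s <= 1 -> rapid (wmono beta s i j).
Proof.
intros h hs. destruct (wmono_bound beta s i j h hs) as [G hG]. exists G, (thermal_base beta); exact hG.
Qed.

Lemma field_entry (beta s : R) (z : C) (m n : nat) : 0 < beta -> 0 <= s <= 1 ->
  entry (field_hs beta s z) m n =
  Cplus (Cmult z (wmono beta s 1 0 m n)) (Cmult (Copp (Cconj z)) (wmono beta s 0 1 m n)).
Proof.
intros h hs.
rewrite <- (mat_op_entry (wmono beta s 1 0) m n), <- (mat_op_entry (wmono beta s 0 1) m n)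
  by (apply wmono_rapid; assumption).
reflexivity.
Qed.

Lemma field_wpw (beta s : R) (z : C) : 0 < beta -> 0 <= s <= 1 ->
  mat_op (wpw beta s 1 z) = field_hs beta s z.
Proof.
intros h hs. apply hs_ext. intros m n.
rewrite mat_op_entry by (apply wpw_rapid; assumption).
rewrite field_entry by assumption. unfold wpw, wmono.
rewrite field_pow_S, weyl_field_eq. unfold field_pow. simpl Nat.iter. rewrite !delta_mono.
rewrite <- !RtoC_mult, mono_cre, mono_ann.
replace (/ INR (fact 1)) with 1 by (simpl; field). simpl (INR 0).
rewrite Rmult_0_l, Rplus_0_r, !RtoC_mult. ring.
Qed.

(** The Gaussian factor has value 1 and derivative 0 at r = 0, so it leaves the first-order
    coefficient unchanged. This is why the field operator evolves without a scalar factor. *)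
Lemma gauss_product_coef (a b : nat -> R) (q : R) :
  (forall r : R, exists l, is_series (fun k => r ^ k * b k) l /\
    is_series (fun k => r ^ k * a k) (exp (- / 2 * (r ^ 2 * q)) * l)) ->
  a 1%nat = b 1%nat.
Proof.
intros h.
assert (ha : forall x : R, Rbar_lt (Rabs x) (CV_radius a)).
{ apply cv_radius_all. intros x. destruct (h x) as [l [_ H]]. eexists; exact H. }
assert (hb : forall x : R, Rbar_lt (Rabs x) (CV_radius b)).
{ apply cv_radius_all. intros x. destruct (h x) as [l [H _]]. eexists; exact H. }
assert (E : forall r, PSeries a r = exp (- / 2 * (r ^ 2 * q)) * PSeries b r).
{ intros r. destruct (h r) as [l [h1 h2]].
  rewrite (PSeries_is_series a r _ h2), (PSeries_is_series b r _ h1). reflexivity. }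
assert (D : forall c, (forall x : R, Rbar_lt (Rabs x) (CV_radius c)) ->
  is_derive (PSeries c) 0 (c 1%nat)).
{ intros c hc. pose proof (is_derive_PSeries c 0 (hc 0)) as H.
  replace (PSeries (PS_derive c) 0) with (c 1%nat) in H; [exact H|].
  rewrite PSeries_0. unfold PS_derive. simpl. ring. }
pose proof (D a ha) as Da. pose proof (D b hb) as Db.
assert (De : is_derive (fun r => exp (- / 2 * (r ^ 2 * q))) 0 0).
{ auto_derive; [exact I|]. simpl. ring. }
assert (Dp : is_derive (fun r => exp (- / 2 * (r ^ 2 * q)) * PSeries b r) 0 (b 1%nat)).
{ pose proof (is_derive_mult _ _ 0 _ _ De Db Rmult_comm) as H.
  replace (b 1%nat) with (plus (mult 0 (PSeries b 0)) (mult (exp (- / 2 * (0 ^ 2 * q))) (b 1%nat)));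
    [exact H|].
  change (0 * PSeries b 0 + exp (- / 2 * (0 ^ 2 * q)) * b 1%nat = b 1%nat).
  replace (- / 2 * (0 ^ 2 * q)) with 0 by ring. rewrite exp_0. ring. }
rewrite <- (is_derive_unique _ _ _ Da), <- (is_derive_unique _ _ _ Dp).
apply Derive_ext. exact E.
Qed.

Lemma semigroup_functional (S : R -> hs -> hs) (t : R) (F : hs -> C) :
  is_contraction_semigroup S -> 0 <= t -> functional F -> functional (fun U => F (S t U)).
Proof.
intros hS ht hF. split.
- intros X Y. rewrite (sg_plus _ hS) by assumption. apply (fun_plus _ hF).
- intros k X. rewrite (sg_scal _ hS) by assumption. apply (fun_scal _ hF).
- destruct (fun_bd _ hF) as [K [hK hb]]. exists K. split; [exact hK|]. intros X.
  eapply Rle_trans; [apply hb|]. apply Rmult_le_compat_l; [exact hK|].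
  apply (sg_contr _ hS), ht.
Qed.

Lemma induced_weyl (p : gauss_param) (W : C -> bop) (T : R -> bop -> bop)
  (beta s : R) (Ts : R -> hs -> hs) (t : R) (z : C) :
  (forall z, is_weyl z (W z)) -> gaussian_action p W T -> zeta p = RtoC 0 ->
  0 < beta -> 0 <= s <= 1 -> induces beta s T Ts -> 0 <= t ->
  Ts t (embed_hs beta s (W z)) =
  hs_scal (RtoC (cfact p t z)) (embed_hs beta s (W (expZ p t z))).
Proof.
intros hW hg hz h hs hi ht. apply (hi t (W z)); [exact ht| |].
- apply (embed_hs_bop beta s z); auto.
- rewrite (gaussian_action_weyl p W T t z hg hz ht).
  change (hs_bop (hs_scal (cfact p t z) (embed_hs beta s (W (expZ p t z)))))
    with (bop_scal (cfact p t z) (embed_hs beta s (W (expZ p t z)))).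
  rewrite (embed_hs_bop beta s (expZ p t z)) by auto.
  apply bop_ext_entry. intros m n.
  change (cfact p t z * entry (embed_bop beta s (W (expZ p t z))) m n =
    entry (embed_bop beta s (bop_scal (cfact p t z) (W (expZ p t z)))) m n)%C.
  rewrite !embed_entry by assumption.
  change (cfact p t z * (wt beta s m n * entry (W (expZ p t z)) m n) =
    wt beta s m n * (cfact p t z * entry (W (expZ p t z)) m n))%C. ring.
Qed.

Lemma induced_field (p : gauss_param) (W : C -> bop) (T : R -> bop -> bop)
  (beta s : R) (Ts : R -> hs -> hs) (t : R) (z : C) :
  (forall z, is_weyl z (W z)) -> gaussian_action p W T -> zeta p = RtoC 0 ->
  0 < beta -> 0 <= s <= 1 -> is_contraction_semigroup Ts -> induces beta s T Ts -> 0 <= t ->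
  Ts t (field_hs beta s z) = field_hs beta s (expZ p t z).
Proof.
intros hW hg hz h hs hS hi ht. apply hs_ext. intros m n.
rewrite <- !(field_wpw beta s) by assumption.
set (zt := expZ p t z).
(* A fixed entry, taken without and with the semigroup: the operator identity along the ray becomes
   a comparison of two scalar power series in [r]. *)
set (F0 := fun U => entry (hs_bop U) m n). set (F1 := fun U => F0 (Ts t U)).
change (F1 (mat_op (wpw beta s 1 z)) = F0 (mat_op (wpw beta s 1 zt))).
assert (hF0 : functional F0) by apply entry_functional.
assert (hF1 : functional F1) by (apply semigroup_functional; assumption).
set (a := fun k => F1 (mat_op (wpw beta s k z))).
set (b := fun k => F0 (mat_op (wpw beta s k zt))).
assert (R1 : forall r : R, exists l, csum (fun k => Cmult (RtoC (r ^ k)) (b k)) l /\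
  csum (fun k => Cmult (RtoC (r ^ k)) (a k)) (Cmult (RtoC (exp (- / 2 * (r ^ 2 * decay p t z)))) l)).
{ intros r. exists (F0 (embed_hs beta s (W (Cmult (RtoC r) zt)))). split.
  - apply weyl_ray; auto.
  - pose proof (weyl_ray beta s r z (W (Cmult (RtoC r) z)) F1 h hs (hW _) hF1) as H.
    unfold F1 at 2 in H.
    rewrite (induced_weyl p W T beta s Ts t (Cmult (RtoC r) z)) in H by assumption.
    unfold cfact in H. rewrite decay_real, expZ_real in H. exact H. }
assert (P : forall (f : C -> R), (forall (x : R) w, f (Cmult (RtoC x) w) = x * f w) ->
  (forall c l, csum c l -> is_series (fun k => f (c k)) (f l)) -> f (a 1%nat) = f (b 1%nat)).
{ intros f hf hc. apply (gauss_product_coef (fun k => f (a k)) (fun k => f (b k)) (decay p t z)).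
  intros r. destruct (R1 r) as [l [h1 h2]]. exists (f l).
  apply hc in h1. apply hc in h2. rewrite hf in h2. split.
  - revert h1. apply is_series_ext. intros k. apply hf.
  - revert h2. apply is_series_ext. intros k. apply hf. }
apply C_ext; apply P.
- intros x w. change (x * Re w - 0 * Im w = x * Re w). ring.
- intros c l [H _]. exact H.
- intros x w. change (x * Im w + 0 * Re w = x * Im w). ring.
- intros c l [_ H]. exact H.
Qed.

Lemma entry_plus (X Y : hs) (m n : nat) :
  entry (hs_bop (plus X Y)) m n = Cplus (entry X m n) (entry Y m n).
Proof. reflexivity. Qed.

Lemma entry_scal (k : C) (X : hs) (m n : nat) :
  entry (hs_bop (scal k X)) m n = Cmult k (entry X m n).
Proof. reflexivity. Qed.

Lemma entry_minus (X Y : hs) (m n : nat) :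
  entry (hs_bop (minus X Y)) m n = Cminus (entry X m n) (entry Y m n).
Proof.
change (entry (hs_bop X) m n + Copp 1 * entry (hs_bop Y) m n = entry X m n - entry Y m n)%C.
ring.
Qed.

Lemma hs_norm_plus (X Y : hs) : hs_norm (plus X Y) <= hs_norm X + hs_norm Y.
Proof. apply (norm_sub _ _ hs_is_norm). Qed.

Lemma hs_norm_scal (k : C) (X : hs) : hs_norm (scal k X) <= Cmod k * hs_norm X.
Proof. apply (norm_hom _ _ hs_is_norm). Qed.

Lemma hs_norm_pos (X : hs) : 0 <= hs_norm X.
Proof. apply (norm_pos _ _ hs_is_norm). Qed.

(** * Generators *)

Lemma generator_eps (S : R -> hs -> hs) (X Y : hs) :
  generator S X Y <-> forall eps, 0 < eps ->
  at_right 0 (fun t => hs_norm (minus (scal (RtoC (/ t)) (minus (S t X) X)) Y) < eps).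
Proof.
split.
- intros h eps he.
  apply (h (fun Z => hs_norm (minus Z Y) < eps)).
  exists (mkposreal eps he). intros Z hZ. exact hZ.
- intros h P [eps hP].
  apply (filter_imp (F := at_right 0)) with (2 := h eps (cond_pos eps)).
  intros t ht. apply hP. exact ht.
Qed.

Lemma generator_comb (S : R -> hs -> hs) (X X' Y Y' : hs) (k l : C) :
  is_contraction_semigroup S -> generator S X X' -> generator S Y Y' ->
  generator S (plus (scal k X) (scal l Y)) (plus (scal k X') (scal l Y')).
Proof.
intros hS hX hY. apply generator_eps. intros eps he.
rewrite generator_eps in hX, hY.
set (D := Cmod k + Cmod l + 1).
pose proof (Cmod_ge_0 k). pose proof (Cmod_ge_0 l).
assert (hD : 0 < D) by (unfold D; lra).
assert (he' : 0 < eps / D) by (apply Rdiv_lt_0_compat; assumption).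
assert (T : at_right 0 (fun t => 0 < t)).
{ exists (mkposreal 1 Rlt_0_1). intros t _ ht. exact ht. }
apply (filter_imp (F := at_right 0)) with (2 := filter_and _ _ T (filter_and _ _ (hX _ he') (hY _ he'))).
intros t [ht [h1 h2]].
set (Q := minus (scal (RtoC (/ t)) (minus (S t X) X)) X') in *.
set (P := minus (scal (RtoC (/ t)) (minus (S t Y) Y)) Y') in *.
match goal with |- hs_norm ?Z < _ => replace Z with (plus (scal k Q) (scal l P)) end.
- eapply Rle_lt_trans; [apply hs_norm_plus|].
  eapply Rle_lt_trans; [apply Rplus_le_compat; apply hs_norm_scal|].
  apply Rle_lt_trans with (Cmod k * (eps / D) + Cmod l * (eps / D)).
  + apply Rplus_le_compat; apply Rmult_le_compat_l; lra.
  + replace eps with (D * (eps / D)) at 3 by (field; lra). unfold D at 3. nra.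
- rewrite (sg_plus _ hS), !(sg_scal _ hS) by lra. unfold Q, P.
  apply hs_ext. intros m n.
  rewrite ?entry_minus, ?entry_plus, ?entry_scal, ?entry_minus, ?entry_plus, ?entry_scal,
    ?entry_minus, ?entry_plus, ?entry_scal. ring.
Qed.

Lemma generator_unique (S : R -> hs -> hs) (X Y Z : hs) :
  generator S X Y -> generator S X Z -> Y = Z.
Proof.
intros h1 h2. rewrite generator_eps in h1, h2.
assert (E : hs_norm (minus Y Z) = 0).
{ destruct (Rle_lt_or_eq_dec 0 _ (hs_norm_pos (minus Y Z))) as [hp|<-]; [|reflexivity].
  exfalso. assert (he : 0 < hs_norm (minus Y Z) / 2) by lra.
  destruct (filter_ex (F := at_right 0) _ (filter_and _ _ (h1 _ he) (h2 _ he))) as [t [g1 g2]].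
  set (Q := scal (RtoC (/ t)) (minus (S t X) X)) in *.
  assert (E : minus Y Z = plus (scal (Copp 1 : C_Ring) (minus Q Y)) (minus Q Z)).
  { apply hs_ext. intros m n.
    rewrite ?entry_minus, ?entry_plus, ?entry_scal, ?entry_minus. ring. }
  assert (N : hs_norm (minus Y Z) <= hs_norm (scal (Copp 1 : C_Ring) (minus Q Y)) + hs_norm (minus Q Z)).
  { eapply Rle_trans; [right; exact (f_equal hs_norm E)|apply hs_norm_plus]. }
  pose proof (hs_norm_scal (Copp 1) (minus Q Y)) as M.
  rewrite Cmod_opp, Cmod_1 in M. lra. }
assert (E0 : minus Y Z = zero) by apply (norm_def _ _ hs_is_norm _ E).
apply hs_ext. intros m n.
assert (E1 : entry (hs_bop (minus Y Z)) m n = RtoC 0) by (rewrite E0; reflexivity).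
rewrite entry_minus in E1.
replace (entry Y m n) with (Cplus (Cminus (entry Y m n) (entry Z m n)) (entry Z m n)) by ring.
rewrite E1. ring.
Qed.

Lemma field_norm (beta s : R) (z : C) : 0 < beta -> 0 <= s <= 1 ->
  hs_norm (field_hs beta s z) <= Cmod z * (hs_norm (cre_hs beta s) + hs_norm (ann_hs beta s)).
Proof.
intros h hs. unfold field_hs. eapply Rle_trans; [apply hs_norm_plus|].
eapply Rle_trans; [apply Rplus_le_compat; apply hs_norm_scal|].
rewrite Cmod_opp, Cmod_conj. lra.
Qed.

Lemma at_right_linear (K eps : R) : 0 <= K -> 0 < eps ->
  at_right 0 (fun t => 0 < t <= 1 /\ K * t < eps).
Proof.
intros hK he.
assert (hd : 0 < Rmin 1 (eps / (K + 1))).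
{ apply Rmin_pos; [lra|]. apply Rdiv_lt_0_compat; lra. }
exists (mkposreal _ hd). intros t ht h0.
change (Rabs (t - 0) < Rmin 1 (eps / (K + 1))) in ht.
rewrite Rminus_0_r, Rabs_pos_eq in ht by lra.
pose proof (Rmin_l 1 (eps / (K + 1))). pose proof (Rmin_r 1 (eps / (K + 1))).
split; [lra|].
assert (t * (K + 1) < eps); [|nra].
apply (Rmult_lt_reg_r (/ (K + 1))); [apply Rinv_0_lt_compat; lra|].
rewrite Rmult_assoc, Rinv_r by lra. unfold Rdiv in *. lra.
Qed.

(** By real linearity the difference quotient minus its limit is again [field_hs] of a complex
    number, so convergence in Hilbert-Schmidt norm reduces to the Taylor estimate in C. *)
Lemma field_generator (p : gauss_param) (beta s : R) (S : R -> hs -> hs) (z : C) :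
  0 < beta -> 0 <= s <= 1 ->
  (forall t, 0 <= t -> S t (field_hs beta s z) = field_hs beta s (expZ p t z)) ->
  generator S (field_hs beta s z) (field_hs beta s (Zop p z)).
Proof.
intros h hs hS. apply generator_eps. intros eps he.
destruct (expZ_taylor p z) as [K [hK hT]].
set (N := hs_norm (cre_hs beta s) + hs_norm (ann_hs beta s)).
assert (hN : 0 <= N) by (apply Rplus_le_le_0_compat; apply hs_norm_pos).
apply (filter_imp (F := at_right 0)) with (2 := at_right_linear (K * N) eps ltac:(nra) he).
intros t [ht hlt]. rewrite hS by lra.
set (d := Cminus (Cmult (RtoC (/ t)) (Cminus (expZ p t z) z)) (Zop p z)).
match goal with |- hs_norm ?Z < _ => replace Z with (field_hs beta s d) end.
- eapply Rle_lt_trans; [apply field_norm; assumption|]. fold N.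
  eapply Rle_lt_trans; [|exact hlt].
  replace (K * N * t) with (K * t * N) by ring. apply Rmult_le_compat_r; [exact hN|].
  assert (E : d = Cmult (RtoC (/ t)) (expZ p t z - z - RtoC t * Zop p z)%C).
  { unfold d. assert (E : Cmult (RtoC (/ t)) (RtoC t) = RtoC 1).
    { rewrite <- RtoC_mult, Rinv_l by lra. reflexivity. }
    transitivity (RtoC (/ t) * (expZ p t z - z) - (RtoC (/ t) * RtoC t) * Zop p z)%C;
      [rewrite E|]; ring. }
  rewrite E, Cmod_mult, Cmod_R, Rabs_pos_eq by (apply Rlt_le, Rinv_0_lt_compat; lra).
  apply Rle_trans with (/ t * (K * t ^ 2)).
  + apply Rmult_le_compat_l; [apply Rlt_le, Rinv_0_lt_compat; lra|]. apply hT, ht.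
  + right. field. lra.
- apply hs_ext. intros m n.
  rewrite entry_minus, entry_scal, entry_minus, !field_entry by assumption.
  unfold d. rewrite !Cminus_conj, Cmult_conj, Cminus_conj, Cconj_R. ring.
Qed.

(** phi is only real-linear in z, so both values phi(1) = a^dagger - a and phi(i) = i (a^dagger + a)
    are used to isolate a ladder operator. *)
Lemma ann_hs_field (beta s : R) : 0 < beta -> 0 <= s <= 1 ->
  ann_hs beta s = plus (scal (- / 2)%C (field_hs beta s 1)) (scal (- Ci / 2)%C (field_hs beta s Ci)).
Proof.
intros h hs. apply hs_ext. intros m n.
rewrite entry_plus, !entry_scal, !field_entry by assumption.
unfold ann_hs. rewrite mat_op_entry by (apply wmono_rapid; assumption).
set (d := wmono beta s 1 0 m n). set (a := wmono beta s 0 1 m n).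
rewrite Cconj_R, Cconj_Ci.
transitivity (- / 2 * (d - a) - (Ci * Ci) / 2 * (d + a))%C; [rewrite Ci_sq|]; field.
Qed.

Lemma cre_hs_field (beta s : R) : 0 < beta -> 0 <= s <= 1 ->
  cre_hs beta s = plus (scal (/ 2)%C (field_hs beta s 1)) (scal (- Ci / 2)%C (field_hs beta s Ci)).
Proof.
intros h hs. apply hs_ext. intros m n.
rewrite entry_plus, !entry_scal, !field_entry by assumption.
unfold cre_hs. rewrite mat_op_entry by (apply wmono_rapid; assumption).
set (d := wmono beta s 1 0 m n). set (a := wmono beta s 0 1 m n).
rewrite Cconj_R, Cconj_Ci.
transitivity (/ 2 * (d - a) - (Ci * Ci) / 2 * (d + a))%C; [rewrite Ci_sq|]; field.
Qed.

(** The complex-linear coefficient of the drift; the antilinear one is [Ci * kappa p]. *)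
Definition alpha (p : gauss_param) : C := (Ci * Omega p - gamma p)%C.

(** In phi(Z z) = (Z z) a^dagger - conj(Z z) a with Z z = alpha z + i kappa conj z, the coefficient
    of conj z is minus the image of a, and the coefficient of z is the image of a^dagger. *)
Lemma ann_generator (p : gauss_param) (beta s : R) (S : R -> hs -> hs) :
  0 < beta -> 0 <= s <= 1 -> is_contraction_semigroup S ->
  (forall t z, 0 <= t -> S t (field_hs beta s z) = field_hs beta s (expZ p t z)) ->
  generator S (ann_hs beta s)
    (plus (scal (Cconj (alpha p)) (ann_hs beta s)) (scal (- (Ci * kappa p))%C (cre_hs beta s))).
Proof.
intros h hs hS hf.
assert (G : forall z, generator S (field_hs beta s z) (field_hs beta s (Zop p z))).
{ intros z. apply field_generator; auto. }
rewrite (ann_hs_field beta s h hs) at 1.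
match goal with |- generator _ _ ?Z =>
  replace Z with (plus (scal (- / 2)%C (field_hs beta s (Zop p 1)))
  (scal (- Ci / 2)%C (field_hs beta s (Zop p Ci)))) end; [apply generator_comb; auto|].
apply hs_ext. intros m n. rewrite !entry_plus, !entry_scal, !field_entry by assumption.
unfold ann_hs, cre_hs. rewrite !mat_op_entry by (apply wmono_rapid; assumption).
set (d := wmono beta s 1 0 m n). set (a := wmono beta s 0 1 m n).
unfold Zop. fold (alpha p).
rewrite !Cconj_R, !Cconj_Ci, !Cplus_conj, !Cmult_conj, !Copp_conj, !Cconj_R, !Cconj_Ci.
set (al := alpha p). set (k := kappa p). set (al' := Cconj al). set (k' := Cconj k).
(* The squares of the imaginary unit are kept explicit: [field] treats [Ci] as an atom, and they are
   replaced by -1 separately. *)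
transitivity (
  - / 2 * ((al + Ci * k) * d - (al' - Ci * k') * a)
  - / 2 * ((al * (Ci * Ci) - Ci * k * (Ci * Ci)) * d + (al' * (Ci * Ci) + Ci * k' * (Ci * Ci)) * a))%C.
- field.
- rewrite Ci_sq. field.
Qed.

Lemma cre_generator (p : gauss_param) (beta s : R) (S : R -> hs -> hs) :
  0 < beta -> 0 <= s <= 1 -> is_contraction_semigroup S ->
  (forall t z, 0 <= t -> S t (field_hs beta s z) = field_hs beta s (expZ p t z)) ->
  generator S (cre_hs beta s)
    (plus (scal (alpha p) (cre_hs beta s)) (scal (Ci * Cconj (kappa p))%C (ann_hs beta s))).
Proof.
intros h hs hS hf.
assert (G : forall z, generator S (field_hs beta s z) (field_hs beta s (Zop p z))).
{ intros z. apply field_generator; auto. }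
rewrite (cre_hs_field beta s h hs) at 1.
match goal with |- generator _ _ ?Z =>
  replace Z with (plus (scal (/ 2)%C (field_hs beta s (Zop p 1)))
  (scal (- Ci / 2)%C (field_hs beta s (Zop p Ci)))) end; [apply generator_comb; auto|].
apply hs_ext. intros m n. rewrite !entry_plus, !entry_scal, !field_entry by assumption.
unfold ann_hs, cre_hs. rewrite !mat_op_entry by (apply wmono_rapid; assumption).
set (d := wmono beta s 1 0 m n). set (a := wmono beta s 0 1 m n).
unfold Zop. fold (alpha p).
rewrite !Cconj_R, !Cconj_Ci, !Cplus_conj, !Cmult_conj, !Copp_conj, !Cconj_R, !Cconj_Ci.
set (al := alpha p). set (k := kappa p). set (al' := Cconj al). set (k' := Cconj k).
transitivity (
  / 2 * ((al + Ci * k) * d - (al' - Ci * k') * a)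
  - / 2 * ((al * (Ci * Ci) - Ci * k * (Ci * Ci)) * d + (al' * (Ci * Ci) + Ci * k' * (Ci * Ci)) * a))%C.
- field.
- rewrite Ci_sq. field.
Qed.

(** * The Hilbert-Schmidt inner product *)

Lemma Cmod_conj_mult_le (a b : C) : Cmod (Cmult (Cconj a) b) <= Cmod a ^ 2 + Cmod b ^ 2.
Proof.
rewrite Cmod_mult, Cmod_conj. pose proof (Cmod_ge_0 a). pose proof (Cmod_ge_0 b).
pose proof (pow2_ge_0 (Cmod a - Cmod b)). nra.
Qed.

Lemma sqsum_sum_series {V : NormedModule C_AbsRing} (x y : nat -> V) : sqsum x -> sqsum y ->
  is_series (fun n => norm (x n) ^ 2 + norm (y n) ^ 2) (l2norm x ^ 2 + l2norm y ^ 2).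
Proof.
intros hx hy. rewrite (l2norm_sq x hx), (l2norm_sq y hy).
apply (is_series_plus (V := R_NormedModule)); apply Series_correct; assumption.
Qed.

Lemma inner_csum (x y : fock) : csum (fun n => Cmult (Cconj (x n)) (y n)) (inner x y).
Proof.
apply (csum_dom _ (fun n => Cmod (x n) ^ 2 + Cmod (y n) ^ 2)).
- intros n. apply Cmod_conj_mult_le.
- eexists. apply (sqsum_sum_series (V := C_NormedModule) x y); apply coord_sqsum.
Qed.

Lemma inner_le (x y : fock) : Cmod (inner x y) <=
  2 * (l2norm (V := C_NormedModule) x ^ 2 + l2norm (V := C_NormedModule) y ^ 2).
Proof.
eapply csum_bound; [|apply (sqsum_sum_series (V := C_NormedModule) x y); apply coord_sqsum|
  apply inner_csum].
intros n. apply Cmod_conj_mult_le.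
Qed.

Lemma hs_inner_csum (X U : hs) :
  csum (fun n => inner (X (e_ n)) (U (e_ n))) (hs_inner X U).
Proof.
apply (csum_dom _ (fun n => 2 * (norm (X (e_ n) : fock_NormedModule) ^ 2
  + norm (U (e_ n) : fock_NormedModule) ^ 2))).
- intros n. apply inner_le.
- apply (ex_series_scal_l (V := R_NormedModule) 2). eexists.
  apply (sqsum_sum_series (V := fock_NormedModule) (fun n => X (e_ n)) (fun n => U (e_ n)));
    apply hs_sqsum.
Qed.

(** A quadratic stand-in for the Cauchy-Schwarz inequality. Applied to [U] scaled to norm at most 1,
    it yields that the pairing is a bounded functional. *)
Lemma hs_inner_le (X U : hs) : Cmod (hs_inner X U) <= 4 * (hs_norm X ^ 2 + hs_norm U ^ 2).
Proof.
replace (4 * (hs_norm X ^ 2 + hs_norm U ^ 2)) with (2 * (2 * (hs_norm X ^ 2 + hs_norm U ^ 2))) by ring.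
apply (csum_bound (fun n => inner (X (e_ n)) (U (e_ n)))
  (fun n => 2 * (norm (X (e_ n) : fock_NormedModule) ^ 2 + norm (U (e_ n) : fock_NormedModule) ^ 2)));
  [|apply (is_series_scal_l (V := R_NormedModule) 2)|apply hs_inner_csum].
- intros n. apply inner_le.
- apply (sqsum_sum_series (V := fock_NormedModule) (fun n => X (e_ n)) (fun n => U (e_ n)));
    apply hs_sqsum.
Qed.

Lemma inner_comb_r (x u v : fock) (k l : C) :
  inner x (plus (scal k u) (scal l v)) = Cplus (Cmult k (inner x u)) (Cmult l (inner x v)).
Proof.
apply csum_Cseries.
eapply csum_ext; [|apply csum_plus; apply csum_scal; apply inner_csum].
intros n. change (k * (Cconj (x n) * u n) + l * (Cconj (x n) * v n) =
  Cconj (x n) * (k * u n + l * v n))%C. ring.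
Qed.

Lemma hs_inner_comb_r (X U V : hs) (k l : C) :
  hs_inner X (plus (scal k U) (scal l V)) = Cplus (Cmult k (hs_inner X U)) (Cmult l (hs_inner X V)).
Proof.
apply csum_Cseries.
eapply csum_ext; [|apply csum_plus; apply csum_scal; apply hs_inner_csum].
intros n. symmetry. exact (inner_comb_r (X (e_ n)) (U (e_ n)) (V (e_ n)) k l).
Qed.

Lemma inner_comb_l (x u v : fock) (k l : C) :
  inner (plus (scal k u) (scal l v)) x = Cplus (Cmult (Cconj k) (inner u x)) (Cmult (Cconj l) (inner v x)).
Proof.
apply csum_Cseries.
eapply csum_ext; [|apply csum_plus; apply csum_scal; apply inner_csum].
intros n. change (Cconj k * (Cconj (u n) * x n) + Cconj l * (Cconj (v n) * x n) =
  Cconj (k * u n + l * v n) * x n)%C. rewrite Cplus_conj, !Cmult_conj. ring.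
Qed.

Lemma hs_inner_comb_l (X U V : hs) (k l : C) :
  hs_inner (plus (scal k U) (scal l V)) X
  = Cplus (Cmult (Cconj k) (hs_inner U X)) (Cmult (Cconj l) (hs_inner V X)).
Proof.
apply csum_Cseries.
eapply csum_ext; [|apply csum_plus; apply csum_scal; apply hs_inner_csum].
intros n. symmetry. exact (inner_comb_l (X (e_ n)) (U (e_ n)) (V (e_ n)) k l).
Qed.

Lemma hs_inner_functional (X : hs) : functional (hs_inner X).
Proof.
assert (hsc : forall (k : C) U, hs_inner X (scal k U) = Cmult k (hs_inner X U)).
{ intros k U. replace (scal k U) with (plus (scal k U) (scal (RtoC 0) U)).
  - rewrite hs_inner_comb_r. ring.
  - apply hs_ext. intros m n. rewrite entry_plus, !entry_scal. ring. }
split.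
- intros U V. replace (plus U V) with (plus (scal (RtoC 1) U) (scal (RtoC 1) V)).
  + rewrite hs_inner_comb_r. ring.
  + apply hs_ext. intros m n. rewrite !entry_plus, !entry_scal. ring.
- exact hsc.
- exists (4 * (hs_norm X ^ 2 + 1)). pose proof (pow2_ge_0 (hs_norm X)). split; [lra|].
  intros U. set (N := hs_norm U). pose proof (hs_norm_pos U) as hN0.
  destruct (Rle_lt_or_eq_dec 0 N hN0) as [hN|hN].
  + set (U' := scal (RtoC (/ N)) U : hs).
    assert (E : U = scal (RtoC N) U').
    { apply hs_ext. intros m n. unfold U'. rewrite !entry_scal, Cmult_assoc, <- RtoC_mult.
      rewrite Rinv_r by lra. ring. }
    assert (hU' : hs_norm U' <= 1).
    { eapply Rle_trans; [apply hs_norm_scal|]. rewrite Cmod_R, Rabs_pos_eq.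
      - fold N. rewrite Rinv_l; lra.
      - apply Rlt_le, Rinv_0_lt_compat, hN. }
    rewrite E, hsc, Cmod_mult, Cmod_R, Rabs_pos_eq, Rmult_comm by lra.
    apply Rmult_le_compat_r; [lra|].
    eapply Rle_trans; [apply hs_inner_le|].
    pose proof (hs_norm_pos U'). nra.
  + rewrite <- hN, Rmult_0_r. symmetry in hN.
    assert (E : U = zero) by apply (norm_def _ _ hs_is_norm _ hN).
    replace U with (scal (RtoC 0) U).
    * rewrite hsc, Cmult_0_l, Cmod_0. lra.
    * apply hs_ext. intros m n. rewrite E, entry_scal.
      change (0 * 0 = 0)%C. ring.
Qed.

Lemma hs_inner_definite (X : hs) : hs_inner X X = RtoC 0 -> X = zero.
Proof.
intros h. apply (norm_def _ _ hs_is_norm).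
assert (I : forall x : fock, inner x x = RtoC (l2norm (V := C_NormedModule) x ^ 2)).
{ intros x. rewrite (l2norm_sq (V := C_NormedModule) x (coord_sqsum x)).
  destruct (inner_csum x x) as [h1 h2].
  apply C_ext.
  - change (Re (RtoC ?a)) with a. rewrite <- (is_series_unique _ _ h1).
    apply Series_ext. intros n. change (norm (x n : C_NormedModule)) with (Cmod (x n)).
    rewrite Cmod2_alt.
    change (Re (x n) * Re (x n) - - Im (x n) * Im (x n) = Re (x n) ^ 2 + Im (x n) ^ 2). ring.
  - change (Im (RtoC ?a)) with 0. rewrite <- (is_series_unique _ _ h2).
    rewrite (Series_ext _ (fun n => 0 * 0)) by
      (intros n; change (Re (x n) * Im (x n) + - Im (x n) * Re (x n) = 0 * 0); ring).
    rewrite Series_scal_l. ring. }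
destruct (hs_inner_csum X X) as [h1 _]. rewrite h in h1.
change (hs_norm X = 0).
assert (E : hs_norm X ^ 2 = 0).
{ unfold hs_norm. rewrite (l2norm_sq (V := fock_NormedModule) _ (hs_sqsum X)).
  transitivity (Re (RtoC 0)); [|reflexivity]. rewrite <- (is_series_unique _ _ h1).
  apply Series_ext. intros n. rewrite I. reflexivity. }
pose proof (hs_norm_pos X). nra.
Qed.

(** * Commutation of Weyl and ladder operators *)

Lemma sqrt_INR_sq (n : nat) : Cmult (RtoC (sqrt (INR n))) (RtoC (sqrt (INR n))) = RtoC (INR n).
Proof. rewrite <- RtoC_mult, sqrt_sqrt by apply pos_INR. reflexivity. Qed.

Lemma ann_cre (x : nat -> C) (m : nat) : ann (cre x) m = Cplus (cre (ann x) m) (x m).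
Proof.
change (RtoC (sqrt (INR (S m))) * (RtoC (sqrt (INR (S m))) * x m) = cre (ann x) m + x m)%C.
rewrite Cmult_assoc, sqrt_INR_sq.
destruct m as [|m].
- simpl. ring.
- change (INR (S (S m)) * x (S m) =
    RtoC (sqrt (INR (S m))) * (RtoC (sqrt (INR (S m))) * x (S m)) + x (S m))%C.
  rewrite Cmult_assoc, sqrt_INR_sq.
  rewrite (S_INR (S m)), RtoC_plus. ring.
Qed.

Lemma field_cre (z : C) (x : nat -> C) (m : nat) :
  weyl_field z (cre x) m = Cminus (cre (weyl_field z x) m) (Cmult (Cconj z) (x m)).
Proof.
assert (E : cre (weyl_field z x) m = Cminus (Cmult z (cre (cre x) m)) (Cmult (Cconj z) (cre (ann x) m))).
{ destruct m as [|m]; simpl; [ring|]. unfold weyl_field. ring. }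
rewrite E. unfold weyl_field. rewrite ann_cre. ring.
Qed.

Lemma field_ann (z : C) (x : nat -> C) (m : nat) :
  weyl_field z (ann x) m = Cminus (ann (weyl_field z x) m) (Cmult z (x m)).
Proof.
assert (E : ann (weyl_field z x) m = Cminus (Cmult z (ann (cre x) m)) (Cmult (Cconj z) (ann (ann x) m))).
{ unfold weyl_field, ann. ring. }
rewrite E. unfold weyl_field. rewrite ann_cre. ring.
Qed.

(** A scalar commutator commutes with phi(z), so each of the k factors contributes the same term, as
    for the derivative of a k-th power. At k = 0 the factor k hides [pred 0]. *)
Lemma iter_commutator (z c : C) (L : (nat -> C) -> nat -> C) (x : nat -> C) (k m : nat) :
  (forall y i, weyl_field z (L y) i = Cminus (L (weyl_field z y) i) (Cmult c (y i))) ->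
  Nat.iter k (weyl_field z) (L x) m =
  Cminus (L (Nat.iter k (weyl_field z) x) m)
    (Cmult (Cmult (RtoC (INR k)) c) (Nat.iter (pred k) (weyl_field z) x m)).
Proof.
intros h. revert m. induction k as [|k IH]; intros m.
- simpl. ring.
- change (weyl_field z (Nat.iter k (weyl_field z) (L x)) m =
    L (weyl_field z (Nat.iter k (weyl_field z) x)) m
    - INR (S k) * c * Nat.iter k (weyl_field z) x m)%C.
  rewrite (weyl_field_ext z _ (fun i => L (Nat.iter k (weyl_field z) x) i +
    (- (INR k * c)) * Nat.iter (pred k) (weyl_field z) x i)%C)
    by (intros i; rewrite IH; ring).
  rewrite weyl_field_plus, weyl_field_scal, h, S_INR, RtoC_plus.
  destruct k as [|k]; [simpl; ring|].
  simpl (pred (S k)).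
  change (weyl_field z (Nat.iter k (weyl_field z) x)) with (Nat.iter (S k) (weyl_field z) x). ring.
Qed.

Lemma cre_delta (n : nat) : cre (delta n) = (fun i => Cmult (RtoC (sqrt (INR (S n)))) (delta (S n) i)).
Proof.
apply functional_extensionality. intros i. unfold delta. destruct i as [|i].
- change (0 =? S n)%nat with false. cbv iota. simpl cre. ring.
- simpl cre. change (S i =? S n)%nat with (i =? n)%nat.
  destruct (Nat.eqb_spec i n); [subst; reflexivity|ring].
Qed.

Lemma ann_delta (n : nat) : ann (delta n) = (fun i => Cmult (RtoC (sqrt (INR n))) (delta (pred n) i)).
Proof.
apply functional_extensionality. intros i. unfold ann, delta. destruct n as [|n].
- simpl (INR 0). rewrite sqrt_0. change (S i =? 0)%nat with false. cbv iota. ring.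
- simpl (pred (S n)). change (S i =? S n)%nat with (i =? n)%nat.
  destruct (Nat.eqb_spec i n); [subst; reflexivity|ring].
Qed.

Lemma iter_weyl_scal (j : nat) (z k : C) (x : nat -> C) (m : nat) :
  Nat.iter j (weyl_field z) (fun i => Cmult k (x i)) m = Cmult k (Nat.iter j (weyl_field z) x m).
Proof.
revert m. induction j as [|j IH]; intros m; [reflexivity|]. simpl.
rewrite (weyl_field_ext _ _ _ _ IH). apply weyl_field_scal.
Qed.

(** The exponential is its own formal derivative: k/k! = 1/(k-1)!, and the term k = 0 is zero. *)
Lemma weyl_entry_shift (z : C) (W : bop) (m n : nat) : is_weyl z W ->
  csum (fun k => Cmult (RtoC (/ INR (fact k))) (Cmult (RtoC (INR k)) (field_pow (pred k) z m n))) (entry W m n).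
Proof.
intros hW.
replace (entry W m n) with (Cplus (Cmult (RtoC (/ INR (fact 0))) (Cmult (RtoC (INR 0)) (field_pow (pred 0) z m n)))
  (entry W m n)) by (simpl (INR 0); ring).
apply (csum_decr_1 (fun k => Cmult (RtoC (/ INR (fact k))) (Cmult (RtoC (INR k)) (field_pow (pred k) z m n)))).
eapply csum_ext; [|apply (weyl_entry z W m n hW)].
intros k. simpl (pred (S k)). rewrite Cmult_assoc, <- RtoC_mult, fact_S. do 2 f_equal.
pose proof (INR_fact_pos k). assert (0 < INR (S k)) by (apply lt_0_INR; lia). field. lra.
Qed.

(** Entrywise form of W(z) a^dagger = (a^dagger - conj z) W(z). The correction k conj z phi^(k-1)
    from [iter_commutator] sums to conj z W(z). *)
Lemma weyl_cre (z : C) (W : bop) (m n : nat) : is_weyl z W ->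
  Cmult (RtoC (sqrt (INR (S n)))) (entry W m (S n)) =
  Cminus (Cmult (RtoC (sqrt (INR m))) (entry W (pred m) n)) (Cmult (Cconj z) (entry W m n)).
Proof.
intros hW.
apply (csum_unique (fun k => Cmult (RtoC (sqrt (INR (S n))))
  (Cmult (RtoC (/ INR (fact k))) (field_pow k z m (S n))))).
- apply csum_scal, weyl_entry, hW.
- replace (_ - _)%C with (sqrt (INR m) * entry W (pred m) n + (- Cconj z) * entry W m n)%C by ring.
  eapply csum_ext; [|apply csum_plus;
    [apply csum_scal, (weyl_entry z W (pred m) n hW)|apply csum_scal, (weyl_entry_shift z W m n hW)]].
  intros k. cbv beta. symmetry.
  assert (E : Cmult (RtoC (sqrt (INR (S n)))) (field_pow k z m (S n)) =
    Cminus (Cmult (RtoC (sqrt (INR m))) (field_pow k z (pred m) n))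
      (Cmult (Cmult (RtoC (INR k)) (Cconj z)) (field_pow (pred k) z m n))).
  { unfold field_pow. rewrite <- iter_weyl_scal, <- cre_delta.
    rewrite (iter_commutator z (Cconj z) cre (delta n) k m (field_cre z)). f_equal.
    destruct m as [|m]; [|reflexivity]. simpl. rewrite sqrt_0. ring. }
  transitivity (RtoC (/ INR (fact k)) * (sqrt (INR (S n)) * field_pow k z m (S n)))%C; [|rewrite E]; ring.
Qed.

(** Likewise W(z) a = (a - z) W(z). *)
Lemma weyl_ann (z : C) (W : bop) (m n : nat) : is_weyl z W ->
  Cmult (RtoC (sqrt (INR n))) (entry W m (pred n)) =
  Cminus (Cmult (RtoC (sqrt (INR (S m)))) (entry W (S m) n)) (Cmult z (entry W m n)).
Proof.
intros hW.
apply (csum_unique (fun k => Cmult (RtoC (sqrt (INR n)))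
  (Cmult (RtoC (/ INR (fact k))) (field_pow k z m (pred n))))).
- apply csum_scal, weyl_entry, hW.
- replace (_ - _)%C with (sqrt (INR (S m)) * entry W (S m) n + (- z) * entry W m n)%C by ring.
  eapply csum_ext; [|apply csum_plus;
    [apply csum_scal, (weyl_entry z W (S m) n hW)|apply csum_scal, (weyl_entry_shift z W m n hW)]].
  intros k. cbv beta. symmetry.
  assert (E : Cmult (RtoC (sqrt (INR n))) (field_pow k z m (pred n)) =
    Cminus (Cmult (RtoC (sqrt (INR (S m)))) (field_pow k z (S m) n))
      (Cmult (Cmult (RtoC (INR k)) z) (field_pow (pred k) z m n))).
  { unfold field_pow. rewrite <- iter_weyl_scal, <- ann_delta.
    rewrite (iter_commutator z z ann (delta n) k m (field_ann z)). reflexivity. }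
  transitivity (RtoC (/ INR (fact k)) * (sqrt (INR n) * field_pow k z m (pred n)))%C; [|rewrite E]; ring.
Qed.

(** * Pairings of first-order polynomials with Weyl operators *)

Lemma ann_hs_pairing (beta s : R) (U : hs) : 0 < beta -> 0 <= s <= 1 ->
  csum (fun k => Cmult (RtoC (wt beta s k (S k) * sqrt (INR (S k)))) (entry U k (S k)))
       (hs_inner (ann_hs beta s) U).
Proof.
intros h hs.
pose proof (hs_inner_csum (ann_hs beta s) U) as H.
assert (E : forall m n, coord (ann_hs beta s (e_ n)) m = wmono beta s 0 1 m n).
{ intros m n. apply mat_op_entry, wmono_rapid; assumption. }
(* Since a e_0 = 0, column 0 contributes nothing and the sum can be reindexed from column 1. *)
assert (E0 : inner (ann_hs beta s (e_ 0)) (U (e_ 0)) = RtoC 0).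
{ apply csum_Cseries. eapply csum_ext; [|apply csum_zero]. intros m. rewrite E.
  unfold wmono. rewrite mono_support by (intros l hl; lia). rewrite Rmult_0_r, Cconj_R. ring. }
pose proof (csum_incr_1 _ _ H) as H1. cbv beta in H1. rewrite E0 in H1.
replace (hs_inner (ann_hs beta s) U - 0)%C with (hs_inner (ann_hs beta s) U) in H1 by ring.
eapply csum_ext; [|exact H1]. intros k. apply csum_Cseries.
assert (Ek : RtoC (wt beta s k (S k) * sqrt (INR (S k))) = Cconj (ann_hs beta s (e_ (S k)) k)).
{ rewrite E. unfold wmono. rewrite Cconj_R. do 2 f_equal.
  pose proof (mono_diag 0 1 k) as D. simpl Nat.add in D. rewrite D, fact_S.
  pose proof (INR_fact_pos k).
  replace (INR (fact k) * (INR (S k) * INR (fact k))) with (INR (S k) * (INR (fact k) * INR (fact k))) by ring.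
  rewrite sqrt_mult, sqrt_square by (try apply Rmult_le_pos; apply pos_INR). field. lra. }
rewrite Ek.
apply (csum_single (fun m => Cmult (Cconj (ann_hs beta s (e_ (S k)) m)) (U (e_ (S k)) m)) k).
intros m hm. rewrite E. unfold wmono.
rewrite mono_support by (intros l hl; lia). rewrite Rmult_0_r, Cconj_R. ring.
Qed.

Lemma cre_hs_pairing (beta s : R) (U : hs) : 0 < beta -> 0 <= s <= 1 ->
  csum (fun k => Cmult (RtoC (wt beta s (S k) k * sqrt (INR (S k)))) (entry U (S k) k))
       (hs_inner (cre_hs beta s) U).
Proof.
intros h hs.
assert (E : forall m n, coord (cre_hs beta s (e_ n)) m = wmono beta s 1 0 m n).
{ intros m n. apply mat_op_entry, wmono_rapid; assumption. }
eapply csum_ext; [|apply (hs_inner_csum (cre_hs beta s) U)]. intros k. apply csum_Cseries.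
assert (Ek : RtoC (wt beta s (S k) k * sqrt (INR (S k))) = Cconj (cre_hs beta s (e_ k) (S k))).
{ rewrite E. unfold wmono. rewrite Cconj_R. do 2 f_equal.
  pose proof (mono_diag 1 0 k) as D. simpl Nat.add in D. rewrite D, fact_S.
  pose proof (INR_fact_pos k). rewrite Rmult_assoc.
  rewrite sqrt_mult, sqrt_square by (try apply Rmult_le_pos; apply pos_INR). field. lra. }
rewrite Ek.
apply (csum_single (fun m => Cmult (Cconj (cre_hs beta s (e_ k) m)) (U (e_ k) m)) (S k)).
intros m hm. rewrite E. unfold wmono.
rewrite mono_support by (intros l hl; lia). rewrite Rmult_0_r, Cconj_R. ring.
Qed.

(** Pairing two embedded operators squares the weight. One step off the diagonal the square is
    e^(-beta k) times a constant, in which s survives only as e^(-beta s) below and e^(-beta (1-s))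
    above the diagonal. *)
Lemma wt_sq (beta s : R) (m n : nat) : 0 < beta ->
  wt beta s m n ^ 2 = (1 - exp (- beta)) * exp (- (beta * (s * INR m + (1 - s) * INR n))).
Proof.
intros h. unfold wt. rewrite !thermal_weight_eq by assumption.
assert (hc : 0 < 1 - exp (- beta)).
{ assert (exp (- beta) < 1) by (rewrite <- exp_0; apply exp_increasing; lra). lra. }
set (c := 1 - exp (- beta)) in *.
replace ((Rpower c (s / 2) * exp (- (beta * (s / 2) * INR m)) *
  (Rpower c ((1 - s) / 2) * exp (- (beta * ((1 - s) / 2) * INR n)))) ^ 2)
  with ((Rpower c (s / 2) * Rpower c ((1 - s) / 2) * (Rpower c (s / 2) * Rpower c ((1 - s) / 2))) *
   ((exp (- (beta * (s / 2) * INR m)) * exp (- (beta * (s / 2) * INR m))) *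
    (exp (- (beta * ((1 - s) / 2) * INR n)) * exp (- (beta * ((1 - s) / 2) * INR n))))) by ring.
rewrite <- !Rpower_plus, <- !exp_plus.
replace (s / 2 + (1 - s) / 2 + (s / 2 + (1 - s) / 2)) with 1 by field.
rewrite Rpower_1 by assumption. do 2 f_equal. field.
Qed.

(** [Tr (rho W) / (1 - e^-beta)] *)
Definition wtrace (beta : R) (W : bop) : C :=
  Cseries (fun n => Cmult (RtoC (exp (- beta) ^ n)) (entry W n n)).

Lemma exp_neg_lt_1 (beta : R) : 0 < beta -> 0 < exp (- beta) < 1.
Proof.
intros h. split; [apply exp_pos|]. rewrite <- exp_0. apply exp_increasing. lra.
Qed.

Lemma bop_entry_bounded (X : bop) : exists M, forall m n, Cmod (entry X m n) <= M.
Proof.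
destruct (bop_linear X) as [_ _ [M [hM hb]]]. exists M. intros m n.
eapply Rle_trans; [apply coord_le|].
eapply Rle_trans; [apply (hb (e_ n))|]. right.
change (M * l2norm (V := C_NormedModule) (e_ n) = M). rewrite e_norm. ring.
Qed.

Lemma wtrace_csum (beta : R) (W : bop) : 0 < beta ->
  csum (fun n => Cmult (RtoC (exp (- beta) ^ n)) (entry W n n)) (wtrace beta W).
Proof.
intros h. destruct (bop_entry_bounded W) as [M hM]. pose proof (exp_neg_lt_1 beta h).
apply (csum_dom _ (fun n => M * exp (- beta) ^ n)).
- intros n. rewrite Cmod_mult, Cmod_R, Rabs_pos_eq by (apply pow_le; lra).
  rewrite Rmult_comm. apply Rmult_le_compat_r; [apply pow_le; lra|apply hM].
- eexists. apply geom_series_scal. assumption.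
Qed.

Lemma trace_thermal (beta : R) (X : bop) : 0 < beta ->
  trace (bop_comp (thermal_state beta) X) = Cmult (RtoC (1 - exp (- beta))) (wtrace beta X).
Proof.
intros h. apply csum_Cseries.
eapply csum_ext; [|apply csum_scal, wtrace_csum, h].
intros n. symmetry. apply csum_Cseries.
assert (E : Cmult (RtoC (1 - exp (- beta))) (Cmult (RtoC (exp (- beta) ^ n)) (entry X n n)) =
  Cmult (Cconj (delta n n)) (thermal_state beta (X (e_ n)) n)).
{ unfold thermal_state. rewrite thermal_pow_act by lra. rewrite thermal_weight_eq by assumption.
  pose proof (exp_neg_lt_1 beta h).
  rewrite Rpower_1 by lra. rewrite exp_pow, RtoC_mult.
  replace (INR n * - beta) with (- (beta * 1 * INR n)) by ring.
  unfold delta. rewrite Nat.eqb_refl, Cconj_R. unfold entry. ring. }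
simpl. rewrite E.
apply (csum_single (fun k => Cmult (Cconj (delta n k)) (thermal_state beta (X (e_ n)) k)) n).
intros k hk. unfold delta. destruct (Nat.eqb_spec k n); [contradiction|]. rewrite Cconj_R. ring.
Qed.

(** Summing the relation over n gives q H = H - w D. It plays the part of cyclicity of the trace
    combined with the commutation of rho and a ladder operator up to the factor q. *)
Lemma shift_solve (q : R) (w : C) (h : nat -> C) (d : nat -> C) (H D : C) :
  q <> 1 -> csum h H -> csum d D ->
  (forall n, match n with O => RtoC 0 | S k => Cmult (RtoC q) (h k) end = Cminus (h n) (Cmult w (d n))) ->
  Cmult (RtoC (1 - q)) H = Cmult w D.
Proof.
intros hq hH hD E.
assert (A : csum (fun n => match n with O => RtoC 0 | S k => Cmult (RtoC q) (h k) end)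
  (Cplus (RtoC 0) (Cmult (RtoC q) H))).
{ apply (csum_decr_1 (fun n => match n with O => RtoC 0 | S k => Cmult (RtoC q) (h k) end)).
  apply csum_scal, hH. }
assert (B : csum (fun n => match n with O => RtoC 0 | S k => Cmult (RtoC q) (h k) end)
  (Cplus H (Cmult (Copp w) D))).
{ eapply csum_ext; [|apply (csum_plus _ _ _ _ hH (csum_scal (Copp w) _ _ hD))].
  intros n. rewrite E. ring. }
pose proof (csum_unique _ _ _ A B) as U.
rewrite RtoC_minus.
replace (Cmult w D) with (Cminus H (Cplus H (Cmult (Copp w) D))) by ring.
rewrite <- U. ring.
Qed.

Lemma cre_hs_weyl (beta s : R) (z : C) (W : bop) : 0 < beta -> 0 <= s <= 1 -> is_weyl z W ->
  hs_inner (cre_hs beta s) (embed_hs beta s W)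
  = Cmult (RtoC (exp (- (beta * s)))) (Cmult z (wtrace beta W)).
Proof.
intros h hs hW. pose proof (exp_neg_lt_1 beta h) as hq. set (q := exp (- beta)) in *.
pose proof (proj1 (weyl_expansion beta s z W _ h hs hW (entry_functional 0 0))) as r.
(* The part of the squared subdiagonal weights independent of k; what remains is q^k, the weight in
   [wtrace]. *)
set (K := (1 - q) * exp (- (beta * s))).
assert (hK : 0 < K) by (apply Rmult_lt_0_compat; [lra|apply exp_pos]).
set (f := fun k => Cmult (RtoC (q ^ k * sqrt (INR (S k)))) (entry W (S k) k)).
set (H := hs_inner (cre_hs beta s) (embed_hs beta s W)).
assert (hf : csum f (Cmult (RtoC (/ K)) H)).
{ eapply csum_ext; [|apply csum_scal, (cre_hs_pairing beta s (embed_hs beta s W) h hs)].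
  intros k. unfold f, embed_hs. cbv beta. rewrite mat_op_entry by exact r.
  rewrite !Cmult_assoc, <- !RtoC_mult. do 2 f_equal.
  transitivity (/ K * wt beta s (S k) k ^ 2 * sqrt (INR (S k))); [ring|].
  rewrite wt_sq by assumption. fold q.
  replace (- (beta * (s * INR (S k) + (1 - s) * INR k))) with (- (beta * s) + INR k * - beta)
    by (rewrite S_INR; ring).
  rewrite exp_plus, <- exp_pow. fold q. unfold K. field.
  split; [apply Rgt_not_eq, exp_pos|lra]. }
pose proof (shift_solve q z f _ _ _ ltac:(lra) hf (wtrace_csum beta W h)) as E.
assert (E' : Cmult (RtoC (1 - q)) (Cmult (RtoC (/ K)) H) = Cmult z (wtrace beta W)).
(* The first argument of the pairing enters through its adjoint, so pairing with a^dagger calls for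
   the commutation with a. *)
{ apply E. intros n. pose proof (weyl_ann z W n n hW) as C1. fold q.
  destruct n as [|k].
  - simpl (INR 0) in C1. rewrite sqrt_0, Cmult_0_l in C1. unfold f. change (q ^ 0) with 1.
    rewrite RtoC_mult. etransitivity; [exact C1|ring].
  - simpl (pred (S k)) in C1. unfold f.
    transitivity (RtoC (q ^ (S k)) * (sqrt (INR (S k)) * entry W (S k) k))%C.
    + simpl (q ^ S k). rewrite !RtoC_mult. ring.
    + rewrite C1, RtoC_mult. ring. }
rewrite <- E'. rewrite !Cmult_assoc, <- !RtoC_mult.
replace (exp (- (beta * s)) * (1 - q) * / K) with 1; [ring|].
unfold K. field. split; [apply Rgt_not_eq, exp_pos|lra].
Qed.

Lemma ann_hs_weyl (beta s : R) (z : C) (W : bop) : 0 < beta -> 0 <= s <= 1 -> is_weyl z W ->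
  hs_inner (ann_hs beta s) (embed_hs beta s W)
  = Copp (Cmult (RtoC (exp (- (beta * (1 - s))))) (Cmult (Cconj z) (wtrace beta W))).
Proof.
intros h hs hW. pose proof (exp_neg_lt_1 beta h) as hq. set (q := exp (- beta)) in *.
pose proof (proj1 (weyl_expansion beta s z W _ h hs hW (entry_functional 0 0))) as r.
set (K := (1 - q) * exp (- (beta * (1 - s)))).
assert (hK : 0 < K) by (apply Rmult_lt_0_compat; [lra|apply exp_pos]).
set (f := fun k => Cmult (RtoC (q ^ k * sqrt (INR (S k)))) (entry W k (S k))).
set (H := hs_inner (ann_hs beta s) (embed_hs beta s W)).
assert (hf : csum f (Cmult (RtoC (/ K)) H)).
{ eapply csum_ext; [|apply csum_scal, (ann_hs_pairing beta s (embed_hs beta s W) h hs)].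
  intros k. unfold f, embed_hs. cbv beta. rewrite mat_op_entry by exact r.
  rewrite !Cmult_assoc, <- !RtoC_mult. do 2 f_equal.
  transitivity (/ K * wt beta s k (S k) ^ 2 * sqrt (INR (S k))); [ring|].
  rewrite wt_sq by assumption. fold q.
  replace (- (beta * (s * INR k + (1 - s) * INR (S k)))) with (- (beta * (1 - s)) + INR k * - beta)
    by (rewrite S_INR; ring).
  rewrite exp_plus, <- exp_pow. fold q. unfold K. field.
  split; [apply Rgt_not_eq, exp_pos|lra]. }
pose proof (shift_solve q (Copp (Cconj z)) f _ _ _ ltac:(lra) hf (wtrace_csum beta W h)) as E.
assert (E' : Cmult (RtoC (1 - q)) (Cmult (RtoC (/ K)) H) = Cmult (Copp (Cconj z)) (wtrace beta W)).
{ apply E. intros n. pose proof (weyl_cre z W n n hW) as C1. fold q.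
  assert (C2 : f n = (RtoC (q ^ n) * (sqrt (INR (S n)) * entry W n (S n)))%C).
  { unfold f. rewrite RtoC_mult. ring. }
  rewrite C2, C1. destruct n as [|k].
  - simpl (INR 0). rewrite sqrt_0. ring.
  - simpl (pred (S k)). unfold f. simpl (q ^ S k). rewrite !RtoC_mult. ring. }
replace (Copp (Cmult (RtoC (exp (- (beta * (1 - s))))) (Cmult (Cconj z) (wtrace beta W))))
  with (Cmult (RtoC (exp (- (beta * (1 - s))))) (Cmult (Copp (Cconj z)) (wtrace beta W))) by ring.
rewrite <- E'. rewrite !Cmult_assoc, <- !RtoC_mult.
replace (exp (- (beta * (1 - s))) * (1 - q) * / K) with 1; [ring|].
unfold K. field. split; [apply Rgt_not_eq, exp_pos|lra].
Qed.

(** * The adjoint on first-order polynomials *)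

Lemma functional_comb (F G : hs -> C) (k l : C) : functional F -> functional G ->
  functional (fun U => Cplus (Cmult k (F U)) (Cmult l (G U))).
Proof.
intros hF hG. split.
- intros X Y. rewrite (fun_plus _ hF), (fun_plus _ hG). ring.
- intros c X. rewrite (fun_scal _ hF), (fun_scal _ hG). ring.
- destruct (fun_bd _ hF) as [K [hK bF]]. destruct (fun_bd _ hG) as [L [hL bG]].
  pose proof (Cmod_ge_0 k). pose proof (Cmod_ge_0 l).
  exists (Cmod k * K + Cmod l * L).
  split; [apply Rplus_le_le_0_compat; apply Rmult_le_pos; assumption|].
  intros X. eapply Rle_trans; [apply Cmod_triangle|]. rewrite !Cmod_mult.
  rewrite Rmult_plus_distr_r, !Rmult_assoc.
  apply Rplus_le_compat; apply Rmult_le_compat_l; auto.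
Qed.

Lemma wtrace_invariant (p : gauss_param) (W : C -> bop) (T : R -> bop -> bop) (beta t : R) (z : C) :
  gaussian_action p W T -> zeta p = RtoC 0 -> 0 < beta ->
  invariant_state T (thermal_state beta) -> 0 <= t ->
  Cmult (RtoC (cfact p t z)) (wtrace beta (W (expZ p t z))) = wtrace beta (W z).
Proof.
intros hg hz h [_ hi] ht. pose proof (hi t (W z) ht) as E.
rewrite !trace_thermal in E by assumption.
rewrite (gaussian_action_weyl p W T t z hg hz ht) in E.
replace (wtrace beta (bop_scal (RtoC (cfact p t z)) (W (expZ p t z)))) with
  (Cmult (RtoC (cfact p t z)) (wtrace beta (W (expZ p t z)))) in E.
2:{ symmetry. apply csum_Cseries.
    eapply csum_ext; [|apply csum_scal, (wtrace_csum beta (W (expZ p t z)) h)].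
    intros n. change (cfact p t z * (RtoC (exp (- beta) ^ n) * entry (W (expZ p t z)) n n) =
      RtoC (exp (- beta) ^ n) * (cfact p t z * entry (W (expZ p t z)) n n))%C. ring. }
pose proof (exp_neg_lt_1 beta h).
assert (E1 : Cmult (RtoC (/ (1 - exp (- beta)))) (RtoC (1 - exp (- beta))) = RtoC 1).
{ rewrite <- RtoC_mult, Rinv_l by lra. reflexivity. }
apply (f_equal (Cmult (RtoC (/ (1 - exp (- beta)))))) in E.
rewrite !(Cmult_assoc (RtoC (/ (1 - exp (- beta)))) (RtoC (1 - exp (- beta)))), E1 in E.
rewrite !Cmult_1_l in E. exact E.
Qed.

Lemma dual_flow (p : gauss_param) (W : C -> bop) (T : R -> bop -> bop)
  (beta s : R) (Ts : R -> hs -> hs) (t : R) :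
  (forall z, is_weyl z (W z)) -> gaussian_action p W T -> zeta p = RtoC 0 ->
  0 < beta -> 0 <= s <= 1 -> invariant_state T (thermal_state beta) ->
  is_contraction_semigroup Ts -> induces beta s T Ts -> 0 <= t ->
  (forall U, hs_inner (cre_hs beta s) (Ts t U) =
     Cplus (Cmult (xZ p t) (hs_inner (cre_hs beta s) U))
       (Cmult (Copp (Cmult (yZ p t) (RtoC (exp ((1 - 2 * s) * beta))))) (hs_inner (ann_hs beta s) U))) /\
  (forall U, hs_inner (ann_hs beta s) (Ts t U) =
     Cplus (Cmult (Cconj (xZ p t)) (hs_inner (ann_hs beta s) U))
       (Cmult (Copp (Cmult (Cconj (yZ p t)) (RtoC (exp ((2 * s - 1) * beta))))) (hs_inner (cre_hs beta s) U))).
Proof.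
intros hW hg hz h hs hinv hS hi ht.
(* Both sides are bounded functionals of [U], hence by [weyl_total] it suffices to compare them on
   embedded Weyl operators. *)
assert (key : forall X k1 k2,
  (forall z, hs_inner X (Ts t (embed_hs beta s (W z))) =
     Cplus (Cmult k1 (hs_inner (cre_hs beta s) (embed_hs beta s (W z))))
       (Cmult k2 (hs_inner (ann_hs beta s) (embed_hs beta s (W z))))) ->
  forall U, hs_inner X (Ts t U) =
     Cplus (Cmult k1 (hs_inner (cre_hs beta s) U)) (Cmult k2 (hs_inner (ann_hs beta s) U))).
{ intros X k1 k2 hX U.
  set (F := fun U => Cplus (Cmult 1 (hs_inner X (Ts t U)))
    (Cmult (Copp 1) (Cplus (Cmult k1 (hs_inner (cre_hs beta s) U))
       (Cmult k2 (hs_inner (ann_hs beta s) U))))).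
  assert (E : F U = RtoC 0).
  { apply (weyl_total beta s W F h hs hW).
    - apply functional_comb; [|apply functional_comb; apply hs_inner_functional].
      apply (semigroup_functional Ts t (hs_inner X)); auto. apply hs_inner_functional.
    - intros z. unfold F. rewrite hX. ring. }
  unfold F in E.
  match goal with |- ?a = ?b => replace a with (Cplus (Cplus (Cmult 1 a) (Cmult (Copp 1) b)) b) by ring end.
  rewrite E. ring. }
(* The conj z part of z_t turns the pairing with a^dagger into a multiple of conj z times the trace,
   that is, into the pairing with a; this rewrites one constant as a multiple of the other. The
   minus sign comes from [ann_hs_weyl]. *)
assert (eE : RtoC (exp (- (beta * s))) =
  Cmult (RtoC (exp ((1 - 2 * s) * beta))) (RtoC (exp (- (beta * (1 - s)))))).
{ rewrite <- RtoC_mult, <- exp_plus. do 2 f_equal. ring. }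
assert (eE' : RtoC (exp (- (beta * (1 - s)))) =
  Cmult (RtoC (exp ((2 * s - 1) * beta))) (RtoC (exp (- (beta * s))))).
{ rewrite <- RtoC_mult, <- exp_plus. do 2 f_equal. ring. }
assert (act : forall X z, hs_inner X (Ts t (embed_hs beta s (W z))) =
  Cmult (RtoC (cfact p t z)) (hs_inner X (embed_hs beta s (W (expZ p t z))))).
{ intros X z. rewrite (induced_weyl p W T beta s Ts t z) by assumption.
  apply (fun_scal _ (hs_inner_functional X)). }
split.
- intros U. apply key. intros z.
  rewrite act.
  rewrite (cre_hs_weyl beta s z (W z)), (cre_hs_weyl beta s (expZ p t z) (W (expZ p t z))),
    (ann_hs_weyl beta s z (W z)) by auto.
  rewrite <- (wtrace_invariant p W T beta t z hg hz h hinv ht), expZ_xy, eE. ring.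
- intros U. rewrite (key (ann_hs beta s)
    (Copp (Cmult (Cconj (yZ p t)) (RtoC (exp ((2 * s - 1) * beta))))) (Cconj (xZ p t))); [ring|].
  intros z. rewrite act.
  rewrite (cre_hs_weyl beta s z (W z)), (ann_hs_weyl beta s z (W z)),
    (ann_hs_weyl beta s (expZ p t z) (W (expZ p t z))) by auto.
  rewrite <- (wtrace_invariant p W T beta t z hg hz h hinv ht), eE'.
  rewrite (expZ_xy p t z) at 1. rewrite Cplus_conj, !Cmult_conj, Cconj_conj. ring.
Qed.

(** Differentiates t -> F(S_t U) at 0, where [u] is the increment and [l] its derivative. As [U] is
    any vector in the domain, this is how a formula for the dual flow becomes one for the adjoint of
    the generator. *)
Lemma generator_pairing (S : R -> hs -> hs) (U V : hs) (F : hs -> C) (u : R -> C) (l : C) (K : R) :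
  functional F -> generator S U V -> 0 <= K ->
  (forall t, 0 < t <= 1 -> F (S t U) = Cplus (F U) (u t) /\
    Cmod (Cminus (u t) (Cmult (RtoC t) l)) <= K * t ^ 2) ->
  F V = l.
Proof.
intros hF hG hK hu.
destruct (fun_bd _ hF) as [B [hB bF]].
destruct (Req_dec (Cmod (Cminus (F V) l)) 0) as [E|E].
{ apply Cmod_eq_0 in E. replace (F V) with (Cplus (Cminus (F V) l) l) by ring. rewrite E. ring. }
exfalso. pose proof (Cmod_ge_0 (Cminus (F V) l)) as he0.
set (eps := Cmod (Cminus (F V) l)) in *. assert (he : 0 < eps) by lra.
rewrite generator_eps in hG.
assert (he2 : 0 < eps / 2 / (B + 1)) by (repeat apply Rdiv_lt_0_compat; lra).
destruct (filter_ex (F := at_right 0) _ (filter_and _ _ (hG _ he2)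
  (at_right_linear K (eps / 2) hK ltac:(lra)))) as [t [h1 [ht h2]]].
set (Q := scal (RtoC (/ t)) (minus (S t U) U)) in *.
destruct (hu t ht) as [E1 E2].
assert (FQ : F Q = Cmult (RtoC (/ t)) (u t)).
{ unfold Q. rewrite (fun_scal _ hF), (functional_minus _ _ _ hF), E1. ring. }
assert (A1 : Cmod (Cminus (F Q) (F V)) <= eps / 2).
{ rewrite <- (functional_minus _ _ _ hF). eapply Rle_trans; [apply bF|].
  apply Rle_trans with (B * (eps / 2 / (B + 1))).
  - apply Rmult_le_compat_l; [exact hB|apply Rlt_le; exact h1].
  - apply Rle_trans with ((B + 1) * (eps / 2 / (B + 1))); [|right; field; lra].
    apply Rmult_le_compat_r; lra. }
assert (A2 : Cmod (Cminus (F Q) l) < eps / 2).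
{ rewrite FQ.
  assert (Et : Cmult (RtoC (/ t)) (RtoC t) = RtoC 1).
  { rewrite <- RtoC_mult, Rinv_l by lra. reflexivity. }
  replace (Cminus (Cmult (RtoC (/ t)) (u t)) l) with (Cmult (RtoC (/ t)) (Cminus (u t) (Cmult (RtoC t) l))).
  2:{ transitivity (RtoC (/ t) * u t - (RtoC (/ t) * RtoC t) * l)%C; [|rewrite Et]; ring. }
  rewrite Cmod_mult, Cmod_R, Rabs_pos_eq by (apply Rlt_le, Rinv_0_lt_compat; lra).
  apply Rle_lt_trans with (/ t * (K * t ^ 2)).
  - apply Rmult_le_compat_l; [apply Rlt_le, Rinv_0_lt_compat; lra|exact E2].
  - replace (/ t * (K * t ^ 2)) with (K * t) by (field; lra). exact h2. }
assert (A3 : eps <= Cmod (Cminus (F Q) (F V)) + Cmod (Cminus (F Q) l)).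
{ unfold eps. replace (Cminus (F V) l) with (Cplus (Copp (Cminus (F Q) (F V))) (Cminus (F Q) l)) by ring.
  eapply Rle_trans; [apply Cmod_triangle|]. rewrite Cmod_opp. lra. }
lra.
Qed.

Lemma xZ_yZ_taylor (p : gauss_param) : exists K, 0 <= K /\ forall t, 0 < t <= 1 ->
  Cmod (xZ p t - 1 - RtoC t * alpha p) <= K * t ^ 2 /\
  Cmod (yZ p t - RtoC t * (Ci * kappa p)) <= K * t ^ 2.
Proof.
destruct (expZ_taylor p 1) as [K1 [h1 T1]]. destruct (expZ_taylor p Ci) as [K2 [h2 T2]].
exists (K1 + K2). split; [lra|]. intros t ht. specialize (T1 t ht). specialize (T2 t ht).
set (a := (expZ p t 1 - 1 - RtoC t * Zop p 1)%C) in *.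
set (b := (expZ p t Ci - Ci - RtoC t * Zop p Ci)%C) in *.
assert (Z1 : Zop p 1 = Cplus (alpha p) (Ci * kappa p)).
{ unfold Zop, alpha. rewrite Cconj_R. ring. }
assert (Zi : Zop p Ci = Cminus (Cmult (alpha p) Ci) (Ci * kappa p * Ci)).
{ unfold Zop, alpha. rewrite Cconj_Ci. ring. }
assert (Ex : (xZ p t - 1 - RtoC t * alpha p)%C = Cmult (/ 2) (a - Ci * b)).
{ unfold xZ, a, b. rewrite Z1, Zi. set (P := expZ p t 1). set (Q := expZ p t Ci).
  (* Terms that vanish because Ci * Ci = -1 are inserted until the identity becomes rational in [Ci]
     as a free atom. *)
  transitivity ((P - Ci * Q) / 2 - 1 + (1 + Ci * Ci) / 2 - RtoC t * alpha p
    + RtoC t * (alpha p + Ci * kappa p * Ci * Ci - alpha p - Ci * kappa p * Ci * Ci) )%C; [rewrite Ci_sq; field|].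
  replace (RtoC t * alpha p)%C with (RtoC t * (alpha p - Ci * Ci * alpha p) / 2)%C by (rewrite Ci_sq; field).
  transitivity ((P - Ci * Q) / 2 - 1 + (1 + Ci * Ci) / 2 - RtoC t * (alpha p - Ci * Ci * alpha p) / 2
    - RtoC t * Ci * kappa p * (1 + Ci * Ci) / 2)%C; [rewrite Ci_sq|]; field. }
assert (Ey : (yZ p t - RtoC t * (Ci * kappa p))%C = Cmult (/ 2) (a + Ci * b)).
{ unfold yZ, a, b. rewrite Z1, Zi. set (P := expZ p t 1). set (Q := expZ p t Ci).
  transitivity ((P + Ci * Q) / 2 - (1 + Ci * Ci) / 2 - RtoC t * (Ci * kappa p) * (1 - Ci * Ci) / 2
    - RtoC t * alpha p * (1 + Ci * Ci) / 2)%C; [rewrite Ci_sq|]; field. }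
assert (half : Cmod (/ 2)%C = / 2).
{ rewrite <- RtoC_inv, Cmod_R, Rabs_pos_eq; lra. }
assert (cm : Cmod Ci = 1).
{ unfold Cmod. simpl. replace (0 * (0 * 1) + 1 * (1 * 1)) with 1 by ring. apply sqrt_1. }
assert (hb : Cmod (Cmult Ci b) <= K2 * t ^ 2) by (rewrite Cmod_mult, cm; lra).
pose proof (Cmod_ge_0 a). pose proof (Cmod_ge_0 (Cmult Ci b)).
rewrite Ex, Ey, !(Cmod_mult (/ 2)%C), half. split.
- assert (Cmod (a - Ci * b) <= Cmod a + Cmod (Ci * b)).
  { eapply Rle_trans; [apply Cmod_triangle|]. rewrite Cmod_opp. lra. }
  lra.
- pose proof (Cmod_triangle a (Ci * b)%C). lra.
Qed.

Lemma adjoint_comb (L : hs -> hs -> Prop) (X X' Y Y' : hs) (k l : C) :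
  adjoint_graph L X X' -> adjoint_graph L Y Y' ->
  adjoint_graph L (plus (scal k X) (scal l Y)) (plus (scal k X') (scal l Y')).
Proof.
intros h1 h2 U V hUV. rewrite !hs_inner_comb_l, (h1 U V hUV), (h2 U V hUV). reflexivity.
Qed.

Lemma Cmod_comb_le (x y a b f g : C) (K t : R) :
  Cmod (x - a) <= K * t ^ 2 -> Cmod (y - b) <= K * t ^ 2 ->
  Cmod (x * f + y * g - (a * f + b * g)) <= (K * (Cmod f + Cmod g)) * t ^ 2.
Proof.
intros h1 h2.
replace (x * f + y * g - (a * f + b * g))%C with ((x - a) * f + (y - b) * g)%C by ring.
eapply Rle_trans; [apply Cmod_triangle|]. rewrite !Cmod_mult.
pose proof (Cmod_ge_0 f). pose proof (Cmod_ge_0 g).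
replace (K * (Cmod f + Cmod g) * t ^ 2) with (K * t ^ 2 * Cmod f + K * t ^ 2 * Cmod g) by ring.
apply Rplus_le_compat; apply Rmult_le_compat_r; assumption.
Qed.

(** The derivative of [dual_flow] at t = 0 gives coefficients of the functional. Moving them into
    the antilinear slot of the pairing conjugates them, so a^dagger gets conj alpha here and alpha
    in the generator. *)
Lemma cre_adjoint (p : gauss_param) (W : C -> bop) (T : R -> bop -> bop)
  (beta s : R) (Ts : R -> hs -> hs) :
  (forall z, is_weyl z (W z)) -> gaussian_action p W T -> zeta p = RtoC 0 ->
  0 < beta -> 0 <= s <= 1 -> invariant_state T (thermal_state beta) ->
  is_contraction_semigroup Ts -> induces beta s T Ts ->
  adjoint_graph (generator Ts) (cre_hs beta s)
    (plus (scal (Cconj (alpha p)) (cre_hs beta s))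
          (scal (Ci * Cconj (kappa p) * RtoC (exp ((1 - 2 * s) * beta)))%C (ann_hs beta s))).
Proof.
intros hW hg hz h hs hinv hS hi U V hUV.
set (e := exp ((1 - 2 * s) * beta)).
destruct (xZ_yZ_taylor p) as [K [hK hT]].
set (f := hs_inner (cre_hs beta s) U). set (g := Copp (Cmult (RtoC e) (hs_inner (ann_hs beta s) U))).
rewrite hs_inner_comb_l, !Cmult_conj, !Cconj_conj, Cconj_R, Cconj_Ci.
apply (generator_pairing Ts U V (hs_inner (cre_hs beta s))
  (fun t => (xZ p t - 1) * f + yZ p t * g)%C _ (K * (Cmod f + Cmod g))
  (hs_inner_functional _) hUV).
- pose proof (Cmod_ge_0 f). pose proof (Cmod_ge_0 g). apply Rmult_le_pos; lra.
- intros t ht. split.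
  + rewrite (proj1 (dual_flow p W T beta s Ts t hW hg hz h hs hinv hS hi ltac:(lra)) U).
    fold e. unfold g. fold f. ring.
  + destruct (hT t ht) as [a1 a2].
    replace (_ - _)%C with ((xZ p t - 1) * f + yZ p t * g
      - (RtoC t * alpha p * f + RtoC t * (Ci * kappa p) * g))%C.
    * apply Cmod_comb_le; assumption.
    * unfold g. fold f. ring.
Qed.

Lemma ann_adjoint (p : gauss_param) (W : C -> bop) (T : R -> bop -> bop)
  (beta s : R) (Ts : R -> hs -> hs) :
  (forall z, is_weyl z (W z)) -> gaussian_action p W T -> zeta p = RtoC 0 ->
  0 < beta -> 0 <= s <= 1 -> invariant_state T (thermal_state beta) ->
  is_contraction_semigroup Ts -> induces beta s T Ts ->
  adjoint_graph (generator Ts) (ann_hs beta s)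
    (plus (scal (alpha p) (ann_hs beta s))
          (scal (- (Ci * kappa p * RtoC (exp ((2 * s - 1) * beta))))%C (cre_hs beta s))).
Proof.
intros hW hg hz h hs hinv hS hi U V hUV.
set (e := exp ((2 * s - 1) * beta)).
destruct (xZ_yZ_taylor p) as [K [hK hT]].
set (f := hs_inner (ann_hs beta s) U). set (g := Copp (Cmult (RtoC e) (hs_inner (cre_hs beta s) U))).
rewrite hs_inner_comb_l, Copp_conj, !Cmult_conj, Cconj_R.
apply (generator_pairing Ts U V (hs_inner (ann_hs beta s))
  (fun t => (Cconj (xZ p t) - 1) * f + Cconj (yZ p t) * g)%C _ (K * (Cmod f + Cmod g))
  (hs_inner_functional _) hUV).
- pose proof (Cmod_ge_0 f). pose proof (Cmod_ge_0 g). apply Rmult_le_pos; lra.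
- intros t ht. split.
  + rewrite (proj2 (dual_flow p W T beta s Ts t hW hg hz h hs hinv hS hi ltac:(lra)) U).
    fold e. unfold g. fold f. ring.
  + destruct (hT t ht) as [a1 a2].
    replace (_ - _)%C with ((Cconj (xZ p t) - 1) * f + Cconj (yZ p t) * g
      - (RtoC t * Cconj (alpha p) * f + RtoC t * (Cconj Ci * Cconj (kappa p)) * g))%C.
    * rewrite <- Cmod_conj, !Cminus_conj, !Cmult_conj, !Cconj_R in a1.
      rewrite <- Cmod_conj, !Cminus_conj, !Cmult_conj, !Cconj_R in a2.
      apply Cmod_comb_le; assumption.
    * unfold g. fold f. ring.
Qed.

(** * Embedded polynomials *)

Lemma ann_embedded (beta s : R) : 0 < beta -> 0 <= s <= 1 ->
  is_embedded_poly beta s LAnn (ann_hs beta s).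
Proof.
intros h hs x _ n. unfold ann_hs. rewrite mat_op_act by (apply wmono_rapid; assumption).
apply csum_Cseries.
assert (E : diag_act (thermal_weight beta (s / 2))
  (poly_act LAnn (diag_act (thermal_weight beta ((1 - s) / 2)) x)) n =
  Cmult (wmono beta s 0 1 n (S n)) (x (S n))).
{ pose proof (mono_diag 0 1 n) as D. simpl Nat.add in D. unfold wmono.
  rewrite D, fact_S. pose proof (INR_fact_pos n).
  replace (INR (fact n) * (INR (S n) * INR (fact n))) with (INR (S n) * (INR (fact n) * INR (fact n))) by ring.
  rewrite sqrt_mult, sqrt_square by (try apply Rmult_le_pos; apply pos_INR).
  replace (wt beta s n (S n) * (sqrt (INR (S n)) * INR (fact n) / INR (fact n)))
    with (wt beta s n (S n) * sqrt (INR (S n))) by (field; lra).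
  unfold diag_act, wt. cbn [poly_act]. unfold ann. rewrite !RtoC_mult. ring. }
rewrite E.
apply (csum_single (fun k => Cmult (wmono beta s 0 1 n k) (x k)) (S n)).
intros k hk. unfold wmono. rewrite mono_support by (intros l hl; lia). rewrite Rmult_0_r. ring.
Qed.

Lemma cre_embedded (beta s : R) : 0 < beta -> 0 <= s <= 1 ->
  is_embedded_poly beta s LCre (cre_hs beta s).
Proof.
intros h hs x _ n. unfold cre_hs. rewrite mat_op_act by (apply wmono_rapid; assumption).
apply csum_Cseries. destruct n as [|n].
- replace (diag_act _ _ 0%nat) with (RtoC 0) by (unfold diag_act; simpl; ring).
  eapply csum_ext; [|apply csum_zero]. intros k. unfold wmono.
  rewrite mono_support by (intros l hl; lia). rewrite Rmult_0_r. ring.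
- assert (E : diag_act (thermal_weight beta (s / 2))
    (poly_act LCre (diag_act (thermal_weight beta ((1 - s) / 2)) x)) (S n) =
    Cmult (wmono beta s 1 0 (S n) n) (x n)).
  { pose proof (mono_diag 1 0 n) as D. simpl Nat.add in D. unfold wmono.
    rewrite D, fact_S. pose proof (INR_fact_pos n). rewrite (Rmult_assoc (INR (S n))).
    rewrite sqrt_mult, sqrt_square by (try apply Rmult_le_pos; apply pos_INR).
    replace (wt beta s (S n) n * (sqrt (INR (S n)) * INR (fact n) / INR (fact n)))
      with (wt beta s (S n) n * sqrt (INR (S n))) by (field; lra).
    unfold diag_act, wt. cbn [poly_act cre]. rewrite !RtoC_mult. ring. }
  rewrite E.
  apply (csum_single (fun k => Cmult (wmono beta s 1 0 (S n) k) (x k)) n).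
  intros k hk. unfold wmono. rewrite mono_support by (intros l hl; lia). rewrite Rmult_0_r. ring.
Qed.

Lemma embedded_comb (beta s : R) (P Q : ladder_poly) (X Y : hs) (k l : C) :
  is_embedded_poly beta s P X -> is_embedded_poly beta s Q Y ->
  is_embedded_poly beta s (LAdd (LMul (LConst k) P) (LMul (LConst l) Q))
    (plus (scal k X) (scal l Y)).
Proof.
intros hP hQ x hx n.
change (k * X x n + l * Y x n = diag_act (thermal_weight beta (s / 2))
  (poly_act (LAdd (LMul (LConst k) P) (LMul (LConst l) Q))
    (diag_act (thermal_weight beta ((1 - s) / 2)) x)) n)%C.
rewrite (hP x hx n), (hQ x hx n). unfold diag_act at 1 3 5. cbn [poly_act]. ring.
Qed.

(** * The fundamental eigenvalues *)

(** The two matrices have disjoint supports; the entries (0, 1) and (1, 0) separate them. *)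
Lemma ladder_entries (beta s : R) (k l : C) : 0 < beta -> 0 <= s <= 1 ->
  plus (scal k (ann_hs beta s)) (scal l (cre_hs beta s)) = zero -> k = RtoC 0 /\ l = RtoC 0.
Proof.
intros h hs E.
assert (ent : forall m n, (k * wmono beta s 0 1 m n + l * wmono beta s 1 0 m n)%C = RtoC 0).
{ intros m n.
  assert (E1 : entry (hs_bop (plus (scal k (ann_hs beta s)) (scal l (cre_hs beta s)))) m n = RtoC 0)
    by (rewrite E; reflexivity).
  rewrite entry_plus, !entry_scal in E1. unfold ann_hs, cre_hs in E1.
  rewrite !mat_op_entry in E1 by (apply wmono_rapid; assumption). exact E1. }
assert (nz : forall i j, wmono beta s i j i j <> RtoC 0).
{ intros i j E1. unfold wmono in E1. apply RtoC_inj in E1. revert E1. apply Rgt_not_eq.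
  pose proof (mono_diag i j 0) as D. rewrite !Nat.add_0_r in D. rewrite D.
  apply Rmult_lt_0_compat; [apply wt_pos; assumption|].
  apply Rdiv_lt_0_compat; [|apply INR_fact_pos].
  apply sqrt_lt_R0, Rmult_lt_0_compat; apply INR_fact_pos. }
split.
- pose proof (ent 0%nat 1%nat) as H. unfold wmono at 2 in H.
  rewrite (mono_support 1 0 0 1), Rmult_0_r in H by (intros i hi; lia).
  rewrite Cmult_0_r, Cplus_0_r in H.
  destruct (Cmult_eq_0 _ _ H) as [Z|Z]; [exact Z|]. destruct (nz _ _ Z).
- pose proof (ent 1%nat 0%nat) as H. unfold wmono at 1 in H.
  rewrite (mono_support 0 1 1 0), Rmult_0_r in H by (intros i hi; lia).
  rewrite Cmult_0_r, Cplus_0_l in H.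
  destruct (Cmult_eq_0 _ _ H) as [Z|Z]; [exact Z|]. destruct (nz _ _ Z).
Qed.

(** The characteristic equation is mu^2 = a b. Eliminating one coordinate from the two equations
    multiplies the other by mu^2 - h^2, and not both coordinates vanish. *)
Lemma antidiagonal_eigenvalues (a b mu h : C) : Cmult a b = Cmult h h ->
  (exists c1 c2, ~ (c1 = RtoC 0 /\ c2 = RtoC 0) /\
     Cmult mu c1 = Cmult a c2 /\ Cmult mu c2 = Cmult b c1)
  <-> (mu = h \/ mu = Copp h).
Proof.
intros hab. split.
- intros [c1 [c2 [nz [e1 e2]]]].
  assert (E1 : Cmult (Cmult (mu - h) (mu + h)) c1 = RtoC 0).
  { transitivity (mu * (mu * c1) - (h * h) * c1)%C; [ring|]. rewrite e1, <- hab.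
    transitivity (a * (mu * c2) - a * b * c1)%C; [ring|]. rewrite e2. ring. }
  assert (E2 : Cmult (Cmult (mu - h) (mu + h)) c2 = RtoC 0).
  { transitivity (mu * (mu * c2) - (h * h) * c2)%C; [ring|]. rewrite e2, <- hab.
    transitivity (b * (mu * c1) - a * b * c2)%C; [ring|]. rewrite e1. ring. }
  assert (E : Cmult (mu - h) (mu + h) = RtoC 0).
  { apply Cmult_eq_0 in E1. apply Cmult_eq_0 in E2. tauto. }
  apply Cmult_eq_0 in E. destruct E as [E|E]; [left|right].
  + replace mu with (mu - h + h)%C by ring. rewrite E. ring.
  + replace mu with (mu + h - h)%C by ring. rewrite E. ring.
- intros hmu.
  assert (mm : Cmult mu mu = Cmult a b) by (rewrite hab; destruct hmu as [->| ->]; ring).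
  (* The vectors (a, mu) and (mu, b) solve the equations; one of them is nonzero unless a = b = 0,
     when mu = 0 and (1, 0) serves. *)
  destruct (Ceq_dec a 0) as [Za|Za]; [destruct (Ceq_dec b 0) as [Zb|Zb]|].
  + assert (Z : mu = RtoC 0).
    { assert (E : Cmult mu mu = RtoC 0) by (rewrite mm, Za; ring).
      apply Cmult_eq_0 in E. tauto. }
    exists 1%C, 0%C. rewrite Z, Zb. split; [|split; ring].
    intros [E _]. apply RtoC_inj in E. lra.
  + exists mu, b. split; [tauto|]. rewrite mm. split; [reflexivity|ring].
  + exists a, mu. split; [tauto|]. rewrite mm. split; ring.
Qed.

(** Rests on (1 + e^x)(1 + e^(-x)) = (2 cosh(x/2))^2; the minus sign cancels against the square of
    the imaginary unit. *)
Lemma cosh_half_product (k : C) (x : R) :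
  Cmult (Ci * Cconj k * RtoC (1 + exp x)) (- (Ci * k * RtoC (1 + exp (- x)))) =
  Cmult (RtoC (2 * Cmod k * cosh (x / 2))) (RtoC (2 * Cmod k * cosh (x / 2))).
Proof.
transitivity (- (Ci * Ci) * (k * Cconj k) * (RtoC (1 + exp x) * RtoC (1 + exp (- x))))%C; [ring|].
rewrite Ci_sq, <- Cmod2_conj.
replace (- (-1))%C with (RtoC 1) by (apply C_ext; simpl; ring).
rewrite <- !RtoC_mult. f_equal. unfold cosh.
assert (E1 : exp (x / 2) * exp (x / 2) = exp x) by (rewrite <- exp_plus; f_equal; field).
assert (E2 : exp (- (x / 2)) * exp (- (x / 2)) = exp (- x)) by (rewrite <- exp_plus; f_equal; field).
assert (E3 : exp (x / 2) * exp (- (x / 2)) = 1).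
{ rewrite <- exp_plus. replace (x / 2 + - (x / 2)) with 0 by ring. apply exp_0. }
assert (E4 : exp x * exp (- x) = 1).
{ rewrite <- exp_plus. replace (x + - x) with 0 by ring. apply exp_0. }
transitivity (Cmod k ^ 2 * (1 + exp x + exp (- x) + exp x * exp (- x))); [ring|].
transitivity (Cmod k ^ 2 * (exp (x / 2) * exp (x / 2) + exp (- (x / 2)) * exp (- (x / 2))
  + 2 * (exp (x / 2) * exp (- (x / 2))))); [rewrite E1, E2, E3, E4; ring|field].
Qed.

Theorem lemma4p1 (p : gauss_param) (W : C -> bop) (T : R -> bop -> bop)
  (beta s : R) (Ts : R -> hs -> hs)
  (hW : forall z : C, is_weyl z (W z))
  (hT : is_qms T)
  (hgauss : gaussian_action p W T)
  (hstable : stable 2 (drift_matrix p))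
  (hzeta : zeta p = RtoC 0)
  (hbeta : beta = - ln ((Cmod (u1 p) ^ 2 + Cmod (u2 p) ^ 2)
                        / (Cmod (v1 p) ^ 2 + Cmod (v2 p) ^ 2)))
  (hbeta0 : 0 < beta)
  (hkappa : kappa p = (Ci * RtoC (tanh (beta / 2)) * (u1 p * v1 p + u2 p * v2 p))%C)
  (hrho : unique_invariant_state T (thermal_state beta))
  (hfaithful : faithful_state (thermal_state beta))
  (hs01 : 0 <= s <= 1)
  (hTs : is_contraction_semigroup Ts)
  (hind : induces beta s T Ts) :
  exists A Ad : hs,
    is_embedded_poly beta s LAnn A /\ is_embedded_poly beta s LCre Ad /\
    sym_generator beta s Ts A
      (plus (scal (RtoC (-2 * gamma p)) A)
            (scal (- (Ci * kappa p * RtoC (1 + exp ((2 * s - 1) * beta))))%C Ad)) /\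
    sym_generator beta s Ts Ad
      (plus (scal (RtoC (-2 * gamma p)) Ad)
            (scal (Ci * Cconj (kappa p) * RtoC (1 + exp ((1 - 2 * s) * beta)))%C A)) /\
    forall lambda : C,
      eigenvalue_on_span (sym_generator beta s Ts) A Ad lambda <->
      (lambda = RtoC (-2 * gamma p + 2 * Cmod (kappa p) * cosh ((1 - 2 * s) * beta / 2)) \/
       lambda = RtoC (-2 * gamma p - 2 * Cmod (kappa p) * cosh ((1 - 2 * s) * beta / 2))).
Proof.
pose proof (proj1 hrho) as hinv.
assert (hf : forall t z, 0 <= t -> Ts t (field_hs beta s z) = field_hs beta s (expZ p t z)).
{ intros t z ht. apply (induced_field p W T beta s Ts t z); assumption. }
set (A := ann_hs beta s). set (Ad := cre_hs beta s).
pose proof (ann_embedded beta s hbeta0 hs01) as eA. fold A in eA.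
pose proof (cre_embedded beta s hbeta0 hs01) as eAd. fold Ad in eAd.
pose proof (ann_generator p beta s Ts hbeta0 hs01 hTs hf) as gA. fold A Ad in gA.
pose proof (cre_generator p beta s Ts hbeta0 hs01 hTs hf) as gAd. fold A Ad in gAd.
pose proof (ann_adjoint p W T beta s Ts hW hgauss hzeta hbeta0 hs01 hinv hTs hind) as aA.
pose proof (cre_adjoint p W T beta s Ts hW hgauss hzeta hbeta0 hs01 hinv hTs hind) as aAd.
fold A Ad in aA, aAd.
set (e := exp ((1 - 2 * s) * beta)) in *. set (e' := exp ((2 * s - 1) * beta)) in *.
(* Generator and adjoint contribute conjugate diagonal coefficients, so the frequency [Omega p]
   cancels. *)
assert (al : Cplus (alpha p) (Cconj (alpha p)) = RtoC (-2 * gamma p)).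
{ unfold alpha. apply C_ext; simpl; ring. }
set (a := (Ci * Cconj (kappa p) * RtoC (1 + e))%C).
set (b := (- (Ci * kappa p * RtoC (1 + e')))%C).
set (g2 := RtoC (-2 * gamma p)) in *.
(* In the basis ([A], [Ad]) the sum is [g2] times the identity plus an antidiagonal matrix with
   entries [a] and [b]. *)
assert (comb : forall k l : C, exists Y1 Y2,
  adjoint_graph (generator Ts) (plus (scal k A) (scal l Ad)) Y1 /\
  generator Ts (plus (scal k A) (scal l Ad)) Y2 /\
  plus Y1 Y2 = plus (scal (g2 * k + a * l)%C A) (scal (g2 * l + b * k)%C Ad)).
{ intros k l. eexists. eexists. split; [apply (adjoint_comb _ _ _ _ _ k l aA aAd)|].
  split; [apply (generator_comb Ts _ _ _ _ k l hTs gA gAd)|].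
  apply hs_ext. intros m n. rewrite ?entry_plus, ?entry_scal, ?entry_plus, ?entry_scal.
  rewrite <- al. unfold a, b. rewrite !RtoC_plus. ring. }
assert (one : forall (X Y : hs) (k l : C), X = plus (scal k A) (scal l Ad) ->
  Y = plus (scal (g2 * k + a * l)%C A) (scal (g2 * l + b * k)%C Ad) ->
  sym_generator beta s Ts X Y).
{ intros X Y k l -> ->. destruct (comb k l) as [Y1 [Y2 [h1 [h2 h3]]]]. split.
  - eexists. apply (embedded_comb beta s _ _ _ _ k l eA eAd).
  - exists Y1, Y2. split; [exact h1|]. split; [exact h2|]. symmetry. exact h3. }
exists A, Ad. split; [exact eA|]. split; [exact eAd|].
split; [|split].
- apply (one _ _ (RtoC 1) (RtoC 0)); apply hs_ext; intros m n;
    rewrite !entry_plus, !entry_scal; ring.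
- apply (one _ _ (RtoC 0) (RtoC 1)); apply hs_ext; intros m n;
    rewrite !entry_plus, !entry_scal; ring.
- intros lambda.
  set (r := 2 * Cmod (kappa p) * cosh ((1 - 2 * s) * beta / 2)).
  assert (hab : Cmult a b = Cmult (RtoC r) (RtoC r)).
  { unfold a, b, r, e, e'. rewrite <- cosh_half_product. do 4 f_equal. f_equal. f_equal. ring. }
  transitivity (Cminus lambda g2 = RtoC r \/ Cminus lambda g2 = Copp (RtoC r)).
  2:{ assert (Er : RtoC (-2 * gamma p + r) = Cplus g2 (RtoC r)) by (unfold g2; apply RtoC_plus).
      assert (Er' : RtoC (-2 * gamma p - r) = Cminus g2 (RtoC r)) by (unfold g2; apply RtoC_minus).
      rewrite Er, Er'. split; (intros [E|E]; [left|right]).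
      - replace lambda with (lambda - g2 + g2)%C by ring. rewrite E. ring.
      - replace lambda with (lambda - g2 + g2)%C by ring. rewrite E. ring.
      - rewrite E. ring.
      - rewrite E. ring. }
  rewrite <- (antidiagonal_eigenvalues a b (Cminus lambda g2) (RtoC r) hab).
  split.
  (* The hypothesis supplies some adjoint image [Y1'], while the computed one is [Y1]. The generator
     images agree by uniqueness of limits; the adjoint images have to be compared separately. *)
  + intros [c1 [c2 [nz [_ [Y1' [Y2' [h1 [h2 h3]]]]]]]].
    set (X := plus (scal c1 A) (scal c2 Ad)) in *.
    destruct (comb c1 c2) as [Y1 [Y2 [k1 [k2 k3]]]]. fold X in k1, k2.
    pose proof (generator_unique Ts X Y2' Y2 h2 k2) as ->.
    exists c1, c2. split.
    { intros [-> ->]. apply nz. apply hs_ext. intros m n. unfold X.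
      rewrite entry_plus, !entry_scal. change (0 * entry A m n + 0 * entry Ad m n = 0)%C. ring. }
    set (d1 := ((lambda - g2) * c1 - a * c2)%C). set (d2 := ((lambda - g2) * c2 - b * c1)%C).
    set (D := plus (scal d1 A) (scal d2 Ad)).
    (* [D] is the difference of two adjoint images of [X], and it lies in the domain
       of the generator, so it is orthogonal to itself. *)
    assert (hD : D = plus (scal (RtoC 1) Y1') (scal (Copp 1) Y1)).
    { apply hs_ext. intros m n.
      pose proof (f_equal (fun Z : hs => entry (hs_bop Z) m n) h3) as q1.
      pose proof (f_equal (fun Z : hs => entry (hs_bop Z) m n) k3) as q2.
      cbv beta in q1, q2. unfold X in q1.
      rewrite ?entry_plus, ?entry_scal, ?entry_plus, ?entry_scal in q1.
      rewrite ?entry_plus, ?entry_scal, ?entry_plus, ?entry_scal in q2.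
      unfold D. rewrite !entry_plus, !entry_scal. unfold d1, d2.
      transitivity (lambda * (c1 * entry A m n + c2 * entry Ad m n) -
        ((g2 * c1 + a * c2) * entry A m n + (g2 * c2 + b * c1) * entry Ad m n))%C; [ring|].
      rewrite q1, <- q2. ring. }
    assert (D0 : D = zero).
    { apply hs_inner_definite. rewrite hD at 1. rewrite hs_inner_comb_l.
      (* The local name [growth_rate] denotes here the fact that [D] is in the domain of the
         generator; it shadows the constant of the estimates. *)
      pose proof (generator_comb Ts _ _ _ _ d1 d2 hTs gA gAd) as growth_rate. fold D in growth_rate.
      rewrite <- (h1 _ _ growth_rate), <- (k1 _ _ growth_rate).
      rewrite Copp_conj, !Cconj_R. ring. }
    apply (ladder_entries beta s d1 d2 hbeta0 hs01) in D0. destruct D0 as [z1 z2]. split.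
    * replace (Cmult a c2) with (Cplus d1 (Cmult a c2)) by (rewrite z1; ring). unfold d1. ring.
    * replace (Cmult b c1) with (Cplus d2 (Cmult b c1)) by (rewrite z2; ring). unfold d2. ring.
  + intros [c1 [c2 [nz [e1 e2]]]]. exists c1, c2. cbv zeta. split.
    * intros E. apply (ladder_entries beta s c1 c2 hbeta0 hs01) in E. apply nz, E.
    * apply (one _ _ c1 c2); [reflexivity|].
      apply hs_ext. intros m n. rewrite ?entry_scal, ?entry_plus, ?entry_scal.
      rewrite <- e1, <- e2. ring.
Qed.
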